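(* Let $(\mathfrak g,\mathfrak k)$ be a Harish-Chandra pair over $\mathbb C$ with $\mathrm{rk}\,\mathfrak g=\mathrm{rk}\,\mathfrak k$, $\mathfrak h\subset\mathfrak k$ a Cartan subalgebra of both, and $P=P_k\cup P_n$ a positive system of roots of $(\mathfrak g,\mathfrak h)$. Assume that $P_n=P_t$ and that $\mathfrak k=[\mathfrak p,\mathfrak p]$. Let $\alpha_1,\dots,\alpha_r$ be the simple roots of $P_k$, let $\mathfrak p^+=\bigoplus_{1\le i\le s}\mathfrak p_i^+$ be the decomposition of $\mathfrak p^+$ into irreducible $\mathfrak k$-modules, and let $\beta_i$ be the lowest root of $\mathfrak p_i^+$ (its lowest weight relative to $P_k$). Then $\{\alpha_1,\dots,\alpha_r,\beta_1,\dots,\beta_s\}$ is the set of simple roots of $P$. Moreover: (a) $r+s=\dim\mathfrak h$. (b) $s=\dim\mathfrak c$, where $\mathfrak c$ is the center of $\mathfrak k$, and the restrictions of $\beta_1,\dots,\beta_s$ to $\mathfrak c$ are linearly independent. (c) If $\beta$ is a non-compact positive root, there are exactly one $i$ ($1\le i\le s$) and integers $m_j\ge 0$ such that $\beta=\beta_i+m_1\alpha_1+\dots+m_r\alpha_r$; $i$ and the $m_j$ are uniquely determined by $\beta$. In particular $[\mathfrak p^+,\mathfrak p^+]=0$. (d) $\mathfrak g$ decomposes as the direct sum of $s$ $\theta$-stable ideals $\mathfrak g_i=\mathfrak k_i\oplus\mathfrak p_i$, where $\mathfrak p_i=\mathfrak p_i^+\oplus\mathfrak p_i^-$ and $\mathfrak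 k_i=[\mathfrak p_i,\mathfrak p_i]$. For each of these, all positive non-compact roots are totally positive, and the center of $\mathfrak k_i$ has dimension $1$. In particular each $\mathfrak g_i$ is simple. (e) $s$ is the number of irreducible components of $\mathfrak p^+$ as a $\mathfrak k$-module. In particular, $\mathfrak g$ is simple if and only if $\mathfrak p^+$ is irreducible.
   Context: A Harish-Chandra pair $(\mathfrak g,\mathfrak k)$ over $\mathbb C$: $\mathfrak g$ is a complex semisimple Lie algebra, $\mathfrak k$ is the fixed point set of an involutive automorphism $\theta$ of $\mathfrak g$, and $\mathfrak k$ is reductive in $\mathfrak g$; $\mathfrak p$ is the $(-1)$-eigenspace of $\theta$, so $\mathfrak g=\mathfrak k\oplus\mathfrak p$. Each root space $\mathfrak g_\alpha$ of $(\mathfrak g,\mathfrak h)$ lies in $\mathfrak k$ or in $\mathfrak p$; $\alpha$ is called compact or non-compact accordingly. $P_k$, $P_n$ are the sets of compact and non-compact roots in $P$, and $\mathfrak p^{\pm}=\bigoplus_{\beta\in P_n}\mathfrak g_{\pm\beta}$. A root $\beta$ is totally positive if $\mathfrak g_\beta$ is contained in a subspace of $\mathfrak p^+$ that is stable under $\mathrm{ad}\,\mathfrak k$; $P_t$ is the set of totally positive roots. When $P_n=P_t$, $\mathfrak p^+$ is $\mathrm{ad}\,\mathfrak k$-stable and multiplicity free, so its decomposition into irreducible $\mathfrak k$-modules is unique up to order; each $\mathfrak p_i^+$ is a sum of root spaces, and $\mathfrak p_i^-$ is the sum of the root spaces for the negatives of the roots occurring in $\mathfrak p_i^+$. *)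

(* Defs.v *)
From HB Require Import structures.
From mathcomp Require Import all_boot all_order all_algebra.

Set Implicit Arguments.
Unset Strict Implicit.
Unset Printing Implicit Defensive.

Import GRing.Theory.
Local Open Scope ring_scope.

HB.mixin Record isLieAlgebra (F : fieldType) L of Vector F L := {
  lie : L -> L -> L;
  lie_linearl : forall (a : F) (x y z : L),
    lie (a *: x + y) z = a *: lie x z + lie y z;
  lie_linearr : forall (a : F) (x y z : L),
    lie x (a *: y + z) = a *: lie x y + lie x z;
  liexx : forall x : L, lie x x = 0;
  lie_jacobi : forall x y z : L,
    lie x (lie y z) + lie y (lie z x) + lie z (lie x y) = 0
}.

(* Finite-dimensional Lie algebras, since a vectType is finite-dimensional. *)
#[short(type="lieAlgType")]
HB.structure Definition LieAlgebra (F : fieldType) :=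
  { L of isLieAlgebra F L & Vector F L }.

(* Subalgebras and ideals are {vspace L}; notions "of A" below take a
   subalgebra A of L, the algebra L itself being fullv. *)
Section LieAlgebraDefs.
Variables (F : fieldType) (L : lieAlgType F).
Implicit Types (x y z : L) (A H I K U V W : {vspace L}).

Lemma lie_is_linear x : linear (lie x : L -> L).
Proof. by move=> a y z; rewrite lie_linearr. Qed.
HB.instance Definition _ x :=
  GRing.isLinear.Build F L L _ (lie x : L -> L) (lie_is_linear x).

Definition ad x : 'End(L) := linfun (lie x).

Lemma adE x y : ad x y = lie x y.
Proof. by rewrite lfunE. Qed.

Lemma lieC x y : lie x y = - lie y x.
Proof.
have addl u v w : lie (u + v) w = lie u w + lie v w :> L.
  by rewrite -[u in LHS]scale1r lie_linearl scale1r.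
apply/eqP; rewrite -addr_eq0; apply/eqP.
have := liexx (x + y).
by rewrite addl !linearD /= !liexx add0r addr0.
Qed.

(* [U, V], the span of all brackets (see lie_prodP), presented as prodv is
   for associative algebras. *)
Definition lie_prod U V : {vspace L} :=
  <<[seq lie x y | x <- vbasis U, y <- vbasis V]>>%VS.

Lemma lie_prodP U V W :
  reflect (forall x y, x \in U -> y \in V -> lie x y \in W)
          (lie_prod U V <= W)%VS.
Proof.
apply: (iffP idP) => [sUVW x y Ux Vy | UVW]; last first.
  apply/span_subvP => _ /allpairsP[[x y] /= [Ux Vy ->]].
  by apply: UVW; apply: vbasis_mem.
rewrite (coord_vbasis Vy) linear_sum /=.
apply: memv_suml => j _; rewrite linearZ /=; apply: memvZ.
rewrite lieC memvN (coord_vbasis Ux) linear_sum /=.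
apply: memv_suml => i _; rewrite linearZ /=; apply: memvZ.
rewrite lieC memvN; apply: (subvP sUVW); apply: memv_span.
by apply: allpairs_f; apply: mem_nth; rewrite size_tuple.
Qed.

Definition subalgebra A : bool := (lie_prod A A <= A)%VS.

Definition lie_ideal A I : bool := (I <= A)%VS && (lie_prod A I <= I)%VS.

Definition solvable_algebra A : Prop :=
  exists n, iter n (fun U => lie_prod U U) A = 0%VS.

Definition nilpotent_algebra A : Prop := exists n, iter n (lie_prod A) A = 0%VS.

Definition semisimple_algebra A : Prop :=
  forall I, lie_ideal A I -> solvable_algebra I -> I = 0%VS.

Definition simple_algebra A : Prop :=
  lie_prod A A <> 0%VS /\ forall I, lie_ideal A I -> I = 0%VS \/ I = A.

Definition lie_center A : {vspace L} :=
  (A :&: \bigcap_(y <- vbasis A) lker (ad y))%VS.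

Lemma lie_centerP A x :
  reflect (x \in A /\ forall y, y \in A -> lie x y = 0) (x \in lie_center A).
Proof.
have capP (s : seq L) : (x \in (\bigcap_(y <- s) lker (ad y))%VS)
    = all (fun y => lie x y == 0) s.
  elim: s => [|y s IHs]; first by rewrite big_nil memvf.
  by rewrite big_cons memv_cap memv_ker adE IHs lieC oppr_eq0.
rewrite memv_cap capP; apply: (iffP andP) => [[Ax /allP cx] | [Ax cx]].
  split=> // y Ay; rewrite (coord_vbasis Ay) linear_sum /= big1 // => i _.
  rewrite linearZ /= (eqP (cx _ _)) ?scaler0 //.
  by apply: mem_nth; rewrite size_tuple.
by split=> //; apply/allP=> y /vbasis_mem Ay; rewrite cx.
Qed.

Definition ad_stable K U : bool := (lie_prod K U <= U)%VS.

Definition irreducible_module K V : Prop :=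
  [/\ ad_stable K V, V <> 0%VS &
      forall U, (U <= V)%VS -> ad_stable K U -> U = 0%VS \/ U = V].

(* directv inspects the syntax of its argument, and would also require the sums
   hidden in concrete summands to be direct; the variables U, W and W i below
   are atomic for it. *)
Definition direct_sum V n (W : 'I_n -> {vspace L}) : Prop :=
  V = (\sum_(i < n) W i)%VS /\ directv (\sum_(i < n) W i).

Definition direct_sum2 V U W : Prop := V = (U + W)%VS /\ directv (U + W).

Definition irreducible_decomposition K V n (W : 'I_n -> {vspace L}) : Prop :=
  direct_sum V W /\ forall i, irreducible_module K (W i).

(* K is reductive in A: A is a semisimple K-module under ad. *)
Definition reductive_in A K : Prop :=
  [/\ (K <= A)%VS, subalgebra K &
      forall U, (U <= A)%VS -> ad_stable K U ->
        exists2 W, ad_stable K W & direct_sum2 A U W].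

Definition cartan_subalgebra A H : Prop :=
  [/\ (H <= A)%VS, subalgebra H, nilpotent_algebra H &
      forall x, x \in A -> (forall y, y \in H -> lie x y \in H) -> x \in H].

Definition has_rank A (n : nat) : Prop :=
  exists2 H, cartan_subalgebra A H & \dim H = n.

Definition involution (theta : 'End(L)) : Prop :=
  (forall x y, theta (lie x y) = lie (theta x) (theta y)) /\
  (forall x, theta (theta x) = x).

Definition harish_chandra_pair (theta : 'End(L)) K : Prop :=
  [/\ semisimple_algebra fullv, involution theta,
      K = fixedSpace theta & reductive_in fullv K].

Definition dual_space H := 'Hom(subvs_of H, F^o).

(* The restriction to U of a functional on H, meaningful when U <= H: vsproj H
   is then the inclusion on U. *)
Definition restrict_dual U H (f : dual_space H) : dual_space U :=
  (f \o linfun (fun x : subvs_of U => vsproj H (vsval x)))%VF.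

Definition root_space A H (a : dual_space H) : {vspace L} :=
  (A :&: \bigcap_(t <- vbasis {: subvs_of H})
           passmx.leigenspace (ad (vsval t)) (a t))%VS.

Lemma root_spaceP A H (a : dual_space H) x :
  reflect (x \in A /\ forall t : subvs_of H, lie (vsval t) x = (a t : F) *: x)
          (x \in root_space A a).
Proof.
have capP (s : seq (subvs_of H)) :
    (x \in (\bigcap_(t <- s) passmx.leigenspace (ad (vsval t)) (a t))%VS)
    = all (fun t => lie (vsval t) x == (a t : F) *: x) s.
  elim: s => [|t s IHs]; first by rewrite big_nil memvf.
  rewrite big_cons memv_cap IHs memv_ker add_lfunE opp_lfunE scale_lfunE.
  by rewrite id_lfunE adE subr_eq0.
rewrite memv_cap capP; apply: (iffP andP) => [[Ax /allP ex] | [Ax ex]].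
  split=> // t; rewrite (coord_vbasis (memvf t)) !linear_sum /= scaler_suml.
  rewrite lieC linear_sum /= -sumrN; apply: eq_bigr => i _.
  rewrite !linearZ /= -lieC (eqP (ex _ _)) ?scalerA //.
  by apply: mem_nth; rewrite size_tuple.
by split=> //; apply/allP=> t _; rewrite ex.
Qed.

Definition is_root A H (a : dual_space H) : bool :=
  (a != 0) && (root_space A a != 0%VS).

(* Sets of roots, which are finite, are given as sequences. *)
Definition positive_system A H (P : seq (dual_space H)) : Prop :=
  [/\ forall a, a \in P -> is_root A a,
      forall a, is_root A a -> (a \in P) (+) (- a \in P) &
      forall a b, a \in P -> b \in P -> is_root A (a + b) -> a + b \in P].

Definition simple_root H (P : seq (dual_space H)) (a : dual_space H) : Prop :=
  a \in P /\ forall b c, b \in P -> c \in P -> a <> b + c.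

(* The roots of P whose root spaces lie in U: P_k for U = k, P_n for U = p. *)
Definition roots_in A H (P : seq (dual_space H)) U : seq (dual_space H) :=
  [seq a <- P | (root_space A a <= U)%VS].

(* Applied to P_n, these are p^+ and p^-. *)
Definition sum_root_spaces A H (P : seq (dual_space H)) : {vspace L} :=
  (\sum_(a <- P) root_space A a)%VS.

Definition sum_opp_root_spaces A H (P : seq (dual_space H)) : {vspace L} :=
  (\sum_(a <- P) root_space A (- a))%VS.

Definition totally_positive A H K (Pn : seq (dual_space H)) (b : dual_space H) : Prop :=
  is_root A b /\
  exists U, [/\ (root_space A b <= U)%VS, (U <= sum_root_spaces A Pn)%VS &
                ad_stable K U].

(* b is the weight of a nonzero vector of V killed by the root spaces of
   the negatives of the roots in Pk. *)
Definition lowest_weight A H (Pk : seq (dual_space H)) V (b : dual_space H) : Prop :=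
  exists v, [/\ v != 0, v \in (V :&: root_space A b)%VS &
    forall a x, a \in Pk -> x \in root_space A (- a) -> lie x v = 0].

End LieAlgebraDefs.

(* Main.v *)
(* The vanishing of the trace of [e, f] on sums of weight spaces stable under
   e and f is the engine. It makes the weights rational multiples of one another
   on [e, f], which gives Cartan's criterion: the Killing form is nondegenerate,
   so h is abelian and acts diagonally. It also gives the elementary theory of
   roots, without representations of sl_2.

   If b, c in P_n and b + c were a root, then -(b + c) would be compact and
   b - (b + c) = -c would be in P_n by k-stability of p^+; hence [p^+, p^+] = 0 and
   every root of p^+ involves exactly one noncompact simple root. The roots of p^+
   involving a given one span a k-submodule, so these simple roots are the lowest
   roots of the p_i^+. The difference of roots of distinct p_i^+ is never a root,
   so the g_i commute; since k = [p, p], they are ideals with sum g. *)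

Require Import Defs.
From HB Require Import structures.
From mathcomp Require Import all_boot all_order all_algebra.
From mathcomp Require Import reals complex boolp.

Set Implicit Arguments.
Unset Strict Implicit.
Unset Printing Implicit Defensive.

Import Order.TTheory GRing.Theory Num.Theory.
Local Open Scope ring_scope.

(** * Traces of endomorphisms *)

Section MatrixTrace.
Variable F : fieldType.

(** If [e] and [f] have weights a and -a, the sum of the weight spaces along b + Z a is stable under
    both, so the trace of x = [e, f] there is zero; solving for b(x) gives b(x) = q a(x) with q
    rational. Only the reality of q is recorded: the Killing form at (x, x) is then a(x)^2 times a
    sum of real squares, and its vanishing kills all weights at x. A second obstacle is that only
    the weight vectors of an ideal are seen to be ad-nilpotent, not their sums, so Engel's theorem
    is needed for sets closed under brackets alone. Once the Killing form is nondegenerate,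
    derivations are inner, and the semisimple part of ad x is recovered as an element of h. A
    positive system is a combinatorial datum here, with no linear functional behind it: sums of
    positive roots are shown to be nonzero by induction, and the sum of all positive roots, whose
    product with a simple root a is (a, a), later serves as the functional. *)

Lemma full_rank_factorization m n (A : 'M[F]_(m, n)) :
  exists r (C : 'M_(m, r)) (B : 'M_(r, n)) (D : 'M_(r, m)),
    [/\ r = \rank A, A = C *m B, D *m C = 1%:M & row_free B].
Proof.
exists (\rank A), (col_base A), (row_base A).
have /row_freeP[D colD] : row_free (col_base A)^T.
  by rewrite /row_free mxrank_tr; have := col_base_full A.
exists D^T; split; rewrite ?mulmx_base ?row_base_free //.
by rewrite -[col_base A]trmxK -trmx_mul colD trmx1.
Qed.

(** With A = C B a full rank factorization, tr (C B) = tr (B C), and B C is nilpotent with exponent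
    one less; induction on the exponent. *)
Lemma mxtrace_nilpotent k n (A : 'M[F]_n) :
  (forall u : 'rV_n, iter k (mulmxr A) u = 0) -> \tr A = 0.
Proof.
elim: k => [|k IHk] in n A * => [A0 | nilA].
  suff ->: A = 0 by rewrite mxtrace0.
  by apply/row_matrixP => i; rewrite row0; apply: A0.
have [r [C [B [D [defr defA DC freeB]]]]] := full_rank_factorization A.
rewrite defA mxtrace_mulC; apply: IHk => w.
apply: (row_free_inj freeB); rewrite mul0mx.
have iterE j u : iter j (mulmxr (B *m C)) u *m B = iter j (mulmxr A) (u *m B).
  by elim: j => //= j <-; rewrite defA !mulmxA.
rewrite iterE -[w]mulmx1 -DC -[RHS](nilA (w *m D)) iterSr /=.
by congr (iter k _ _); rewrite defA !mulmxA.
Qed.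

(** Cancelling the full rank factors in C B C B = C B leaves B C = 1, of size the rank. *)
Lemma mxtrace_idempotent n (A : 'M[F]_n) :
  A *m A = A -> \tr A = (\rank A)%:R.
Proof.
have [r [C [B [D [defr defA DC freeB]]]]] := full_rank_factorization A.
move=> AA; rewrite [in LHS]defA mxtrace_mulC.
suff ->: B *m C = 1%:M by rewrite mxtrace1 defr.
apply: (row_free_inj freeB).
rewrite mul1mx -[RHS]mul1mx -DC -!mulmxA -defA -[in RHS]AA.
by rewrite !defA !mulmxA DC mul1mx.
Qed.

End MatrixTrace.

Section EndomorphismTrace.
Import VectorInternalTheory.
Variables (F : fieldType) (vT : vectType F).
Implicit Types (f g e : 'End(vT)) (U V : {vspace vT}).

Definition lfun_trace f : F := \tr (f2mx f).

Lemma lfun_apply f v :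
  f v = r2v
          (v2r v *m f2mx f).
Proof. by rewrite /fun_of_lfun [in LHS]unlock. Qed.

Lemma f2mx_lin (a : F) f g : f2mx (a *: f + g) =
  a *: f2mx f + f2mx g.
Proof.
apply/row_matrixP => i; rewrite !rowE mulmxDr -scalemxAr.
apply: r2v_inj.
rewrite linearD linearZ /= -[delta_mx _ _]r2vK -!lfun_apply.
by rewrite add_lfunE scale_lfunE.
Qed.

Lemma f2mx_comp f g : f2mx (f \o g)%VF =
  f2mx g *m f2mx f.
Proof.
apply/row_matrixP => i; rewrite !rowE mulmxA.
apply: r2v_inj.
rewrite -[delta_mx _ _]r2vK -lfun_apply comp_lfunE.
by rewrite !lfun_apply !r2vK.
Qed.

Lemma lfun_traceP (a : F) f g :
  lfun_trace (a *: f + g) = a * lfun_trace f + lfun_trace g.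
Proof. by rewrite /lfun_trace f2mx_lin mxtraceD mxtraceZ. Qed.

Lemma lfun_traceD f g : lfun_trace (f + g) = lfun_trace f + lfun_trace g.
Proof. by rewrite -[f]scale1r lfun_traceP mul1r scale1r. Qed.

Lemma lfun_trace0 : lfun_trace 0 = 0.
Proof. by apply: (addrI (lfun_trace 0)); rewrite -lfun_traceD !addr0. Qed.

Lemma lfun_traceB f g : lfun_trace (f - g) = lfun_trace f - lfun_trace g.
Proof. by rewrite addrC -scaleN1r lfun_traceP mulN1r addrC. Qed.

Lemma lfun_trace_sum (I : finType) (fs : I -> 'End(vT)) :
  lfun_trace (\sum_i fs i) = \sum_i lfun_trace (fs i).
Proof. exact: (big_morph lfun_trace lfun_traceD lfun_trace0). Qed.

Lemma lfun_traceC f g : lfun_trace (f \o g)%VF = lfun_trace (g \o f)%VF.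
Proof. by rewrite /lfun_trace !f2mx_comp mxtrace_mulC. Qed.

Lemma lfun_trace_nilpotent k f :
  (forall v, iter k f v = 0) -> lfun_trace f = 0.
Proof.
move=> nilf; apply: (@mxtrace_nilpotent _ k) => u.
apply: r2v_inj; rewrite linear0.
rewrite -(nilf (r2v u)).
elim: k {nilf} => //= k IHk.
by rewrite -IHk lfun_apply r2vK.
Qed.

Lemma lfun_trace_idempotent e :
  (e \o e)%VF = e -> lfun_trace e = (\dim (limg e))%:R.
Proof.
move=> ee; rewrite /lfun_trace mxtrace_idempotent -?f2mx_comp ?ee //.
have imE : (vs2mx (limg e) :=: f2mx e)%MS.
  apply: eqmx_trans (_ : (vs2mx (@fullv _ vT) *m f2mx e)%R :=: _)%MS.
    by rewrite unlock; apply: mx2vsK.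
  by apply: eqmx_trans (eqmxMr _ (mx2vsK _)) _; rewrite mul1mx.
by rewrite /dimv imE.
Qed.

(** On maps preserving [U], composing with the projection to [U] is multiplicative, so the
    compression of the commutator is the commutator of the compressions. *)
Lemma lfun_trace_commutator0 U f g :
    {in U, forall v, f v \in U} -> {in U, forall v, g v \in U} ->
  lfun_trace (((f \o g) - (g \o f)) \o projv U)%VF = 0.
Proof.
move=> fU gU.
have splitE f' g' : {in U, forall v, g' v \in U} ->
    ((f' \o g') \o projv U = (f' \o projv U) \o (g' \o projv U))%VF.
  move=> g'U; apply/lfunP => v; rewrite !comp_lfunE.
  by rewrite [projv U (g' _)]projv_id // g'U // memv_proj.
rewrite comp_lfunDl comp_lfunNl lfun_traceB !splitE //.
by rewrite lfun_traceC subrr.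
Qed.

(** On each block, [f] is the scalar [c i] plus a nilpotent map; a scalar times an idempotent has
    trace [c i] times its rank. *)
Lemma block_trace (I : finType) (V : I -> {vspace vT}) (c : I -> F) f :
    directv (\sum_i V i) ->
    (forall i, {in V i, forall v, f v \in V i}) ->
    (forall i, exists n, {in V i, forall v, iter n (f - c i *: \1)%VF v = 0}) ->
  lfun_trace (f \o projv (\sum_i V i))%VF = \sum_i c i *+ \dim (V i).
Proof.
set W := (\sum_i V i)%VS => dxV fV nilf.
have defW : W = (\sum_i V i)%VS by [].
(* The idempotents of the decomposition, extended by zero on the chosen complement of [W]. *)
pose e i : 'End(vT) := (sumv_pi_for defW i \o projv W)%VF.
have eV i v : e i v \in V i by rewrite comp_lfunE memv_sum_pi.
have sum_e v : v \in W -> \sum_i e i v = v.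
  move=> Wv; rewrite -[RHS](sumv_pi_sum defW) //.
  by apply: eq_bigr => i _; rewrite comp_lfunE projv_id.
have VW i : (V i <= W)%VS by apply: (sumv_sup i).
have e_id i v : v \in V i -> e i v = v.
  move=> Vv; have Wv := subvP (VW i) _ Vv.
  have /directv_sum_unique := dxV.
  move=> /(_ (e^~ v) (fun j => if j == i then v else 0)).
  rewrite sum_e // -big_mkcond big_pred1_eq eqxx => dxv.
  suff /esym/forall_inP/(_ i isT) : true = [forall (j | true),
      e j v == (if j == i then v else 0)] by rewrite eqxx => /eqP.
  by apply: dxv => // j _; case: eqP => [->|_]; rewrite ?mem0v.
have -> : (f \o projv W)%VF = \sum_i (f \o e i)%VF.
  apply/lfunP => v; rewrite sum_lfunE comp_lfunE -[in LHS](sum_e (projv W v)).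
    rewrite linear_sum; apply: eq_bigr => i _ /=.
    by rewrite !comp_lfunE projv_proj.
  exact: memv_proj.
rewrite lfun_trace_sum; apply: eq_bigr => i _.
have -> : (f \o e i = c i *: e i + ((f - c i *: \1) \o e i))%VF.
  by rewrite comp_lfunDl comp_lfunNl -comp_lfunZl comp_lfun1l addrC subrK.
rewrite lfun_traceP lfun_trace_idempotent; last first.
  by apply/lfunP => v; rewrite comp_lfunE e_id.
rewrite [X in _ + X](_ : _ = 0) ?addr0; last first.
  (* One more iteration than on [V i]: the first application only brings [v] into [V i]. *)
  have [n niln] := nilf i; apply: (@lfun_trace_nilpotent n.+1) => v.
  rewrite iterSr; set u := ((_ \o _)%VF v).
  have Vu : u \in V i.
    rewrite /u comp_lfunE add_lfunE opp_lfunE scale_lfunE id_lfunE.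
    by rewrite memvB ?memvZ ?fV.
  rewrite -(niln u Vu); elim: n {niln} => //= n IHn.
  rewrite IHn comp_lfunE e_id //; elim: n {IHn} => //= n.
  set w := iter n _ _ => Vw.
  by rewrite add_lfunE opp_lfunE scale_lfunE id_lfunE memvB ?memvZ ?fV.
rewrite mulr_natr; congr (_ *+ \dim _); apply/vspaceP => v.
apply/idP/idP => [/memv_imgP[w _ ->] // | Vv].
by rewrite -(e_id i v Vv) memv_img ?memvf.
Qed.

(** The form in which the trace argument is used: the eigenvalues of [f, g] on a sum stable under
    [f] and [g] add up to zero with multiplicity. *)
Lemma commutator_block_trace (I : finType) (V : I -> {vspace vT}) (c : I -> F)
    f g (h := ((f \o g) - (g \o f))%VF) (U := (\sum_i V i)%VS) :
    directv (\sum_i V i) ->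
    {in U, forall v, f v \in U} -> {in U, forall v, g v \in U} ->
    (forall i, {in V i, forall v, h v \in V i}) ->
    (forall i, exists n, {in V i, forall v, iter n (h - c i *: \1)%VF v = 0}) ->
  \sum_i c i *+ \dim (V i) = 0.
Proof.
by move=> dxV fU gU hV nilh; rewrite -(block_trace dxV hV nilh) lfun_trace_commutator0.
Qed.

End EndomorphismTrace.

(** * Lie brackets and nilpotency *)

Section LieBracket.
Variables (F : fieldType) (L : lieAlgType F).
Implicit Types (x y z u v : L) (U V : {vspace L}).

Lemma lieDl x y z : lie (x + y) z = lie x z + lie y z.
Proof. by rewrite lieC linearD opprD -!lieC. Qed.

Lemma lieZl c x y : lie (c *: x) y = c *: lie x y.
Proof. by rewrite lieC linearZ -scalerN -lieC. Qed.

Lemma lieNl x y : lie (- x) y = - lie x y.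
Proof. by rewrite -scaleN1r lieZl scaleN1r. Qed.

Lemma lie0l y : lie 0 y = 0.
Proof. by rewrite lieC linear0 oppr0. Qed.

Lemma lieBl x y z : lie (x - y) z = lie x z - lie y z.
Proof. by rewrite lieDl lieNl. Qed.

Lemma lie_suml (I : Type) (r : seq I) (P : pred I) (f : I -> L) z :
  lie (\sum_(i <- r | P i) f i) z = \sum_(i <- r | P i) lie (f i) z.
Proof. exact: (big_morph (lie^~ z) (fun x y => lieDl x y z) (lie0l z)). Qed.

Lemma lie_derivation x y z : lie x (lie y z) = lie (lie x y) z + lie y (lie x z).
Proof.
apply/eqP; rewrite -subr_eq0 -(lie_jacobi x y z) opprD.
rewrite [lie z (lie x y)]lieC [lie z x]lieC linearN /=.
by rewrite addrAC addrA.
Qed.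

Lemma ad_lie x y : ad (lie x y) = ((ad x \o ad y) - (ad y \o ad x))%VF.
Proof.
apply/lfunP => z; rewrite add_lfunE opp_lfunE !comp_lfunE !adE.
by rewrite [lie x (lie y z)]lie_derivation addrK.
Qed.

Lemma ad_lin c x y : ad (c *: x + y) = c *: ad x + ad y.
Proof.
by apply/lfunP => z; rewrite add_lfunE scale_lfunE !adE lieDl lieZl.
Qed.

Lemma mem_lie_prod U V x y : x \in U -> y \in V -> lie x y \in lie_prod U V.
Proof. by move/lie_prodP: (subvv (lie_prod U V)); apply. Qed.

Lemma lie_prodS U1 U2 V1 V2 :
  (U1 <= U2)%VS -> (V1 <= V2)%VS -> (lie_prod U1 V1 <= lie_prod U2 V2)%VS.
Proof.
move=> /subvP sU /subvP sV; apply/lie_prodP => x y Ux Vy.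
by rewrite mem_lie_prod ?sU ?sV.
Qed.

End LieBracket.

Section Endomorphisms.
Variables (F : fieldType) (vT : vectType F).
Implicit Types (f g : 'End(vT)) (U V : {vspace vT}).

Lemma iter_lfun_is_linear n f : linear (iter n f).
Proof. by move=> a u v; elim: n => //= n ->; rewrite linearP. Qed.
HB.instance Definition _ n f :=
  GRing.isLinear.Build F vT vT _ (iter n f) (iter_lfun_is_linear n f).

Lemma iter_nil_leq m n f v : (m <= n)%N -> iter m f v = 0 -> iter n f v = 0.
Proof. by move=> /subnK <- fv0; rewrite iterD fv0 linear0. Qed.

(** The kernels of the iterates increase and have bounded dimension; take one of maximal dimension.
    Exponents that depend on the vector thus become uniform. *)
Lemma uniform_nilpotency f :
  exists n, forall m v, iter m f v = 0 -> iter n f v = 0.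
Proof.
pose d n := \dim (lker (linfun (iter n f))).
pose P k := `[< exists n, d n = k >].
have exP : exists k, P k by exists (d 0); apply/asboolP; exists 0.
have ubP k : P k -> (k <= \dim {:vT})%N.
  by case/asboolP => n <-; rewrite dimvS ?subvf.
case: (ex_maxnP exP ubP) => _ /asboolP[n <-] max_n.
exists n => m v fv0.
have sub i j : (i <= j)%N ->
    (lker (linfun (iter i f)) <= lker (linfun (iter j f)))%VS.
  move=> le_ij; apply/subvP => w; rewrite !memv_ker !lfunE /= => /eqP fw0.
  by rewrite (iter_nil_leq le_ij).
have eqK : lker (linfun (iter n f)) = lker (linfun (iter (maxn m n) f)).
  apply/eqP; rewrite eqEdim sub ?leq_maxr //= max_n //.
  by apply/asboolP; exists (maxn m n).
have : v \in lker (linfun (iter n f)).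
  rewrite eqK memv_ker lfunE /= (iter_nil_leq _ fv0) //.
  exact: leq_maxl.
by rewrite memv_ker lfunE /= => /eqP.
Qed.

(** A subspace of maximal dimension inside [P] absorbs every vector of [P]. This turns predicates
    with quantifiers into subspaces. *)
Lemma vspace_of_pred (P : vT -> Prop) :
    P 0 -> (forall c u v, P u -> P v -> P (c *: u + v)) ->
  exists U : {vspace vT}, forall v, v \in U <-> P v.
Proof.
move=> P0 PD.
pose Q k := `[< exists U : {vspace vT}, \dim U = k /\ forall v, v \in U -> P v >].
have exQ : exists k, Q k.
  exists 0; apply/asboolP; exists 0%VS; split; first exact: dimv0.
  by move=> v; rewrite memv0 => /eqP->.
have ubQ k : Q k -> (k <= \dim {:vT})%N.
  by case/asboolP => U [<- _]; rewrite dimvS ?subvf.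
case: (ex_maxnP exQ ubQ) => _ /asboolP[U [<- UP]] max_U.
exists U => v; split=> [/UP // | Pv].
have sUv : (U <= <[v]> + U)%VS by apply: addvSr.
suff -> : U = (<[v]> + U)%VS by rewrite (subvP (addvSl _ _)) ?memv_line.
apply/eqP; rewrite eqEdim sUv max_U //; apply/asboolP.
exists (<[v]> + U)%VS; split=> // _ /memv_addP[_ /vlineP[c ->] [u Uu ->]].
exact: PD (UP u Uu).
Qed.

End Endomorphisms.

Section Eigenvector.
Variables (F : numClosedFieldType) (vT : vectType F).
Import VectorInternalTheory.

Lemma stable_eigenvector (f : 'End(vT)) (U : {vspace vT}) :
    {in U, forall v, f v \in U} -> U != 0%VS ->
  exists c v, [/\ v \in U, v != 0 & f v = c *: v].
Proof.
move=> fU nzU.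
pose g : 'End(subvs_of U) := linfun (vsproj U \o f \o vsval).
have dimU : (0 < dim (subvs_of U))%N by rewrite lt0n dimv_eq0.
have [c /eigenvalueP[w wg nzw]] := spectral.eigenvalue_closed (f2mx g) dimU.
exists c, (vsval (r2v w)); split; first exact: subvsP.
- apply: contra nzw => /eqP w0; rewrite -(inj_eq (@r2v_inj _ (subvs_of U))) linear0.
  by apply/eqP/subvs_inj.
have := lfun_apply g (r2v w); rewrite r2vK wg linearZ /= => /(congr1 vsval).
by rewrite lfunE /= vsprojK ?fU ?subvsP.
Qed.

End Eigenvector.

Section Coprime.
Variables (F : fieldType) (vT : vectType F).

(** Induction on [m] reduces to f v = c v, where (f - d)^n acts on v as the scalar (c - d)^n. *)
Lemma coprime_nilpotent (f : 'End(vT)) (c d : F) m n v : c != d ->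
    iter m (f - c *: \1)%VF v = 0 -> iter n (f - d *: \1)%VF v = 0 -> v = 0.
Proof.
move=> neq_cd; elim: m v => [//|m IHm] v; rewrite iterSr => fm fn.
have fE a u : (f - a *: \1)%VF u = f u - a *: u.
  by rewrite add_lfunE opp_lfunE scale_lfunE id_lfunE.
have fcv0 : (f - c *: \1)%VF v = 0.
  apply: IHm => //.
  suff -> : iter n (f - d *: \1)%VF ((f - c *: \1)%VF v) =
      (f - c *: \1)%VF (iter n (f - d *: \1)%VF v) by rewrite fn linear0.
  elim: (n) => //= k ->; set u := iter _ _ v.
  rewrite !fE !linearB !linearZ /=. rewrite !opprK !scalerA.
  by rewrite [c * d]mulrC addrA [in RHS]addrA; congr (_ + _); rewrite addrAC.
have {fcv0}fv : f v = c *: v by apply/eqP; rewrite -subr_eq0 -fE fcv0.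
have fnE k : iter k (f - d *: \1)%VF v = (c - d) ^+ k *: v.
  elim: k => [|k /= ->]; first by rewrite scale1r.
  by rewrite linearZ /= fE fv -scalerBl scalerA exprSr.
move/eqP: fn; rewrite fnE scaler_eq0 expf_eq0 subr_eq0 (negPf neq_cd) andbF.
by move/eqP.
Qed.

End Coprime.

(** * Generalized weight spaces *)

Section ShiftedAdjoint.
Variables (F : fieldType) (L : lieAlgType F).
Implicit Types (x y z u v : L) (U V : {vspace L}).

Definition adm x (c : F) : 'End(L) := (ad x - c *: \1)%VF.

Lemma admE x c v : adm x c v = lie x v - c *: v.
Proof. by rewrite add_lfunE opp_lfunE scale_lfunE id_lfunE adE. Qed.

Lemma adm_lie x a b u v :
  adm x (a + b) (lie u v) = lie (adm x a u) v + lie u (adm x b v).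
Proof.
rewrite !admE lie_derivation lieBl lieZl [lie u (_ - _)]linearB.
rewrite /= [lie u (b *: v)]linearZ /=.
by rewrite scalerDl opprD addrACA.
Qed.

(** The binomial formula for (ad x - a - b)^(m+n) on a bracket, by induction on m + n instead of
    with coefficients. It makes generalized weights additive under brackets. *)
Lemma iter_adm_lie x a b m n u v :
    iter m (adm x a) u = 0 -> iter n (adm x b) v = 0 ->
  iter (m + n) (adm x (a + b)) (lie u v) = 0.
Proof.
move: {2}(m + n)%N (leqnn (m + n)) => k.
elim: k => [|k IHk] in m n u v *.
  by rewrite leqn0 addn_eq0 => /andP[/eqP-> /eqP->] /= -> _; rewrite lie0l.
case: m => [|m] le_k; first by move=> /= -> _; rewrite lie0l linear0.
case: n => [|n] in le_k *; first by move=> _ /= ->; rewrite !linear0.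
rewrite addSn ltnS in le_k; move=> um vn.
rewrite addSn iterSr adm_lie linearD /= IHk -?iterSr ?add0r //.
by rewrite -addSnnS in le_k *; rewrite IHk // -iterSr.
Qed.

End ShiftedAdjoint.

Section GeneralizedWeights.
Variables (F : numClosedFieldType) (L : lieAlgType F) (h : {vspace L}).
Implicit Types (x y z u v : L) (U V : {vspace L}) (a b : dual_space h).

(** The exponent may depend on [t] and [v]; [uniform_nilpotency] removes the dependence on [v] when
    that matters. *)
Definition gen_weight a v : Prop :=
  forall t : subvs_of h, exists n, iter n (adm (vsval t) (a t)) v = 0.

Lemma gen_weight0 a : gen_weight a 0.
Proof. by move=> t; exists 0. Qed.

Lemma gen_weightP a c u v :
  gen_weight a u -> gen_weight a v -> gen_weight a (c *: u + v).
Proof.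
move=> au av t; have [[m um] [n vn]] := (au t, av t).
exists (maxn m n); rewrite linearP /= (iter_nil_leq _ um) ?leq_maxl //.
by rewrite (iter_nil_leq _ vn) ?leq_maxr // scaler0 addr0.
Qed.

Definition gen_weight_space a : {vspace L} :=
  projT1 (cid (vspace_of_pred (gen_weight0 a) (gen_weightP (a := a)))).

Lemma gen_weight_spaceP a v : v \in gen_weight_space a <-> gen_weight a v.
Proof. by rewrite /gen_weight_space; case: cid => U. Qed.

Lemma gen_weight_lie a b u v :
  gen_weight a u -> gen_weight b v -> gen_weight (a + b) (lie u v).
Proof.
move=> au bv t; have [[m um] [n vn]] := (au t, bv t).
by exists (m + n)%N; rewrite add_lfunE iter_adm_lie.
Qed.

Hypothesis h_lie : {in h &, forall x y, lie x y \in h}.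
Hypothesis h_nil : {in h &, forall x y, exists m, iter m (lie x) y = 0}.

Lemma gen_weight_h x : x \in h -> gen_weight 0 x.
Proof.
move=> hx t; have [m tx] := h_nil (subvsP t) hx; exists m.
rewrite zero_lfunE -[RHS]tx; elim: (m) => //= k ->.
by rewrite admE scale0r subr0.
Qed.

Lemma gen_weight_ad a x v : x \in h -> gen_weight a v -> gen_weight a (lie x v).
Proof. by move/gen_weight_h => hx av; rewrite -[a]add0r; apply: gen_weight_lie. Qed.

Lemma adm_gen_weight a x c v :
  x \in h -> gen_weight a v -> gen_weight a (adm x c v).
Proof.
move=> hx av; rewrite admE addrC -scaleNr.
by apply: gen_weightP => //; apply: gen_weight_ad.
Qed.

Lemma iter_adm_gen_weight a x c v n :
  x \in h -> gen_weight a v -> gen_weight a (iter n (adm x c) v).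
Proof. by move=> hx av; elim: n => //= n; apply: adm_gen_weight. Qed.

(** For [a] other than the head [b], choose [t] where they differ and apply a power of ad t - b(t)
    that kills [w b]. By induction it kills [w a] as well, and coprimality gives [w a] = 0. *)
Lemma gen_weight_indep (s : seq (dual_space h)) (w : dual_space h -> L) :
    uniq s -> (forall a, a \in s -> gen_weight a (w a)) ->
  \sum_(a <- s) w a = 0 -> forall a, a \in s -> w a = 0.
Proof.
elim: s w => // b s IHs w /andP[bs uniq_s] gw.
have gws a : a \in s -> gen_weight a (w a).
  by move=> sa; apply: gw; rewrite inE sa orbT.
rewrite big_cons => sumw0.
have ws0 a : a \in s -> w a = 0.
  move=> sa; have [neq_ab|/lfunPn[t neq_t]] := eqVneq a b.
    by rewrite -neq_ab sa in bs.
  have [n bn] := gw b (mem_head _ _) t.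
  have [m am] := gws a sa t.
  apply: (coprime_nilpotent neq_t am (n := n)).
  apply: (IHs (fun a => iter n (adm (vsval t) (b t)) (w a))) => // [c sc|].
    exact: iter_adm_gen_weight (subvsP t) (gws c sc).
  rewrite -linear_sum /= -[RHS](linear0 (iter n (adm (vsval t) (b t)))).
  by rewrite -[X in _ = iter _ _ X]sumw0 linearD /= bn add0r.
move=> a; rewrite inE => /predU1P[->|/ws0//].
by move: sumw0; rewrite big1_seq ?addr0 // => c /andP[_ /ws0].
Qed.

Lemma directv_gen_weight (s : seq (dual_space h)) :
  uniq s -> directv (\sum_(i < size s) gen_weight_space s`_i).
Proof.
move=> uniq_s; apply/directv_sum_independent => us Us sum0 i _.
pose w a := us (insubd i (index a s)).
have wE (j : 'I_(size s)) : w s`_j = us j.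
  by rewrite /w index_uniq // valKd.
rewrite -wE; apply: (gen_weight_indep uniq_s); rewrite ?mem_nth //.
  move=> a sa; have lt_a: (index a s < size s)%N by rewrite index_mem.
  rewrite -[X in gen_weight X](nth_index 0 sa).
  apply/gen_weight_spaceP; rewrite -[index a s]/(val (Ordinal lt_a)).
  by rewrite -[w a]/(us _) (_ : insubd _ _ = Ordinal lt_a) ?Us // /insubd insubT.
by rewrite (big_nth 0) big_mkord -[RHS]sum0; apply: eq_bigr => j _; rewrite wE.
Qed.

(** The only eigenvalue of x on [U] is the trace of ad x on [U] divided by the dimension, which is
    linear in x. No theorem of Lie is needed to see that it is a weight. *)
Lemma weight_of_single U :
    {in h & U, forall x v, lie x v \in U} -> U != 0%VS ->
    {in h, forall x, exists c n, {in U, forall v, iter n (adm x c) v = 0}} ->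
  exists a, {in U, forall v, gen_weight a v}.
Proof.
move=> hU nzU one.
pose tr x := lfun_trace (ad x \o projv U)%VF / (\dim U)%:R.
have nzd : (\dim U)%:R != 0 :> F by rewrite pnatr_eq0 dimv_eq0.
have trP x c n : x \in h -> {in U, forall v, iter n (adm x c) v = 0} -> tr x = c.
  move=> hx nilx; have dxU : directv (\sum_(i : 'I_1) U).
    by rewrite directvE /= !big_ord1.
  have := block_trace (c := fun=> c) (f := ad x) dxU.
  rewrite !big_ord1 /tr => ->; first by rewrite /= -[c *+ _]mulr_natr mulfK.
    by move=> _ v Uv; rewrite adE hU.
  by exists n.
have tr_lin : scalar (fun t : subvs_of h => tr (vsval t)).
  move=> c t t'; rewrite /tr linearP ad_lin comp_lfunDl -comp_lfunZl.
  by rewrite lfun_traceP mulrDl mulrA.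
pose lin := GRing.isLinear.Build F (subvs_of h) F^o _ _ tr_lin.
pose tr' : {linear subvs_of h -> F^o} := HB.pack (fun t => tr (vsval t)) lin.
exists (linfun tr') => v Uv t; have [c [n tn]] := one _ (subvsP t).
by exists n; rewrite lfunE /= (trP _ _ _ (subvsP t) tn) tn.
Qed.

(** Moving [y] across powers of ad x - c costs at most [m] of them, by [y, (ad x - c) z] = (ad x -
    c) [y, z] - [[x, y], z] and induction, first on [m] for [x, y], then on [j]. So the stable image
    of ad x - c is preserved by h. *)
Lemma lie_iter_adm x c y m U j v :
    x \in h -> {in h & U, forall x v, lie x v \in U} -> y \in h -> v \in U ->
    iter m (lie x) y = 0 ->
  exists2 u, u \in U & lie y (iter (m + j) (adm x c) v) = iter j (adm x c) u.
Proof.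
move=> hx hU; elim: m j y => [|m IHm] j y hy Uv xy.
  by exists 0; rewrite ?mem0v // linear0 (_ : y = 0) // lie0l.
elim: j => [|j [u Uu IHj]].
  exists (lie y (iter (m.+1 + 0) (adm x c) v)) => //; apply: (hU) => //.
  elim: (m.+1 + 0)%N => //= k Uk; rewrite admE memvB ?memvZ //; exact: hU.
have [|||w Uw defw] := IHm j.+1 (lie x y); rewrite ?h_lie // -?iterSr //.
exists (u - w); first exact: memvB.
rewrite -addSnnS in defw.
have -> : iter j.+1 (adm x c) (u - w)
    = iter j.+1 (adm x c) u - iter j.+1 (adm x c) w by rewrite linearB.
rewrite -defw [iter j.+1 _ u]iterS -IHj.
rewrite addnS [in LHS]iterS.
rewrite !admE; set z := iter _ _ v.
rewrite [lie y (_ - _)]linearB /= [lie y (_ *: _)]linearZ /= [lie x (lie y z)]lie_derivation.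
by rewrite addrAC [lie (lie x y) z + _]addrC addrK.
Qed.

(** Fitting decomposition: when some x of h does not have a single eigenvalue on [U], the kernel and
    image of a high power of ad x - c split [U] into smaller h-stable pieces. Otherwise all of [U]
    has one weight. *)
Lemma gen_weight_span U : {in h & U, forall x v, lie x v \in U} ->
  exists X : seq L,
    U = <<X>>%VS /\ forall v, v \in X -> exists a, gen_weight a v.
Proof.
move: {2}(\dim U) (leqnn (\dim U)) => n.
elim: n U => [|n IHn] U dimU hU.
  by exists [::]; move: dimU; rewrite leqn0 dimv_eq0 span_nil => /eqP.
have [-> | nzU] := eqVneq U 0%VS; first by exists [::]; rewrite span_nil.
have [one | ] := pselect
    {in h, forall x, exists c n, {in U, forall v, iter n (adm x c) v = 0}}.
  have [a aU] := weight_of_single hU nzU one.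
  exists (vbasis U); rewrite (span_basis (vbasisP U)); split=> // v.
  by move/vbasis_mem => Uv; exists a; apply: aU.
move/existsNP => [x /not_implyP[hx] /forallNP many].
have admU c : {in U, forall v, adm x c v \in U}.
  by move=> v Uv; rewrite admE memvB ?memvZ ?hU.
have iterU k c : {in U, forall v, iter k (adm x c) v \in U}.
  by move=> v Uv; elim: k => //= k; apply: admU.
have adxU : {in U, forall v, ad x v \in U} by move=> v Uv; rewrite adE hU.
(* An actual eigenvalue makes the kernel part nonzero; [many] makes the image part nonzero. *)
have [c [v [Uv nzv xv]]] := stable_eigenvector adxU nzU.
have [k nilk] := uniform_nilpotency (adm x c).
pose f : 'End(L) := linfun (iter k (adm x c)).
have fE u : f u = iter k (adm x c) u by rewrite lfunE.
pose U1 := (U :&: lker f)%VS; pose U2 := (f @: U)%VS.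
have sU1 : (U1 <= U)%VS by apply: capvSl.
have sU2 : (U2 <= U)%VS.
  by apply/subvP => _ /memv_imgP[u Uu ->]; rewrite fE iterU.
have dim12 : (\dim U1 + \dim U2)%N = \dim U by apply: limg_ker_dim.
have dx12 : (U1 :&: U2 = 0)%VS.
  apply/eqP; rewrite -subv0; apply/subvP => w; rewrite memv_cap memv0.
  case/andP; rewrite memv_cap => /andP[_]; rewrite memv_ker => /eqP fw.
  case/memv_imgP => u Uu defw; rewrite defw fE (nilk (k + k)%N) //.
  by rewrite iterD -!fE -defw.
have defU : U = (U1 + U2)%VS.
  apply/eqP; rewrite eq_sym eqEdim subv_add sU1 sU2 /=.
  by rewrite dimv_disjoint_sum ?dim12.
have nzU1 : U1 != 0%VS.
  apply: contraNneq nzv => U10; rewrite -memv0 -U10 memv_cap Uv memv_ker fE.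
  apply/eqP; apply: (nilk 1%N).
  by rewrite /= admE -adE xv subrr.
have nzU2 : U2 != 0%VS.
  apply/eqP => U20; apply: (many c); exists k => u Uu; apply/eqP.
  by rewrite -fE -memv0 -U20 memv_img.
have hU1 : {in h & U1, forall x v, lie x v \in U1}.
  move=> y u hy; rewrite !memv_cap => /andP[Uu]; rewrite !memv_ker hU //=.
  rewrite !fE => /eqP cu; apply/eqP; have [m xy] := h_nil hx hy.
  apply: (nilk (m + k)%N); rewrite -[c]add0r; apply: iter_adm_lie => //.
  by rewrite -[RHS]xy; elim: (m) => //= i ->; rewrite admE scale0r subr0.
have hU2 : {in h & U2, forall x v, lie x v \in U2}.
  move=> y _ hy /memv_imgP[u Uu ->]; have [m xy] := h_nil hx hy.
  (* The kernels are stationary from exponent [k] on, hence so are the images: there are [m] spare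
     powers to spend in [lie_iter_adm]. *)
  have Kimg : (f @: U = linfun (iter (m + k) (adm x c)) @: U)%VS.
    apply/eqP; rewrite eq_sym eqEdim; apply/andP; split.
      apply/subvP => _ /memv_imgP[w Uw ->]; rewrite lfunE /= addnC iterD -fE.
      by rewrite memv_img ?iterU.
    rewrite -(leq_add2l (\dim (U :&: lker f))) limg_ker_dim.
    rewrite -(limg_ker_dim (linfun (iter (m + k) (adm x c))) U) leq_add2r.
    apply/dimvS/capvS => //; apply/subvP => w; rewrite !memv_ker lfunE fE /=.
    by move/eqP/nilk => ->.
  have : f u \in (f @: U)%VS by rewrite memv_img.
  rewrite Kimg => /memv_imgP[w Uw ->]; rewrite lfunE /=.
  have [z Uz ->] := lie_iter_adm c k hx hU hy Uw xy.
  by rewrite -fE memv_img.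
have lt1 : (\dim U1 <= n)%N.
  rewrite -ltnS (leq_trans _ dimU) // -dim12 -addn1 leq_add2l lt0n.
  by rewrite dimv_eq0.
have lt2 : (\dim U2 <= n)%N.
  rewrite -ltnS (leq_trans _ dimU) // -dim12 -add1n leq_add2r lt0n.
  by rewrite dimv_eq0.
have [[X1 [dX1 w1]] [X2 [dX2 w2]]] := (IHn _ lt1 hU1, IHn _ lt2 hU2).
exists (X1 ++ X2); rewrite span_cat -dX1 -dX2; split=> // u.
by rewrite mem_cat => /orP[/w1|/w2].
Qed.

End GeneralizedWeights.

(** * Weakly closed sets of nilpotent maps *)

Section WeaklyClosedEngel.
Variables (F : fieldType) (L : lieAlgType F) (S : L -> Prop).
Implicit Types (x y z u v : L) (A B U V W : {vspace L}).
Hypothesis S_lie : forall x y, S x -> S y -> S (lie x y).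

(* S is not assumed to be a subspace, only closed under brackets: it will be the
   set of weight vectors of an ideal, whose sums need not be ad-nilpotent. *)
Definition stable_under A V := {in A & V, forall x v, lie x v \in V}.

Definition spanned_by_S A := exists2 X : seq L,
  A = <<X>>%VS & forall x, x \in X -> S x.

Definition S_nil V := forall s v, S s -> v \in V -> exists k, iter k (lie s) v = 0.

Lemma stable_span (X : seq L) V W : (forall x v, x \in X -> v \in V -> lie x v \in W) ->
  {in <<X>>%VS & V, forall x v, lie x v \in W}.
Proof.
move=> XW x v Xx Vv; rewrite (coord_span (X := in_tuple X) Xx) lie_suml.
apply: memv_suml => i _; rewrite lieZl memvZ // XW //.
exact: mem_nth.
Qed.

Lemma transporter A V W : exists N : {vspace L},
  forall v, v \in N <-> v \in V /\ {in A, forall x, lie x v \in W}.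
Proof.
apply: vspace_of_pred => [|c u v [Vu Wu] [Vv Wv]].
  by split=> [|x _]; rewrite ?linear0 mem0v.
split=> [|x Ax]; first by rewrite memvD ?memvZ.
by rewrite linearP /= memvD ?memvZ ?Wu ?Wv.
Qed.

(** Jacobson's version of Engel's theorem, stated relative to [W] to avoid the quotient V/W.
    Induction on dim A: a maximal proper subalgebra [B] spanned by elements of [S] is normalized by
    some [s] of [S] outside it, so A = B + <s>; among the vectors that [B] carries into [W],
    iterating [s] finds one carried into [W] by [s] too. *)
Lemma weakly_closed_engel A V W :
    spanned_by_S A -> stable_under A A -> S_nil A ->
    (W <= V)%VS -> W != V -> stable_under A V -> stable_under A W -> S_nil V ->
  exists v, [/\ v \in V, v \notin W & {in A, forall x, lie x v \in W}].
Proof.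
move: {2}(\dim A) (leqnn (\dim A)) => n; elim: n A V W => [|n IHn] A V W.
  rewrite leqn0 dimv_eq0 => /eqP-> _ _ _ sWV neqWV _ _ _.
  have /subvPn[v Vv nWv] : ~~ (V <= W)%VS.
    by apply: contra neqWV => sVW; rewrite eqEsubv sWV.
  by exists v; split=> // x; rewrite memv0 => /eqP->; rewrite lie0l mem0v.
move=> dimA [X defA SX] AA nilA sWV neqWV AV AW nilV.
have [A0 | nzA] := eqVneq A 0%VS.
  apply: (IHn) => //; [by rewrite A0 dimv0 | by exists X].
pose good B := [/\ (B <= A)%VS, B != A, spanned_by_S B & stable_under B B].
pose P k := `[< exists2 B, good B & \dim B = k >].
have exP : exists k, P k.
  exists 0; apply/asboolP; exists 0%VS; last exact: dimv0.
  split; rewrite ?sub0v //; first by rewrite eq_sym.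
    by exists [::]; rewrite ?span_nil.
  by move=> x y _; rewrite memv0 => /eqP->; rewrite linear0 mem0v.
have ubP k : P k -> (k <= \dim A)%N by case/asboolP => B [/dimvS dB _ _ _] <-.
case: (ex_maxnP exP ubP) => _ /asboolP[B [sBA neqBA spB BB] <-] maxB.
have [Y defB SY] := spB.
have dimB : (\dim B <= n)%N.
  rewrite -ltnS (leq_trans _ dimA) // ltn_neqAle dimvS // andbT.
  by apply: contra neqBA => /eqP dBA; rewrite eqEdim sBA dBA leqnn.
have nilB : S_nil B by move=> s v Ss /(subvP sBA); apply: nilA.
have BA : stable_under B A by move=> x v /(subvP sBA); apply: AA.
(* The search for a normalizing [s] is generalized from [B] to any proper B-stable [U], for
   induction on its codimension. *)
have choose_s m U : (\dim A - \dim U <= m)%N -> (U <= A)%VS -> U != A ->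
    stable_under B U ->
  exists s, [/\ S s, s \in A, s \notin U & {in B, forall x, lie x s \in U}].
  elim: m U => [|m IHm] U.
    rewrite leqn0 subn_eq0 => leAU sUA neqUA.
    by rewrite eqEdim sUA leAU in neqUA.
  move=> codim sUA neqUA BU.
  have [v [Av nUv Bv]] := IHn _ _ _ dimB spB BB nilB sUA neqUA BA BU nilA.
  have [N NP] := transporter B A U.
  have sNA : (N <= A)%VS by apply/subvP => w /NP[].
  have sUN : (U <= N)%VS.
    by apply/subvP => w Uw; apply/NP; rewrite (subvP sUA) //; split=> // x /BU; apply.
  have [NA | neqNA] := eqVneq N A.
    have /hasP[x Xx nUx] : has (fun x => x \notin U) X.
      rewrite has_predC; apply: contra neqUA => /allP XU.
      by rewrite eqEsubv sUA defA; apply/span_subvP.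
    have Ax : x \in A by rewrite defA memv_span.
    exists x; split=> //; first exact: SX.
    by have : x \in N by [rewrite NA]; case/NP.
  have BN : stable_under B N.
    move=> x w Bx /NP[Aw BwU]; apply/NP; split; first exact: BA.
    by move=> y By; apply: BU => //; apply: BwU.
  have [|s [Ss As nNs BsN]] := IHm N _ sNA neqNA BN.
    move: codim; rewrite !leq_subLR addnS -addSn => /leq_trans-> //.
    rewrite leq_add2r ltn_neqAle dimvS // andbT.
    apply: contra nUv => /eqP dUN; have /eqP-> : U == N.
      by rewrite eqEdim sUN dUN leqnn.
    exact/NP.
  (* Here s lies in [S] and is carried by [B] into [N] but not into [U]; then [y, s] is in [S],
     outside [U], and carried by [B] into [U] by definition of [N]. *)
  have /hasP[y Yy nUys] : has (fun y => lie y s \notin U) Y.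
    rewrite has_predC; apply: contra nNs => /allP YU; apply/NP; split=> //.
    move=> x; rewrite defB => Yx.
    apply: (stable_span (V := <[s]>%VS)) Yx (memv_line s) => y _ Yy /vlineP[c ->].
    by rewrite linearZ memvZ //; apply: YU.
  have By : y \in B by rewrite defB memv_span.
  exists (lie y s); split=> //; first by apply: S_lie => //; apply: SY.
    exact: BA.
  by case/NP: (BsN y By).
have [s [Ss As nBs BsB]] := choose_s _ B (leqnn _) sBA neqBA BB.
have defA' : A = (B + <[s]>)%VS.
  apply/eqP/negPn/negP => neqA.
  have sB'A : (B + <[s]> <= A)%VS by rewrite subv_add sBA.
  have : (\dim (B + <[s]>) <= \dim B)%N.
    apply: maxB; apply/asboolP; exists (B + <[s]>)%VS => //; split=> //.
    - by rewrite eq_sym.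
    - exists (s :: Y); first by rewrite span_cons -defB addvC.
      by move=> x; rewrite inE => /predU1P[->|/SY].
    move=> _ _ /memv_addP[b Bb [_ /vlineP[c ->] ->]]
             /memv_addP[b' Bb' [_ /vlineP[c' ->] ->]].
    apply: (subvP (addvSl _ _)).
    rewrite lieDl !linearD /= !lieZl !linearZ /= liexx !scaler0 addr0.
    have sb' : lie s b' \in B by rewrite lieC memvN BsB.
    apply: memvD; last exact: memvZ.
    apply: memvD; first exact: BB.
    by apply: memvZ; apply: (BsB b Bb).
  rewrite leqNgt => /negP; apply; have sBB' := addvSl B <[s]>%VS.
  rewrite ltn_neqAle dimvS // andbT; apply: contra nBs => /eqP dB.
  have /eqP-> : B == (B + <[s]>)%VS by rewrite eqEdim sBB' dB leqnn.
  by rewrite (subvP (addvSr _ _)) ?memv_line.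
have BV : stable_under B V by move=> x v /(subvP sBA); apply: AV.
have BW : stable_under B W by move=> x v /(subvP sBA); apply: AW.
have [v0 [Vv0 nWv0 Bv0]] := IHn _ _ _ dimB spB BB nilB sWV neqWV BV BW nilV.
(* The iterate just before the first one that falls into [W] is the vector sought. *)
pose Q k := iter k (lie s) v0 \in W.
have exQ : exists k, Q k.
  by have [k sk] := nilV s v0 Ss Vv0; exists k; rewrite /Q sk mem0v.
(* Since [B, s] lies in [B], every iterate of [v0] under [s] is still carried into [W] by [B]. *)
have kill k : {in B, forall x, lie x (iter k (lie s) v0) \in W}.
  elim: k => //= k IHk x Bx; rewrite lie_derivation memvD //.
    by apply: IHk; apply: BsB.
  by apply: AW => //; apply: IHk.
case: (ex_minnP exQ) => [[|k]]; first by rewrite /Q (negPf nWv0).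
move=> Wk mink; exists (iter k (lie s) v0); split.
- by elim: (k) => //= j; apply: AV.
- by apply/negP => /mink; rewrite ltnn.
move=> x; rewrite defA' => /memv_addP[b Bb [_ /vlineP[c ->] ->]].
by rewrite lieDl lieZl; apply: memvD; [apply: kill | apply: memvZ].
Qed.

(** Enlarge [W] by all vectors that [A] carries into it, until the enlargement fills [V]; the last
    proper [W] contains [A, V]. With A = V it says that A is not perfect. *)
Lemma weakly_closed_engel_quotient A V :
    spanned_by_S A -> stable_under A A -> S_nil A ->
    V != 0%VS -> stable_under A V -> S_nil V ->
  exists W, [/\ (W <= V)%VS, W != V & {in A & V, forall x v, lie x v \in W}].
Proof.
move=> spA AA nilA nzV AV nilV.
suff H m W : (\dim V - \dim W <= m)%N -> (W <= V)%VS -> W != V ->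
    stable_under A W ->
  exists W', [/\ (W' <= V)%VS, W' != V & {in A & V, forall x v, lie x v \in W'}].
  apply: (H _ 0%VS (leqnn _)); rewrite ?sub0v 1?eq_sym //.
  by move=> x v _; rewrite memv0 => /eqP->; rewrite linear0 mem0v.
elim: m W => [|m IHm] W.
  rewrite leqn0 subn_eq0 => leVW sWV neqWV _.
  by rewrite eqEdim sWV leVW in neqWV.
move=> codim sWV neqWV AW.
have [v [Vv nWv Av]] := weakly_closed_engel spA AA nilA sWV neqWV AV AW nilV.
have [N NP] := transporter A V W.
have sNV : (N <= V)%VS by apply/subvP => w /NP[].
have sWN : (W <= N)%VS.
  by apply/subvP => w Ww; apply/NP; rewrite (subvP sWV) //; split=> // x /AW; apply.
have [NV | neqNV] := eqVneq N V.
  exists W; split=> // x w Ax; rewrite -NV => /NP[_]; exact.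
apply: (IHm N) => //; last first.
  move=> x w Ax /NP[Vw AwW]; apply/NP; split; first exact: AV.
  by move=> y Ay; apply: AW => //; apply: AwW.
move: codim; rewrite !leq_subLR addnS -addSn => /leq_trans-> //.
rewrite leq_add2r ltn_neqAle dimvS // andbT.
apply: contra nWv => /eqP dWN; have /eqP-> : W == N.
  by rewrite eqEdim sWN dWN leqnn.
exact/NP.
Qed.

End WeaklyClosedEngel.

(** * Killing form *)

Section Killing.
Variables (F : fieldType) (L : lieAlgType F).
Implicit Types x y z : L.

Definition killing x y : F := lfun_trace (ad x \o ad y)%VF.

Lemma killingC x y : killing x y = killing y x.
Proof. exact: lfun_traceC. Qed.

Lemma killing_linl c x y z :
  killing (c *: x + y) z = c * killing x z + killing y z.
Proof. by rewrite /killing ad_lin comp_lfunDl -comp_lfunZl lfun_traceP. Qed.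

Lemma killing_linr c x y z :
  killing z (c *: x + y) = c * killing z x + killing z y.
Proof. by rewrite !(killingC z) killing_linl. Qed.

Lemma killing_scalar x : scalar (killing x).
Proof. by move=> c y z; rewrite killing_linr. Qed.
HB.instance Definition _ x :=
  GRing.isLinear.Build F L F^o _ (killing x : L -> F^o) (killing_scalar x).

Lemma killingDl x y z : killing (x + y) z = killing x z + killing y z.
Proof. by rewrite -[x]scale1r killing_linl mul1r scale1r. Qed.

Lemma killingDr x y z : killing z (x + y) = killing z x + killing z y.
Proof. by rewrite !(killingC z) killingDl. Qed.

Lemma killing0r x : killing x 0 = 0.
Proof. exact: (linear0 (killing x : L -> F^o)). Qed.

Lemma killingZr c x y : killing y (c *: x) = c * killing y x.
Proof. by rewrite -[c *: x]addr0 killing_linr killing0r addr0. Qed.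

Lemma killingZl c x y : killing (c *: x) y = c * killing x y.
Proof. by rewrite !(killingC _ y) killingZr. Qed.

Lemma killing_sumr x (I : Type) (r : seq I) (P : pred I) (f : I -> L) :
  killing x (\sum_(i <- r | P i) f i) = \sum_(i <- r | P i) killing x (f i).
Proof. exact: (linear_sum (killing x : L -> F^o)). Qed.

Lemma killing_invariant x y z : killing (lie x y) z = killing x (lie y z).
Proof.
rewrite /killing !ad_lie comp_lfunDl comp_lfunDr comp_lfunNl comp_lfunNr.
rewrite !lfun_traceB; congr (_ - _); first by rewrite comp_lfunA.
by rewrite -comp_lfunA [LHS]lfun_traceC comp_lfunA.
Qed.

(** Nondegeneracy makes the map from L to its dual injective, hence onto by dimension. *)
Lemma killing_represents (phi : 'Hom(L, F^o)) :
    (forall x, (forall y, killing x y = 0) -> x = 0) ->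
  exists s, forall y, phi y = killing s y.
Proof.
move=> nondeg; pose K s : 'Hom(L, F^o) := linfun (killing s : L -> F^o).
have K_lin : linear K.
  move=> c s t; apply/lfunP => y.
  by rewrite add_lfunE scale_lfunE !lfunE /= killing_linl.
pose lin := GRing.isLinear.Build F L 'Hom(L, F^o) _ _ K_lin.
pose K' : {linear L -> 'Hom(L, F^o)} := HB.pack K lin.
have kerK : lker (linfun K') == 0%VS.
  rewrite -subv0; apply/subvP => s; rewrite memv_ker memv0 lfunE /=.
  move=> /eqP/lfunP Ks0; apply/eqP/nondeg => y.
  by have := Ks0 y; rewrite zero_lfunE lfunE.
have : phi \in limg (linfun K').
  suff -> : limg (linfun K') = fullv by rewrite memvf.
  apply/eqP; rewrite eqEdim subvf limg_dim_eq ?(eqP kerK) ?capv0 //=.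
  by rewrite !dimvf /dim /= muln1.
by case/memv_imgP => s _ ->; exists s => y; rewrite lfunE /= lfunE.
Qed.

End Killing.

Section CartanDecomposition.
Variables (F : numClosedFieldType) (L : lieAlgType F) (h : {vspace L}).
Implicit Types (x y z u v : L) (U V Q : {vspace L}) (a b c : dual_space h).

Hypothesis h_lie : {in h &, forall x y, lie x y \in h}.
Hypothesis h_nil : {in h &, forall x y, exists m, iter m (lie x) y = 0}.

Let gws := @gen_weight_space F L h.

(** The projections are indexed by all functionals and vanish off the finite list [S], so that
    weight components can be taken without first testing for membership. *)
Lemma gen_weight_decomposition :
  exists (S : seq (dual_space h)) (pi : dual_space h -> 'End(L)),
  [/\ uniq S, (forall a v, gen_weight a (pi a v)),
      (forall v, \sum_(a <- S) pi a v = v),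
      (forall a, a \notin S -> pi a = 0) &
      (forall a b v, gen_weight a v -> pi b v = if b == a then v else 0)].
Proof.
have [|X [defL wX]] := @gen_weight_span F L h h_lie h_nil fullv.
  by move=> *; apply: memvf.
have [S0 S0X] : exists S0 : seq (dual_space h),
    forall v, v \in X -> exists2 a, a \in S0 & gen_weight a v.
  elim: X wX {defL} => [|x X IHX] wX; first by exists [::].
  have [|S0 S0X] := IHX; first by move=> v Xv; apply: wX; rewrite inE Xv orbT.
  have [a ax] := wX x (mem_head _ _).
  exists (a :: S0) => v; rewrite inE => /predU1P[->|/S0X[b S0b bv]].
    by exists a; rewrite ?mem_head.
  by exists b; rewrite // inE S0b orbT.
pose S := undup S0; have uniqS : uniq S by apply: undup_uniq.
pose V := (\sum_(i < size S) gws S`_i)%VS.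
have dxV := directv_gen_weight h_nil uniqS.
have defV : V = fullv.
  apply/eqP; rewrite eqEsubv subvf defL; apply/span_subvP => v /S0X[a S0a av].
  have lt_a : (index a S < size S)%N by rewrite index_mem mem_undup.
  apply: (subvP (sumv_sup (Ordinal lt_a) _ (subvv _)) v) => //=.
  by rewrite nth_index ?mem_undup //; apply/gen_weight_spaceP.
pose pi0 (i : 'I_(size S)) : 'End(L) := sumv_pi_for (erefl V) i.
pose pi a : 'End(L) := if insub (index a S) is Some i then pi0 i else 0.
have piE (i : 'I_(size S)) : pi S`_i = pi0 i.
  by rewrite /pi index_uniq // valK.
have pi_sum v : \sum_(a <- S) pi a v = v.
  rewrite (big_nth 0) big_mkord -[RHS](sumv_pi_sum (erefl V)) ?defV ?memvf //.
  by apply: eq_bigr => i _; rewrite piE.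
have pi_w a v : gen_weight a (pi a v).
  rewrite /pi; case: insubP => [i _ defi | _]; last first.
    by rewrite zero_lfunE; apply: gen_weight0.
  have aS : a \in S by rewrite -index_mem -defi; apply: ltn_ord.
  apply/gen_weight_spaceP; rewrite -[X in gen_weight_space X](nth_index 0 aS) -defi.
  exact: (memv_sum_pi (erefl V) i v).
have pi_out a : a \notin S -> pi a = 0.
  by move=> aS; rewrite /pi insubF // index_mem (negPf aS).
exists S, pi; split=> // a b v av.
(* The two decompositions of [v] differ by a family of weight vectors with sum zero, which
   independence kills. *)
pose w c := (if c == a then v else 0) - pi c v.
have wP c : gen_weight c (w c).
  rewrite /w -scaleN1r addrC; apply: gen_weightP; first exact: pi_w.
  by case: eqP => [->|_] //; apply: gen_weight0.
suff : w b = 0 by move/eqP; rewrite subr_eq0 => /eqP.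
set T := undup [:: a, b & S].
have uniqT : uniq T by apply: undup_uniq.
have memT c : (c \in T) = [|| c == a, c == b | c \in S].
  by rewrite mem_undup !inE.
have w0 : \sum_(c <- T) w c = 0.
  rewrite /w sumrB -big_mkcond -(big_filter _ (pred1 a)) filter_pred1_uniq //; last first.
    by rewrite memT eqxx.
  rewrite big_seq1; apply/eqP; rewrite subr_eq0 eq_sym; apply/eqP.
  rewrite -[RHS]pi_sum [LHS](bigID (mem S)) /= addrC big1 ?add0r.
    rewrite -[LHS]big_filter; apply: perm_big; apply: uniq_perm => //.
      by rewrite filter_uniq.
    by move=> c; rewrite mem_filter memT; case: (c \in S); rewrite ?orbT.
  by move=> c /pi_out ->; rewrite zero_lfunE.
apply: (gen_weight_indep h_nil uniqT _ w0) => //.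
by rewrite memT eqxx orbT.
Qed.

End CartanDecomposition.

(** * Cartan's criterion *)

Section SemisimpleCartan.
Variables (F : numClosedFieldType) (L : lieAlgType F) (h : {vspace L}).
Implicit Types (x y z u v : L) (U V Q : {vspace L}) (a b c : dual_space h).

Hypothesis h_lie : {in h &, forall x y, lie x y \in h}.
Hypothesis h_nil : {in h &, forall x y, exists m, iter m (lie x) y = 0}.

Variables (wts : seq (dual_space h)) (pi : dual_space h -> 'End(L)).
Hypothesis wts_uniq : uniq wts.
Hypothesis pi_weight : forall a v, gen_weight a (pi a v).
Hypothesis pi_sum : forall v, \sum_(a <- wts) pi a v = v.
Hypothesis pi_out : forall a, a \notin wts -> pi a = 0.
Hypothesis pi_id : forall a b v, gen_weight a v -> pi b v = if b == a then v else 0.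

Local Notation gws := (@gen_weight_space F L h).

Lemma gen_weight_out a v : a \notin wts -> gen_weight a v -> v = 0.
Proof.
move=> /pi_out pia0 av; have := pi_id a av.
by rewrite eqxx pia0 zero_lfunE.
Qed.

Lemma gws_wts a : gws a != 0%VS -> a \in wts.
Proof.
apply: contraR => /gen_weight_out a0; rewrite -subv0; apply/subvP => v.
by move/gen_weight_spaceP/a0 ->; rewrite mem0v.
Qed.

Lemma gws_sum_stable (S : seq (dual_space h)) a x :
    gen_weight a x -> (forall b, b \in S -> b + a \in S \/ b + a \notin wts) ->
  {in (\sum_(i < size S) gws S`_i)%VS,
     forall v, lie x v \in (\sum_(i < size S) gws S`_i)%VS}.
Proof.
move=> ax Sa v /memv_sumP[vs Vvs ->]; rewrite linear_sum /=.
apply: memv_suml => i _; have /gen_weight_spaceP vi := Vvs i isT.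
have := gen_weight_lie ax vi; rewrite addrC => xvi.
have [|Sai|/gen_weight_out/(_ xvi)->] := Sa S`_i; rewrite ?mem_nth ?mem0v //.
have lt_i : (index (S`_i + a)%R S < size S)%N by rewrite index_mem.
apply: (subvP (sumv_sup (Ordinal lt_i) _ (subvv _))) => //=.
by rewrite nth_index //; apply/gen_weight_spaceP.
Qed.

(** A weight that leaves [S] under a shift by a or -a must leave the list of weights, so [e] and [f]
    preserve the sum over [S] and [e, f] has trace zero there. *)
Lemma string_trace (S : seq (dual_space h)) a e f :
    uniq S -> gen_weight a e -> gen_weight (- a) f -> lie e f \in h ->
    (forall b, b \in S -> b + a \in S \/ b + a \notin wts) ->
    (forall b, b \in S -> b - a \in S \/ b - a \notin wts) ->
  \sum_(b <- S) (b (vsproj h (lie e f)) : F) *+ \dim (gws b) = 0.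
Proof.
move=> uniqS ae af hef Sa SNa; rewrite (big_nth 0) big_mkord.
have wef (i : 'I_(size S)) v : v \in gws S`_i ->
    ad (lie e f) v \in gws S`_i.
  move/gen_weight_spaceP => vi; apply/gen_weight_spaceP.
  by rewrite adE; apply: gen_weight_ad.
apply: (commutator_block_trace (V := fun i : 'I__ => gws S`_i)
          (c := fun i : 'I__ => S`_i _) (f := ad e) (g := ad f)).
- exact: directv_gen_weight.
- by move=> v; rewrite adE; apply: gws_sum_stable.
- by move=> v; rewrite adE; apply: gws_sum_stable.
- by move=> i v Vv; rewrite -ad_lie; apply: wef.
move=> i; rewrite -ad_lie.
have [n niln] := uniform_nilpotency (adm (lie e f) (S`_i (vsproj h (lie e f)))).
exists n => v /gen_weight_spaceP/(_ (vsproj h (lie e f)))[m].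
by rewrite vsprojK // => /niln.
Qed.

(** Along S = b + Z a the trace of x = [e, f] is the sum of (b + n a)(x) with multiplicities, and it
    vanishes. In characteristic zero the total dimension can be inverted, so b(x) is minus the
    average of n, times a(x). *)
Lemma weight_rational a e f b :
    gen_weight a e -> gen_weight (- a) f -> lie e f \in h -> gws b != 0%VS ->
  exists2 q : F, q \is Num.real &
    b (vsproj h (lie e f)) = q * (a (vsproj h (lie e f)) : F) :> F.
Proof.
move=> ae af hef nzb; have wb := gws_wts nzb; set x := vsproj h (lie e f).
pose inS c := `[< exists n : int, c = b + a *~ n >].
pose S := [seq c <- wts | inS c].
have uniqS : uniq S by rewrite filter_uniq.
have memS c : c \in S = (c \in wts) && inS c by rewrite mem_filter andbC.
have closed (m : int) c : c \in S -> c + a *~ m \in S \/ c + a *~ m \notin wts.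
  rewrite !memS => /andP[wc /asboolP[n defc]].
  case: (boolP (c + a *~ m \in wts)) => _; [left | by right].
  by apply/asboolP; exists (n + m); rewrite defc mulrzDr addrA.
have := string_trace uniqS ae af hef (closed 1) (closed (-1)); rewrite -/x => trS.
have nP c : exists n : int, c \in S -> c = b + a *~ n.
  case: (boolP (c \in S)) => [|_]; last by exists 0.
  by rewrite memS => /andP[_ /asboolP[n ->]]; exists n.
(* When a = 0 the coefficient is not unique; any choice serves. *)
pose n c := projT1 (cid (nP c)).
have nE c : c \in S -> c = b + a *~ n c by rewrite /n; case: cid.
have Sb : b \in S by rewrite memS wb; apply/asboolP; exists 0; rewrite addr0.
pose d c := \dim (gws c).
have d_neq0 : (\sum_(c <- S) d c)%:R != 0 :> F.
  by rewrite pnatr_eq0 (big_rem b) //= addn_eq0 dimv_eq0 (negPf nzb).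
pose N : int := \sum_(c <- S) (n c *+ d c).
exists (- (N%:~R / (\sum_(c <- S) d c)%:R)).
  by rewrite rpredN rpredM ?rpredV ?realz ?realn.
apply: (mulIf d_neq0); rewrite mulNr mulrAC mulNr divfK //.
apply/eqP; rewrite -addr_eq0 -[X in _ == X]trS; apply/eqP.
rewrite natr_sum rmorph_sum /= mulr_sumr mulr_suml -big_split /=.
rewrite [LHS]big_seq [RHS]big_seq; apply: eq_bigr => c Sc.
have -> : c x = b x + (n c)%:~R * (a x : F) :> F.
  by rewrite {1}(nE c Sc) add_lfunE -scaler_int scale_lfunE.
rewrite mulrnDl mulr_natr -/(d c); congr (_ + _).
rewrite -mulrnAl; congr (_ * _).
by rewrite [RHS]pmulrn -mulrzA -[n c *+ d c]mulr_natr natz.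
Qed.

Lemma escape_weights (c a : dual_space h) :
  a != 0 -> exists k, c + a *+ k \notin wts.
Proof.
move=> nza; apply/not_existsP => /(_ _)/negP esc.
pose s := [seq c + a *+ k | k <- iota 0 (size wts).+1].
have us : uniq s.
  rewrite map_inj_in_uniq ?iota_uniq // => i j _ _ /addrI/eqP.
  wlog leij : i j / (i <= j)%N.
    by move=> W; case: (leqP i j) => [/W//|/ltnW/W/[1!eq_sym] Wji /Wji].
  rewrite -(subnK leij) mulrnDr -subr_eq0 opprD addrC subrK oppr_eq0.
  by rewrite -scaler_nat scaler_eq0 (negPf nza) orbF pnatr_eq0 => /eqP->.
have : (size s <= size wts)%N.
  apply: uniq_leq_size => // _ /mapP[k _ ->].
  by have := esc k; rewrite negbK.
by rewrite size_map size_iota ltnn.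
Qed.

(** ad x ad y shifts weights by a + b, which is nonzero, and there are finitely many weights: it is
    nilpotent. *)
Lemma killing_orthogonal a b x y :
  gen_weight a x -> gen_weight b y -> a + b != 0 -> killing x y = 0.
Proof.
move=> ax bY nzab; rewrite /killing.
have [n niln] := uniform_nilpotency (ad x \o ad y)%VF.
apply: (@lfun_trace_nilpotent _ _ n) => v.
rewrite -[v]pi_sum linear_sum big1 //= => c _.
have [k out] := escape_weights c nzab.
apply: (niln k); apply: gen_weight_out out _; elim: k => [|k IHk].
  by rewrite addr0; apply: pi_weight.
rewrite iterS comp_lfunE !adE mulrS addrCA -addrA.
by apply: gen_weight_lie => //; apply: gen_weight_lie.
Qed.

Lemma killing_square x : x \in h ->
  killing x x = \sum_(a <- wts) (a (vsproj h x) : F) ^+ 2 *+ \dim (gws a).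
Proof.
move=> hx; rewrite (big_nth 0) big_mkord /killing.
have full : (\sum_(i < size wts) gws wts`_i)%VS = fullv.
  apply/eqP; rewrite eqEsubv subvf; apply/subvP => v _.
  rewrite -[v]pi_sum (big_nth 0) big_mkord; apply: memv_suml => i _.
  apply: (subvP (sumv_sup i _ (subvv _))) => //.
  exact/gen_weight_spaceP/pi_weight.
have projE : projv (\sum_(i < size wts) gws wts`_i)%VS = \1%VF.
  by apply/lfunP => v; rewrite id_lfunE projv_id // full memvf.
have := block_trace (V := fun i : 'I__ => gws wts`_i)
  (c := fun i : 'I__ => (wts`_i (vsproj h x) : F) ^+ 2) (f := (ad x \o ad x)%VF)
  (directv_gen_weight h_nil wts_uniq).
rewrite projE comp_lfun1r; apply=> i.
  move=> v /gen_weight_spaceP vi; apply/gen_weight_spaceP.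
  by rewrite comp_lfunE !adE; do 2!apply: gen_weight_ad => //.
set c : F := wts`_i (vsproj h x).
have [n niln] := uniform_nilpotency (adm x c); exists n.
move=> v /gen_weight_spaceP/(_ (vsproj h x))[m].
rewrite vsprojK // => /niln vn.
(* (ad x)^2 - c^2 is ad x + c, named [g], composed with the nilpotent ad x - c, and the two factors
   commute. *)
have [g gE] : exists g : 'End(L), forall u, g u = lie x u + c *: u.
  exists (ad x + c *: \1)%VF => u.
  by rewrite add_lfunE scale_lfunE id_lfunE adE.
have fg u : (ad x \o ad x - c ^+ 2 *: \1)%VF u = g (adm x c u).
  rewrite gE admE add_lfunE opp_lfunE scale_lfunE id_lfunE comp_lfunE !adE.
  rewrite linearB /= [lie x (c *: u)]linearZ /= scalerBr scalerA addrA subrK.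
  by [].
have comm u : g (adm x c u) = adm x c (g u).
  rewrite !gE !admE [lie x (_ - _)]linearB [lie x (_ + _)]linearD /= ![lie x (c *: _)]linearZ /=.
  by rewrite scalerBr scalerDr opprD !addrA subrK addrK.
suff fE k u : iter k (ad x \o ad x - c ^+ 2 *: \1)%VF u = iter k g (iter k (adm x c) u).
  by rewrite fE vn linear0.
elim: k u => // k IHk u; rewrite !iterSr fg IHk comm; congr (iter k g _).
by elim: k {IHk} => //= k ->; rewrite comm.
Qed.

Hypothesis h_zero : forall v, gen_weight (h := h) 0 v -> v \in h.

(** Against a nonzero weight, orthogonality applies. Against z in h, polarize: the weights do not
    distinguish x + z from z, so both have the same square, and so does x with 0; hence 2 K(x, z) =
    0. *)
Lemma killing_h_separates x : x \in h ->
    (forall a, gws a != 0%VS -> a (vsproj h x) = 0) -> forall y, killing x y = 0.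
Proof.
move=> hx x0 y; rewrite -[y]pi_sum killing_sumr big1 // => a _.
have [-> | nza] := eqVneq a 0; last first.
  by apply: (killing_orthogonal (gen_weight_h h_nil hx) (pi_weight _ _)); rewrite add0r.
set z := pi 0 y; have hz : z \in h by apply/h_zero/pi_weight.
have sq a' : gws a' != 0%VS -> a' (vsproj h (x + z)) = a' (vsproj h z).
  by move=> nz; rewrite !linearD /= x0 // add0r.
have eq_sq : killing (x + z) (x + z) = killing z z.
  rewrite !killing_square ?memvD //; apply: eq_bigr => b _.
  by have [->|/sq->//] := eqVneq (gws b) 0%VS; rewrite dimv0.
have xx0 : killing x x = 0.
  rewrite killing_square // big1 // => b _.
  have [->|/x0->//] := eqVneq (gws b) 0%VS; first by rewrite dimv0.
  by rewrite expr0n mul0rn.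
move: eq_sq; rewrite killingDl !killingDr xx0 add0r [killing z x]killingC addrA.
move/eqP; rewrite -[X in _ == X]add0r (inj_eq (addIr _)) -mulr2n mulrn_eq0.
by move=> /eqP.
Qed.

(** All weights at z are real multiples of a(z), so K(z, z) = 0 reads a(z)^2 times a sum of
    nonnegative terms. Either a(z) = 0 or every multiple is zero. *)
Lemma killing_null_bracket a x y z : z = lie x y -> gen_weight a x -> gen_weight (- a) y ->
    killing z z = 0 ->
  forall b, gws b != 0%VS -> b (vsproj h z) = 0.
Proof.
move=> defz ax ay zz0 b nzb.
have hz : z \in h.
  by apply: h_zero; rewrite defz -(subrr a); apply: gen_weight_lie.
rewrite defz in hz zz0 *; set t := vsproj h (lie x y).
have [q _ bE] := weight_rational ax ay hz nzb.
have [at0|nzat] := eqVneq (a t : F) 0; first by rewrite bE -/t at0 mulr0.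
have : \sum_(c <- wts) ((c t : F) / a t) ^+ 2 *+ \dim (gws c) = 0.
  apply: (mulIf (expf_neq0 2 nzat)); rewrite mul0r -[RHS]zz0 [RHS]killing_square // mulr_suml.
  by apply: eq_bigr => c _; rewrite mulrnAl -exprMn divfK.
move/eqP; rewrite psumr_eq0; last first.
  move=> c _; have [->|nzc] := eqVneq (gws c) 0%VS; first by rewrite dimv0.
  have [q' realq' ->] := weight_rational ax ay hz nzc.
  by rewrite mulfK // mulrn_wge0 // -realEsqr.
move/allP/(_ b (gws_wts nzb)).
rewrite /= mulrn_eq0 dimv_eq0 (negPf nzb) /= expf_eq0 /= mulf_eq0 invr_eq0.
by rewrite (negPf nzat) orbF => /eqP.
Qed.

(* The h-component of a bracket of opposite weight vectors of Q is annihilated by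
   all weights, so the weight vectors of the perfect ideal Q are ad-nilpotent. *)
Lemma perfect_null_ideal Q :
    (forall x y, y \in Q -> lie x y \in Q) -> (Q <= lie_prod Q Q)%VS ->
    {in Q, forall x y, killing x y = 0} ->
  Q = 0%VS.
Proof.
move=> idQ perfQ nullQ.
have [|X [defQ wX]] := gen_weight_span h_lie h_nil (U := Q).
  by move=> x y _; apply: idQ.
have XQ x : x \in X -> x \in Q by rewrite defQ; apply: memv_span.
have [K KP] : exists K : {vspace L}, forall v, v \in K <->
    (forall b, gws b != 0%VS -> b (vsproj h (pi 0 v)) = 0).
  apply: vspace_of_pred => [b _|c u v u0 v0 b nzb]; first by rewrite !linear0.
  by rewrite !linearP /= u0 ?v0 // addr0 [_ *: 0]mulr0.
have sQK : (Q <= K)%VS.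
  apply: subv_trans perfQ _; apply/lie_prodP => x y.
  rewrite {1}defQ; move: x y; apply: stable_span => x y Xx.
  rewrite defQ => QX; rewrite -memvN -lieC.
  suff H : {in <<X>>%VS & <[x]>%VS, forall z w, lie z w \in K}.
    by apply: H => //; apply: memv_line.
  apply: stable_span => z _ Xz /vlineP[k ->].
  rewrite linearZ /= memvZ //.
  have [[a ax] [b bY]] := (wX x Xx, wX z Xz).
  apply/KP => c nzc; rewrite (pi_id _ (gen_weight_lie bY ax)).
  have [ba0|_] := eqVneq; last by rewrite !linear0.
  have ab : a = - b by apply/eqP; rewrite -addr_eq0 addrC -ba0.
  rewrite ab in ax; apply: (killing_null_bracket _ bY ax) nzc => //.
  by apply: nullQ; apply: idQ; apply: XQ.
pose S x := x \in Q /\ exists a, gen_weight (h := h) a x.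
have S_lie x y : S x -> S y -> S (lie x y).
  move=> [_ [a ax]] [Qy [b bY]]; split; first exact: idQ.
  by exists (a + b); apply: gen_weight_lie.
have spQ : spanned_by_S S Q.
  by exists X => // x Xx; split; [apply: XQ | apply: wX].
have nilS V : S_nil S V.
  move=> s v [Qs [a as_]] _; have [n niln] := uniform_nilpotency (ad s).
  have adE' k u : iter k (lie s) u = iter k (ad s) u.
    by elim: k => //= k ->; rewrite adE.
  exists n; rewrite adE' -[v]pi_sum linear_sum big1 //= => c _.
  (* A weight vector of weight zero is in h and all weights vanish on it, so its generalized
     eigenvalues are zero. For another weight, iterated shifts leave the finite list of weights. *)
  have [a0 | nza] := eqVneq a 0.
    have [gc0 | nzc] := eqVneq (gws c) 0%VS.
      suff -> : pi c v = 0 by rewrite linear0.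
      by apply/eqP; rewrite -memv0 -gc0; apply/gen_weight_spaceP.
    have hs : s \in h by apply: h_zero; rewrite -a0.
    have [m] := pi_weight c v (vsproj h s).
    have := subvP sQK s Qs; move/KP/(_ c nzc).
    rewrite (pi_id _ as_) a0 eqxx => ->; rewrite vsprojK // => sm.
    apply: (niln m); rewrite -[RHS]sm; elim: (m) => //= k ->.
    by rewrite adE admE scale0r subr0.
  have [k out] := escape_weights c nza.
  apply: (niln k); apply: gen_weight_out out _; elim: k => [|k IHk].
    by rewrite addr0; apply: pi_weight.
  by rewrite iterS adE mulrS addrCA; apply: gen_weight_lie.
apply/eqP/negPn/negP => nzQ.
have QQ : stable_under Q Q by move=> x y _; apply: idQ.
have [W [sWQ neqWQ QW]] :=
  weakly_closed_engel_quotient S_lie spQ QQ (nilS Q) nzQ QQ (nilS Q).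
(* Engel's theorem for [Q] acting on itself puts [Q, Q] in a proper subspace, against
   perfectness. *)
case/negP: neqWQ; rewrite eqEsubv sWQ; apply: subv_trans perfQ _.
exact/lie_prodP.
Qed.

(** * Nondegeneracy of the Killing form and the diagonal action of h *)

Hypothesis h_normalizer :
  forall x, (forall y, y \in h -> lie x y \in h) -> x \in h.
Hypothesis semisimpleL : semisimple_algebra (fullv : {vspace L}).

Lemma lie_prod_ideal Q : (forall x y, y \in Q -> lie x y \in Q) ->
  forall x y, y \in lie_prod Q Q -> lie x y \in lie_prod Q Q.
Proof.
move=> idQ x y QQy; rewrite -adE memv_preim; apply: (subvP _ _ QQy).
apply/lie_prodP => u v Qu Qv; rewrite -memv_preim adE lie_derivation.
by rewrite memvD ?mem_lie_prod ?idQ.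
Qed.

(** Every ideal [Q] inside the radical is zero, by induction on its dimension: if perfect, by
    [perfect_null_ideal]; otherwise [Q, Q] is zero by induction, so [Q] is abelian and
    semisimplicity applies. *)
Lemma killing_nondegenerate x : (forall y, killing x y = 0) -> x = 0.
Proof.
move=> x0; have [K KP] : exists K : {vspace L}, forall v, v \in K <->
    (forall y, killing v y = 0).
  apply: vspace_of_pred => [y|c u v u0 v0 y]; first by rewrite killingC killing0r.
  by rewrite killing_linl u0 v0 mulr0 addr0.
suff K0 : K = 0%VS by apply/eqP; rewrite -memv0 -K0; apply/KP.
suff H n Q : (\dim Q <= n)%N -> (forall x y, y \in Q -> lie x y \in Q) ->
    (Q <= K)%VS -> Q = 0%VS.
  apply: (H _ K (leqnn _)) => // z y /KP y0; apply/KP => w.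
  by rewrite lieC -scaleN1r killingZl killing_invariant y0 mulr0.
elim: n Q => [|n IHn] Q.
  by rewrite leqn0 dimv_eq0 => /eqP.
move=> dimQ idQ sQK.
have sQQ : (lie_prod Q Q <= Q)%VS by apply/lie_prodP => u v _; apply: idQ.
have [eqQ | neqQ] := eqVneq (lie_prod Q Q) Q.
  apply: perfect_null_ideal => //; first by rewrite eqQ.
  by move=> u /(subvP sQK)/KP.
have QQ0 : lie_prod Q Q = 0%VS.
  apply: IHn (lie_prod_ideal idQ) (subv_trans sQQ sQK).
  rewrite -ltnS (leq_trans _ dimQ) // ltn_neqAle dimvS // andbT.
  by apply: contra neqQ => /eqP dQ; rewrite eqEdim sQQ dQ leqnn.
apply: semisimpleL; last by exists 1%N.
by rewrite /lie_ideal subvf; apply/lie_prodP => u v _; apply: idQ.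
Qed.

Lemma h_separating x : x \in h ->
  (forall a, gws a != 0%VS -> a (vsproj h x) = 0) -> x = 0.
Proof. by move=> hx x0; apply/killing_nondegenerate/killing_h_separates. Qed.

(** On a single generalized weight space the trace of [x, y] is a([x, y]) times the dimension, and
    it is zero; weights separate the points of h. *)
Lemma h_abelian : {in h &, forall x y, lie x y = 0}.
Proof.
move=> x y hx hy; apply: h_separating (h_lie hx hy) _ => a nza.
have := @string_trace [:: a] 0 x y isT (gen_weight_h h_nil hx).
have S0 b : b \in [:: a] -> b + 0 \in [:: a] \/ b + 0 \notin wts.
  by rewrite addr0; left.
rewrite oppr0 => /(_ (gen_weight_h h_nil hy) (h_lie hx hy) S0 S0)/eqP.
rewrite big_seq1 mulrn_eq0 dimv_eq0 (negPf nza).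
by move=> /eqP.
Qed.

(** [D], acting on each weight space by its weight at x, is the semisimple part of ad x. It is a
    derivation because weights add up, hence D = ad s by nondegeneracy; s lies in h and has the same
    weights as x, so s = x. *)
Lemma gen_weight_diag a v x : gen_weight a v -> x \in h ->
  lie x v = (a (vsproj h x) : F) *: v.
Proof.
pose t := vsproj h x; move=> av hx.
pose D : 'End(L) := \sum_(a <- wts) (a t : F) *: pi a.
have DE b u : gen_weight b u -> D u = (b t : F) *: u.
  move=> bu; rewrite sum_lfunE; have [wb | nwb] := boolP (b \in wts); last first.
    rewrite (gen_weight_out nwb bu) scaler0 big1 // => c _.
    by rewrite scale_lfunE linear0 scaler0.
  rewrite (bigD1_seq b) //= big1 ?addr0 => [|c /negPf neqcb].
    by rewrite scale_lfunE (pi_id _ bu) eqxx.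
  by rewrite scale_lfunE (pi_id _ bu) neqcb scaler0.
(* [E] measures the failure of the Leibniz rule for [D]; it is checked on weight vectors. *)
pose E u : 'End(L) := ((D \o ad u) - (ad u \o D) - ad (D u))%VF.
have EE u w : E u w = D (lie u w) - lie u (D w) - lie (D u) w.
  by rewrite !add_lfunE !opp_lfunE !comp_lfunE !adE.
have E_sum u w : (forall b, E u (pi b w) = 0) -> E u w = 0.
  by move=> Euw; rewrite -[w]pi_sum linear_sum big1 // => b _; apply: Euw.
have EC u w : E u w = - E w u.
  rewrite !EE (lieC w u) (lieC w (D u)) (lieC (D w) u) !linearN /= !opprK !opprD.
  by rewrite !opprK addrAC.
have E0 u w : E u w = 0.
  apply: (E_sum) => c; rewrite EC; apply/eqP; rewrite oppr_eq0; apply/eqP.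
  apply: E_sum => b; rewrite EE; have [bu cw] := (pi_weight b u, pi_weight c w).
  rewrite (DE _ _ (gen_weight_lie cw bu)) (DE _ _ bu) (DE _ _ cw).
  by rewrite lieZl linearZ /= -scalerBl -scalerBl add_lfunE addrK subrr scale0r.
have Dder u w : D (lie u w) = lie (D u) w + lie u (D w).
  by apply/eqP; rewrite addrC -subr_eq0 opprD addrA -EE E0.
(* The usual proof that derivations are inner: s represents the functional that sends y to the trace
   of D ad y. *)
have [s sP] : exists s, forall u, D u = lie s u.
  have phi_lin : scalar (fun y : L => lfun_trace (D \o ad y)%VF).
    move=> c u w; rewrite ad_lin comp_lfunDr -comp_lfunZr lfun_traceP.
    by [].
  pose lin := GRing.isLinear.Build F L F^o _ _ phi_lin.
  pose phi' : {linear L -> F^o} := HB.pack (fun y => lfun_trace (D \o ad y)%VF) lin.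
  have [s sP] := killing_represents (linfun phi') killing_nondegenerate.
  exists s => u; apply/eqP; rewrite -subr_eq0; apply/eqP.
  apply: killing_nondegenerate => y; rewrite killingDl -scaleN1r killingZl mulN1r.
  have Dad w : ad (D w) = ((D \o ad w) - (ad w \o D))%VF.
    apply/lfunP => z; rewrite add_lfunE opp_lfunE !comp_lfunE !adE Dder.
    by rewrite addrK.
  rewrite killing_invariant -sP lfunE /= /killing Dad ad_lie.
  rewrite comp_lfunDl comp_lfunNl comp_lfunDr comp_lfunNr !lfun_traceB.
  rewrite -!comp_lfunA [lfun_trace (ad u \o (D \o _))%VF]lfun_traceC.
  by rewrite -!comp_lfunA subrr.
have hs : s \in h.
  apply: h_normalizer => y hy; rewrite -sP (DE _ _ (gen_weight_h h_nil hy)).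
  by rewrite zero_lfunE scale0r mem0v.
suff xs : x = s by rewrite {1}xs -sP (DE _ _ av).
apply/eqP; rewrite -subr_eq0; apply/eqP/h_separating; first by rewrite memvB.
(* If b(x) and b(s) differed, vectors of weight b would be eigenvectors of ad s = D for b(x) and
   generalized eigenvectors for b(s), hence zero. *)
move=> b nzb; rewrite linearB /=; apply/eqP; rewrite linearB subr_eq0 -/t.
apply: contraR nzb => neq; rewrite -subv0; apply/subvP => u /gen_weight_spaceP bu.
have [n sn] := bu (vsproj h s); rewrite vsprojK // in sn.
rewrite memv0; apply/eqP; apply: (coprime_nilpotent (f := ad s) neq (m := 1%N) _ sn).
by rewrite /= -/(adm s (b t)) admE -sP (DE _ _ bu) subrr.
Qed.

End SemisimpleCartan.

Section CartanStructure.
Variables (F : numClosedFieldType) (L : lieAlgType F) (h : {vspace L}).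
Implicit Types (x y z u v : L) (U V Q : {vspace L}) (a b c : dual_space h).
Local Notation rs := (@root_space F L fullv h).

Lemma iter_lie_prod U x y n : x \in U -> y \in U ->
  iter n (lie x) y \in iter n (lie_prod U) U.
Proof. by move=> Ux Uy; elim: n => //= n; apply: mem_lie_prod. Qed.

(** Collects what the theory of roots uses; from here on generalized weight spaces are replaced by
    [root_space]. *)
Lemma cartan_structure :
    semisimple_algebra (fullv : {vspace L}) -> cartan_subalgebra fullv h ->
  [/\ {in h &, forall x y, lie x y = 0}, rs 0 = h,
      forall x, (forall y, killing x y = 0) -> x = 0 &
      exists (Phi : seq (dual_space h)) (pi : dual_space h -> 'End(L)),
      [/\ uniq Phi, (forall a, (a \in Phi) = is_root fullv a),
          (forall a v, pi a v \in rs a),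
          (forall v, pi 0 v + \sum_(a <- Phi) pi a v = v) &
          (forall a b v, v \in rs a -> pi b v = if b == a then v else 0)] /\
      [/\ (forall x, x \in h -> killing x x =
             \sum_(a <- Phi) (a (vsproj h x) : F) ^+ 2 *+ \dim (rs a)),
          (forall a b e f, e \in rs a -> f \in rs (- a) -> is_root fullv b ->
             exists2 q : F, q \is Num.real &
               b (vsproj h (lie e f)) = q * (a (vsproj h (lie e f)) : F) :> F) &
          (forall U, {in h & U, forall x v, lie x v \in U} ->
             exists X : seq L, U = <<X>>%VS /\
               forall v, v \in X -> exists a, v \in rs a)]].
Proof.
move=> ssL [_ /lie_prodP hlie [m nilm] self_norm].
have h_lie : {in h &, forall x y, lie x y \in h} by move=> x y; apply: hlie.
have h_nil : {in h &, forall x y, exists n, iter n (lie x) y = 0}.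
  move=> x y hx hy; exists m; apply/eqP; rewrite -memv0 -nilm.
  exact: iter_lie_prod.
have h_norm x : (forall y, y \in h -> lie x y \in h) -> x \in h.
  by apply: self_norm; apply: memvf.
(* If the generalized zero weight space [W] exceeded h, Engel's theorem for h acting on W modulo h
   would yield a vector outside h that normalizes h. *)
have h_zero v : gen_weight (h := h) 0 v -> v \in h.
  pose W := gen_weight_space (0 : dual_space h).
  have shW : (h <= W)%VS.
    by apply/subvP => x hx; apply/gen_weight_spaceP/gen_weight_h.
  have [hW | neq] := eqVneq h W.
    by move/gen_weight_spaceP; rewrite -/W -hW.
  have sph : spanned_by_S (fun x => x \in h) h.
    by exists (vbasis h) => [|x /vbasis_mem//]; rewrite (span_basis (vbasisP h)).
  have nilW : S_nil (fun x => x \in h) W.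
    move=> s w hs /gen_weight_spaceP/(_ (vsproj h s))[n].
    rewrite zero_lfunE vsprojK // => sn; exists n.
    by rewrite -[RHS]sn; elim: (n) => //= k ->; rewrite admE scale0r subr0.
  have hW : stable_under h W.
    move=> x w hx /gen_weight_spaceP w0; apply/gen_weight_spaceP.
    exact: gen_weight_ad.
  have [w [_ nhw hw]] := weakly_closed_engel h_lie sph h_lie h_nil shW neq hW h_lie nilW.
  case/negP: nhw; apply: h_norm => y hy.
  by rewrite lieC memvN hw.
have [wts [pi [uniqw piw pisum piout piid]]] := gen_weight_decomposition h_lie h_nil.
have diag a v x : gen_weight a v -> x \in h -> lie x v = (a (vsproj h x) : F) *: v.
  exact: (gen_weight_diag h_lie h_nil uniqw piw pisum piout piid h_zero h_norm).
have rsP a v : v \in rs a <-> gen_weight a v.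
  split=> [/root_spaceP[_ va] t | av].
    by exists 1%N; rewrite /= admE va subrr.
  apply/root_spaceP; split=> [|t]; first exact: memvf.
  by rewrite (diag a v _ av (subvsP t)) vsvalK.
have rs_out a : a \notin wts -> rs a = 0%VS.
  move=> nwa; apply/eqP; rewrite -subv0; apply/subvP => v /rsP av.
  by rewrite memv0; apply/eqP; apply: (gen_weight_out piout piid nwa av).
split.
- exact: (h_abelian h_lie h_nil uniqw piw pisum piout piid h_zero ssL).
- apply/vspaceP => v; apply/idP/idP => [/rsP/h_zero // | hv].
  exact/rsP/gen_weight_h.
- exact: (killing_nondegenerate h_lie h_nil uniqw piw pisum piout piid h_zero ssL).
exists [seq a <- wts | is_root fullv a], pi; split; first split.
- by rewrite filter_uniq.
- move=> a; rewrite mem_filter andb_idr // => /andP[_].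
  by apply: contraR => /rs_out->.
- by move=> a v; apply/rsP.
- move=> v; set Phi := filter _ _; set w := _ + _.
  rewrite -[RHS]pisum -[LHS]pisum; apply: eq_bigr => a _.
  rewrite linearD linear_sum /= (piid _ _ _ (piw 0 v)).
  under eq_bigr do rewrite (piid _ _ _ (piw _ v)) eq_sym.
  rewrite -big_mkcond -big_filter.
  have [->|nza] := eqVneq a 0.
    rewrite big1_seq ?addr0 // => b /andP[_].
    rewrite !mem_filter => /andP[/eqP->].
    by rewrite /is_root eqxx.
  rewrite add0r; have [Pa | nPa] := boolP (a \in Phi).
    by rewrite filter_pred1_uniq ?filter_uniq // big_seq1.
  rewrite big1_seq => [|b /andP[_]]; last first.
    by rewrite mem_filter => /andP[/eqP->]; rewrite (negPf nPa).
  apply/esym/eqP; have [wa | /piout->] := boolP (a \in wts); last by rewrite zero_lfunE.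
  move: nPa; rewrite mem_filter wa andbT negb_and nza negbK => /eqP rsa0.
  by rewrite -memv0 -rsa0; apply/rsP.
- by move=> a b v /rsP; apply: piid.
have gwsE a : gen_weight_space a = rs a.
  by apply/vspaceP => v; apply/idP/idP => [/gen_weight_spaceP/rsP|/rsP/gen_weight_spaceP].
split=> [x hx | a b e f /rsP ae /rsP af /andP[_ nzb] | U hU].
  rewrite (killing_square h_nil uniqw piw pisum hx).
  rewrite [LHS](bigID (fun a : dual_space h => is_root fullv a)) /= addrC big1 ?add0r => [|a].
    by rewrite big_filter; apply: eq_bigr => a _; rewrite gwsE.
  rewrite negb_and !negbK gwsE => /orP[/eqP-> | /eqP->].
    by rewrite zero_lfunE expr0n mul0rn.
  by rewrite dimv0.
  apply: (weight_rational h_nil uniqw piout piid ae af); last by rewrite gwsE.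
  by apply: h_zero; rewrite -(subrr a); apply: gen_weight_lie.
have [X [defU wX]] := gen_weight_span h_lie h_nil hU.
by exists X; split=> // v /wX[a av]; exists a; apply/rsP.
Qed.
End CartanStructure.

(** * Roots *)

Section Roots.
Variables (F : numClosedFieldType) (L : lieAlgType F) (h : {vspace L}).
Implicit Types (x y z u v e f : L) (U V Q : {vspace L}) (a b c d : dual_space h).
Local Notation rs := (@root_space F L fullv h).
Local Notation root := (@is_root F L fullv h).

Hypothesis ssL : semisimple_algebra (fullv : {vspace L}).
Hypothesis cartanL : cartan_subalgebra fullv h.

(** Evaluation at elements of L through [vsproj], meaningful on h; it spares the coercions from the
    subspace type. *)
Definition ev a x : F := a (vsproj h x).

Lemma ev_lin a k x y : ev a (k *: x + y) = k * ev a x + ev a y.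
Proof. by rewrite /ev !linearP. Qed.

Lemma evDl a b x : ev (a + b) x = ev a x + ev b x.
Proof. by rewrite /ev add_lfunE. Qed.

Lemma evNl a x : ev (- a) x = - ev a x.
Proof. by rewrite /ev opp_lfunE. Qed.

Lemma evZl k a x : ev (k *: a) x = k * ev a x.
Proof. by rewrite /ev scale_lfunE. Qed.

Lemma ev0l x : ev 0 x = 0.
Proof. by rewrite /ev zero_lfunE. Qed.

Lemma ev_suml (I : Type) (r : seq I) (P : pred I) (w : I -> dual_space h) x :
  ev (\sum_(i <- r | P i) w i) x = \sum_(i <- r | P i) ev (w i) x.
Proof. exact: (big_morph (ev^~ x) (fun a b => evDl a b x) (ev0l x)). Qed.

Lemma ev_eq a b : {in h, ev a =1 ev b} -> a = b.
Proof.
by move=> eqab; apply/lfunP => t; have := eqab _ (subvsP t); rewrite /ev vsvalK.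
Qed.

Lemma h_abelianL : {in h &, forall x y, lie x y = 0}.
Proof. by have [] := cartan_structure ssL cartanL. Qed.

Lemma rs0 : rs 0 = h.
Proof. by have [] := cartan_structure ssL cartanL. Qed.

Lemma mem_rs0 x : (x \in rs 0) = (x \in h).
Proof. by rewrite rs0. Qed.

Lemma killing_nondegenerateL x : (forall y, killing x y = 0) -> x = 0.
Proof. by have [_ _ nd _] := cartan_structure ssL cartanL; apply: nd. Qed.

Lemma roots_exist : exists Phi : seq (dual_space h) * (dual_space h -> 'End(L)),
  let: (root_seq, pi) := Phi in
   [/\ uniq root_seq, (forall a, (a \in root_seq) = root a),
       (forall a v, pi a v \in rs a),
       (forall v, pi 0 v + \sum_(a <- root_seq) pi a v = v) &
       (forall a b v, v \in rs a -> pi b v = if b == a then v else 0)] /\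
   [/\ (forall x, x \in h -> killing x x =
          \sum_(a <- root_seq) (a (vsproj h x) : F) ^+ 2 *+ \dim (rs a)),
       (forall a b e f, e \in rs a -> f \in rs (- a) -> root b ->
          exists2 q : F, q \is Num.real &
            b (vsproj h (lie e f)) = q * (a (vsproj h (lie e f)) : F) :> F) &
       (forall U, {in h & U, forall x v, lie x v \in U} ->
          exists X : seq L, U = <<X>>%VS /\
            forall v, v \in X -> exists a, v \in rs a)].
Proof.
by have [_ _ _ [Phi [pi H]]] := cartan_structure ssL cartanL; exists (Phi, pi).
Qed.

Definition root_seq : seq (dual_space h) := (projT1 (cid roots_exist)).1.
Definition rproj : dual_space h -> 'End(L) := (projT1 (cid roots_exist)).2.

Lemma roots_spec :
   [/\ uniq root_seq, (forall a, (a \in root_seq) = root a),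
       (forall a v, rproj a v \in rs a),
       (forall v, rproj 0 v + \sum_(a <- root_seq) rproj a v = v) &
       (forall a b v, v \in rs a -> rproj b v = if b == a then v else 0)] /\
   [/\ (forall x, x \in h -> killing x x =
          \sum_(a <- root_seq) (a (vsproj h x) : F) ^+ 2 *+ \dim (rs a)),
       (forall a b e f, e \in rs a -> f \in rs (- a) -> root b ->
          exists2 q : F, q \is Num.real &
            b (vsproj h (lie e f)) = q * (a (vsproj h (lie e f)) : F) :> F) &
       (forall U, {in h & U, forall x v, lie x v \in U} ->
          exists X : seq L, U = <<X>>%VS /\
            forall v, v \in X -> exists a, v \in rs a)].
Proof. by rewrite /root_seq /rproj; case: cid => [[]]. Qed.

Lemma roots_uniq : uniq root_seq. Proof. by have [[]] := roots_spec. Qed.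
Lemma mem_roots a : (a \in root_seq) = root a. Proof. by have [[]] := roots_spec. Qed.
Lemma rprojP a v : rproj a v \in rs a. Proof. by have [[]] := roots_spec. Qed.
Lemma rproj_sum v : rproj 0 v + \sum_(a <- root_seq) rproj a v = v.
Proof. by have [[]] := roots_spec. Qed.
Lemma rproj_id a b v : v \in rs a -> rproj b v = if b == a then v else 0.
Proof. by have [[_ _ _ _ pid] _] := roots_spec; apply: pid. Qed.

Lemma root_neq0 a : root a -> a != 0. Proof. by case/andP. Qed.
Lemma is_root0 : root 0 = false. Proof. by rewrite /is_root eqxx. Qed.
Lemma rs_out a : a != 0 -> ~~ root a -> rs a = 0%VS.
Proof. by rewrite /is_root => -> /=; rewrite negbK => /eqP. Qed.
Lemma rs_root a v : v \in rs a -> v != 0 -> a != 0 -> root a.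
Proof.
move=> av nzv nza; rewrite /is_root nza; apply: contra nzv => /eqP rsa0.
by rewrite -memv0 -rsa0.
Qed.

Lemma lie_rs a v x : v \in rs a -> x \in h -> lie x v = ev a x *: v.
Proof. by move=> /root_spaceP[_ av] hx; rewrite /ev -av vsprojK. Qed.

Lemma mem_rs a v : {in h, forall x, lie x v = ev a x *: v} -> v \in rs a.
Proof.
move=> av; apply/root_spaceP; split=> [|t]; first exact: memvf.
by rewrite av ?subvsP // /ev vsvalK.
Qed.

Lemma lie_mem_rs a b u v : u \in rs a -> v \in rs b -> lie u v \in rs (a + b).
Proof.
move=> au bv; apply: mem_rs => x hx; rewrite lie_derivation.
rewrite (lie_rs au hx) (lie_rs bv hx) lieZl linearZ /= -scalerDl.
by rewrite evDl.
Qed.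

Lemma killing_rs_orthogonal a b u v :
  u \in rs a -> v \in rs b -> a + b != 0 -> killing u v = 0.
Proof.
move=> au bv /lfunPn[t]; rewrite zero_lfunE => nzt; have ht := subvsP t.
have := killing_invariant u (vsval t) v.
rewrite lieC (lie_rs au ht) (lie_rs bv ht) -scaleNr killingZl killingZr.
move/eqP; rewrite eq_sym -subr_eq0 -mulrBl opprK -!/(ev _ _) addrC -evDl mulf_eq0.
by rewrite /ev vsvalK (negPf nzt) => /eqP.
Qed.

Lemma killing_h_rs a x v : a != 0 -> x \in h -> v \in rs a -> killing x v = 0.
Proof.
move=> nza; rewrite -mem_rs0 => hx av.
by apply: killing_rs_orthogonal hx av _; rewrite add0r.
Qed.

Lemma killing_rproj0 x y : x \in h -> killing x y = killing x (rproj 0 y).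
Proof.
move=> hx; rewrite -{1}[y]rproj_sum killingDr killing_sumr big1_seq ?addr0 //.
move=> a /andP[_]; rewrite mem_roots => /root_neq0 nza.
exact: killing_h_rs (rprojP a y).
Qed.

Lemma coroot_exists a : exists t, t \in h /\ {in h, forall x, killing t x = ev a x}.
Proof.
have phi_lin : scalar (fun y => ev a (rproj 0 y)).
  by move=> c x y; rewrite linearP ev_lin.
pose lin := GRing.isLinear.Build F L F^o _ _ phi_lin.
pose phi : {linear L -> F^o} := HB.pack (fun y => ev a (rproj 0 y)) lin.
have [s sP] := killing_represents (linfun phi) killing_nondegenerateL.
have hs : rproj 0 s \in h by rewrite -mem_rs0 rprojP.
exists (rproj 0 s); split=> // x hx.
rewrite killingC -killing_rproj0 // killingC -sP lfunE /=.
by rewrite (rproj_id 0 (_ : x \in rs 0)) ?mem_rs0 ?eqxx.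
Qed.

(** The element of h dual to a under the Killing form, often written t_a; it is not normalized as a
    coroot. *)
Definition tau a : L := projT1 (cid (coroot_exists a)).

Lemma tau_h a : tau a \in h.
Proof. by rewrite /tau; case: cid => t []. Qed.

Lemma killing_tau a x : x \in h -> killing (tau a) x = ev a x.
Proof. by move=> hx; rewrite /tau; case: cid => t [_ ->]. Qed.

(** The Killing form of h carried to the dual. Its values are complex in general and real on pairs
    of roots. *)
Definition dot a b : F := ev a (tau b).

Lemma dotC a b : dot a b = dot b a.
Proof. by rewrite /dot -!killing_tau ?tau_h // killingC. Qed.
Lemma dotDl a b c : dot (a + b) c = dot a c + dot b c. Proof. exact: evDl. Qed.
Lemma dotNl a b : dot (- a) b = - dot a b. Proof. exact: evNl. Qed.
Lemma dotZl k a b : dot (k *: a) b = k * dot a b. Proof. exact: evZl. Qed.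
Lemma dot_suml (I : Type) (r : seq I) (P : pred I) (w : I -> dual_space h) b :
  dot (\sum_(i <- r | P i) w i) b = \sum_(i <- r | P i) dot (w i) b.
Proof. exact: ev_suml. Qed.
Lemma dotNr a b : dot a (- b) = - dot a b.
Proof. by rewrite !(dotC a) dotNl. Qed.
Lemma dotZr k a b : dot a (k *: b) = k * dot a b.
Proof. by rewrite !(dotC a) dotZl. Qed.
Lemma dot_sumr (I : Type) (r : seq I) (P : pred I) (w : I -> dual_space h) b :
  dot b (\sum_(i <- r | P i) w i) = \sum_(i <- r | P i) dot b (w i).
Proof. by rewrite dotC dot_suml; apply: eq_bigr => i _; rewrite dotC. Qed.
Lemma dot0l a : dot 0 a = 0. Proof. exact: ev0l. Qed.
Lemma dotMnl a b n : dot (a *+ n) b = dot a b *+ n.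
Proof. by elim: n => [|n IHn]; rewrite ?dot0l // !mulrS dotDl IHn. Qed.

Lemma lie_tau a u v : u \in rs a -> v \in rs (- a) ->
  lie u v = killing u v *: tau a.
Proof.
move=> au av; have huv : lie u v \in h by rewrite -mem_rs0 -(subrr a) lie_mem_rs.
apply/eqP; rewrite -subr_eq0; apply/eqP/killing_nondegenerateL => y.
rewrite killing_rproj0 ?memvB ?memvZ ?tau_h //.
set x := rproj 0 y; have hx : x \in h by rewrite -mem_rs0 rprojP.
rewrite killingDl -scaleN1r !killingZl killing_invariant lieC (lie_rs av hx).
rewrite -scaleNr killingZr evNl opprK killing_tau // mulN1r mulrC subrr //.
Qed.

Lemma center0 x : (forall y, lie x y = 0) -> x = 0.
Proof.
move=> x0; apply: killing_nondegenerateL => y; rewrite /killing.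
suff -> : ad x = 0 by rewrite comp_lfun0l lfun_trace0.
by apply/lfunP => z; rewrite adE x0 zero_lfunE.
Qed.

Lemma roots_separate x : x \in h -> (forall a, root a -> ev a x = 0) -> x = 0.
Proof.
move=> hx x0; apply: center0 => y; rewrite -[y]rproj_sum linearD linear_sum /=.
rewrite h_abelianL ?add0r //; last by rewrite -mem_rs0 rprojP.
rewrite big1_seq // => a /andP[_]; rewrite mem_roots => /x0 ax.
by rewrite (lie_rs (rprojP a y) hx) ax scale0r.
Qed.

Lemma tau_eq0 a : (forall b, root b -> dot b a = 0) -> a = 0.
Proof.
move=> a0; apply: ev_eq => x hx; rewrite ev0l -killing_tau //.
by rewrite (roots_separate (tau_h a) a0) killingC killing0r.
Qed.

(** Nondegeneracy and orthogonality of root spaces give a partner of weight -a. The scaling makes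
    [e, f] = [tau a], so this is not the standard sl_2 triple. *)
Lemma root_triple a : root a ->
  exists e f, [/\ e \in rs a, f \in rs (- a), e != 0, f != 0 & lie e f = tau a].
Proof.
case/andP => nza nzrs; pose e := vpick (rs a).
have nze : e != 0 by rewrite vpick0.
have ae : e \in rs a by apply: memv_pick.
have [y nzy] : exists y, killing e y != 0.
  apply/not_existsP => e0; case/eqP: nze; apply: killing_nondegenerateL => y.
  by apply/eqP/negPn/negP/e0.
have ey : killing e y = killing e (rproj (- a) y).
  rewrite -{1}[y]rproj_sum killingDr killing_sumr.
  rewrite (killing_rs_orthogonal ae (rprojP 0 y)) ?addr0 ?add0r //.
  have [ra | nra] := boolP (- a \in root_seq).
    rewrite (bigD1_seq (- a)) ?roots_uniq //= big1 ?addr0 // => b neqb.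
    by rewrite (killing_rs_orthogonal ae (rprojP b y)) // addrC addr_eq0.
  have := rprojP (- a) y; rewrite mem_roots in nra.
  rewrite rs_out ?oppr_eq0 // memv0 => /eqP->; rewrite killing0r big1_seq //.
  move=> b /andP[_ rb]; rewrite (killing_rs_orthogonal ae (rprojP b y)) //.
  by rewrite addrC addr_eq0; apply: contraNneq nra => <-; rewrite -mem_roots.
rewrite ey in nzy; set f0 := rproj (- a) y in nzy.
have af0 : f0 \in rs (- a) by apply: rprojP.
exists e, ((killing e f0)^-1 *: f0).
split; [exact: ae | exact: memvZ | exact: nze | |].
  rewrite scaler_eq0 invr_eq0 (negPf nzy) /=.
  by apply: contraNneq nzy => ->; rewrite killing0r.
by rewrite linearZ /= (lie_tau ae af0) scalerA mulVf // scale1r.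
Qed.

Lemma is_rootN a : root a -> root (- a).
Proof.
move=> ra; have [e [f [_ af _ nzf _]]] := root_triple ra.
by apply: rs_root af nzf _; rewrite oppr_eq0 root_neq0.
Qed.

Lemma is_rootNE a : root (- a) = root a.
Proof. by apply/idP/idP => /is_rootN; rewrite ?opprK. Qed.

Lemma dot_ratio a b : root a -> root b ->
  exists2 q, q \is Num.real & dot b a = q * dot a a.
Proof.
move=> ra rb; have [e [f [ae af _ _ eft]]] := root_triple ra.
by have [_ [_ /(_ a b e f ae af rb) + _]] := roots_spec; rewrite eft.
Qed.

Lemma killing_tau_square x : x \in h ->
  killing x x = \sum_(b <- root_seq) ev b x ^+ 2 *+ \dim (rs b).
Proof. by have [_ [sq _ _]] := roots_spec; apply: sq. Qed.

Lemma rproj_stable U b v :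
  {in h & U, forall x u, lie x u \in U} -> v \in U -> rproj b v \in U.
Proof.
move=> hU; have [_ [_ _ /(_ U hU)[X [defU XP]]]] := roots_spec.
rewrite [in v \in U]defU => Xv; rewrite (coord_span (X := in_tuple X) Xv) linear_sum.
apply: memv_suml => i _; rewrite linearZ memvZ //.
have Xi : X`_i \in X by apply: mem_nth.
have [a ai] := XP _ Xi; rewrite /= (rproj_id b ai); case: eqP => _.
  by rewrite defU memv_span.
exact: mem0v.
Qed.

(** D = (a, a) is nonzero, as otherwise all (b, a), being multiples of it, vanish and a = 0. The
    trace formula reads D = D^2 Q, where Q is a sum of real squares, so D = 1/Q. Positivity in [F]
    includes being real. *)
Lemma dot_root_gt0 a : root a -> 0 < dot a a.
Proof.
move=> ra; set D := dot a a.
have nzD : D != 0.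
  apply/eqP => D0; case/eqP: (root_neq0 ra); apply: tau_eq0 => b rb.
  by have [q _ ->] := dot_ratio ra rb; rewrite -/D D0 mulr0.
pose Q := \sum_(b <- root_seq) (dot b a / D) ^+ 2 *+ \dim (rs b).
have Q_ge0 : 0 <= Q.
  rewrite /Q big_seq sumr_ge0 // => b; rewrite mem_roots => rb.
  have [q q_real ->] := dot_ratio ra rb.
  by rewrite mulfK // mulrn_wge0 // -realEsqr.
have DQ : D = D ^+ 2 * Q.
  rewrite {1}/D /dot -killing_tau ?tau_h // killing_tau_square ?tau_h // mulr_sumr.
  apply: eq_bigr => b _; rewrite mulrnAr -exprMn mulrC divfK //.
have {DQ}DQ : 1 = D * Q.
  by apply: (mulfI nzD); rewrite mulr1 {1}DQ expr2 mulrA.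
have nzQ : Q != 0.
  by apply: contra_eq_neq DQ => ->; rewrite mulr0 oner_eq0.
have -> : D = Q^-1 by apply: (mulIf nzQ); rewrite mulVf.
by rewrite invr_gt0 lt_neqAle eq_sym nzQ.
Qed.

Lemma dot_real a b : root a -> root b -> dot a b \is Num.real.
Proof.
move=> ra rb; have [q q_real ->] := dot_ratio rb ra.
by rewrite rpredM // gtr0_real // dot_root_gt0.
Qed.

End Roots.

(** * Root strings *)

(** How a vanishing trace is exploited: if all eigenvalues are positive, every multiplicity is
    zero. *)
Lemma psum_mulrn_eq0 (R : numDomainType) (T : eqType) (s : seq T) (w : T -> R)
    (n : T -> nat) :
    {in s, forall b, 0 < w b} -> \sum_(b <- s) w b *+ n b = 0 ->
  {in s, forall b, n b = 0%N}.
Proof.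
move=> w_gt0 /eqP; rewrite big_seq psumr_eq0 => [/allP sum0 b sb | b sb].
  by have := sum0 b sb; rewrite sb /= mulrn_eq0 (gt_eqF (w_gt0 b sb)) orbF => /eqP->.
by apply: mulrn_wge0; apply: ltW; apply: w_gt0.
Qed.

Section RootStrings.
Variables (F : numClosedFieldType) (L : lieAlgType F) (h : {vspace L}).
Implicit Types (x y z u v e f : L) (U V Q : {vspace L}) (a b c d : dual_space h).
Local Notation rs := (@root_space F L fullv h).
Local Notation root := (@is_root F L fullv h).

Hypothesis ssL : semisimple_algebra (fullv : {vspace L}).
Hypothesis cartanL : cartan_subalgebra fullv h.
Local Notation root_seq := (root_seq ssL cartanL).
Local Notation rproj := (rproj ssL cartanL).
Local Notation tau := (tau ssL cartanL).
Local Notation dot := (dot ssL cartanL).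

Lemma rproj_self a v : v \in rs a -> rproj a v = v.
Proof. by move=> av; rewrite (rproj_id _ _ _ av) eqxx. Qed.

Lemma directv_rs (S : seq (dual_space h)) (V : dual_space h -> {vspace L}) :
    uniq S -> (forall b, (V b <= rs b)%VS) ->
  directv (\sum_(i < size S) V S`_i).
Proof.
move=> uniqS sV; apply/directv_sum_independent => us Us sum0 i _.
have usP j : us j \in rs S`_j by apply: (subvP (sV _)); apply: Us.
rewrite -[us i](rproj_self (usP i)) -[RHS](linear0 (rproj S`_i)) -[in RHS]sum0.
rewrite linear_sum /= (bigD1 i) //= big1 ?addr0 // => j neqji.
rewrite (rproj_id _ _ _ (usP j)) (_ : (S`_i == S`_j) = false) //.
by rewrite nth_uniq // eq_sym; apply: negPf.
Qed.

(** Subspaces of root spaces are allowed, so that a string can be cut at a point where a full root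
    space would not be stable. *)
Lemma graded_trace (S : seq (dual_space h)) (V : dual_space h -> {vspace L}) e f :
    uniq S -> (forall b, (V b <= rs b)%VS) -> lie e f \in h ->
    (forall b v, b \in S -> v \in V b ->
       lie e v = 0 \/ exists2 c, c \in S & lie e v \in V c) ->
    (forall b v, b \in S -> v \in V b ->
       lie f v = 0 \/ exists2 c, c \in S & lie f v \in V c) ->
  \sum_(b <- S) ev b (lie e f) *+ \dim (V b) = 0.
Proof.
move=> uniqS sV hef eS fS; rewrite (big_nth 0) big_mkord.
have stable x : (forall b v, b \in S -> v \in V b ->
       lie x v = 0 \/ exists2 c, c \in S & lie x v \in V c) ->
    {in (\sum_(i < size S) V S`_i)%VS,
      forall v, ad x v \in (\sum_(i < size S) V S`_i)%VS}.
  move=> xS v /memv_sumP[vs Vvs ->]; rewrite linear_sum /=.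
  apply: memv_suml => i _; rewrite adE.
  have [||->|[c Sc Vc]] := xS S`_i (vs i); rewrite ?mem_nth ?mem0v ?Vvs //.
  have lt_c : (index c S < size S)%N by rewrite index_mem.
  apply: (subvP (sumv_sup (Ordinal lt_c) _ (subvv _))) => //=.
  by rewrite nth_index.
have efE (i : 'I_(size S)) v : v \in V S`_i ->
    ad (lie e f) v = ev S`_i (lie e f) *: v.
  by move/(subvP (sV _)) => rv; rewrite adE (lie_rs rv hef).
apply: (commutator_block_trace (V := fun i : 'I__ => V S`_i)
          (c := fun i : 'I__ => ev S`_i _) (f := ad e) (g := ad f)).
- exact: directv_rs.
- exact: stable.
- exact: stable.
- by move=> i v Vv; rewrite -ad_lie (efE i) // memvZ.
move=> i; exists 1%N => v Vv /=; rewrite -ad_lie.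
by rewrite add_lfunE opp_lfunE scale_lfunE id_lfunE (efE i) // subrr.
Qed.

(* The trace of [tau a] on the sum, over n > 0, of the spaces
   {v in g_(-n a) | n = 1 -> [e, v] = 0} vanishes, but its eigenvalues there
   are all negative. *)
Lemma dim_opp_root_space a : root a ->
  \dim (rs (- a)) = 1%N /\ rs (- (a *+ 2)) = 0%VS.
Proof.
move=> ra; have [e [f [ae af nze nzf eft]]] := root_triple ssL cartanL ra.
have nza := root_neq0 ra.
have neq_mul m n : (a *+ m == a *+ n) = (m == n).
  apply/eqP/eqP => [|-> //]; wlog le_mn : m n / (m <= n)%N.
    by move=> W; case: (leqP m n) => [/W//|/ltnW/W{W}W /esym/W].
  move/eqP; rewrite eq_sym -subr_eq0 -mulrnBr // -scaler_nat scaler_eq0 (negPf nza).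
  by rewrite orbF pnatr_eq0 subn_eq0 => le_nm; apply/eqP; rewrite eqn_leq le_mn.
pose inS b := `[< exists n, b = - (a *+ n.+1) >].
pose S := [seq b <- root_seq | inS b].
(* [e] maps weight -a into h, which is outside the sum; the cut to the kernel of [e] prevents
   this. *)
pose V b := if b == - a then (rs b :&: lker (ad e))%VS else rs b.
have sV b : (V b <= rs b)%VS by rewrite /V; case: ifP => _; [exact: capvSl | exact: subvv].
have SP n v : v \in rs (- (a *+ n.+1)) -> v != 0 -> - (a *+ n.+1) \in S.
  move=> rv nzv; rewrite mem_filter mem_roots (rs_root rv nzv) ?andbT.
    by apply/asboolP; exists n.
  by rewrite oppr_eq0 -(mulr0n a) neq_mul.
have uniqS : uniq S by rewrite filter_uniq ?roots_uniq.
have hef : lie e f \in h by rewrite eft tau_h.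
have trS : \sum_(b <- S) ev b (lie e f) *+ \dim (V b) = 0.
  apply: graded_trace => // b v; rewrite mem_filter => /andP[/asboolP[n ->] _].
    case: n => [|[|n]] Vv.
    - left; move: Vv; rewrite /V eqxx memv_cap => /andP[_].
      by rewrite memv_ker adE => /eqP.
    - have [->|nz] := eqVneq (lie e v) 0; [by left | right].
      have rev : lie e v \in rs (- (a *+ 1)).
        have := lie_mem_rs ae (subvP (sV _) _ Vv).
        by rewrite mulrS opprD addrA subrr add0r.
      exists (- (a *+ 1)); first exact: SP nz.
      (* [e, [e, v]] is a multiple of K(e, [e, v]) = K([e, e], v) = 0, so [e] does land in the cut
         space. *)
      rewrite /V eqxx memv_cap rev memv_ker adE (lie_tau ssL cartanL ae rev).
      by rewrite -killing_invariant liexx killingC killing0r scale0r eqxx.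
    have [->|nz] := eqVneq (lie e v) 0; [by left | right].
    have rev : lie e v \in rs (- (a *+ n.+2)).
      have := lie_mem_rs ae (subvP (sV _) _ Vv).
      by rewrite [a *+ n.+3]mulrS opprD addrA subrr add0r.
    exists (- (a *+ n.+2)); first exact: SP nz.
    by rewrite /V eqr_opp -{2}[a]mulr1n neq_mul.
  move=> Vv; have [->|nz] := eqVneq (lie f v) 0; [by left | right].
  have rfv : lie f v \in rs (- (a *+ n.+2)).
    have := lie_mem_rs af (subvP (sV _) _ Vv).
    by rewrite [a *+ n.+2]mulrS opprD.
  exists (- (a *+ n.+2)); first exact: SP nz.
  by rewrite /V eqr_opp -{2}[a]mulr1n neq_mul.
have V0 b : b \in S -> V b = 0%VS.
  move=> Sb; apply/eqP; rewrite -dimv_eq0; apply/eqP.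
  apply: (psum_mulrn_eq0 (w := fun b => - ev b (lie e f)) (n := fun b => \dim (V b)) _ _ Sb).
    move=> c; rewrite mem_filter => /andP[/asboolP[n ->] _].
    rewrite evNl opprK eft -/(dot _ _) dotMnl pmulrn_lgt0 //.
    exact: dot_root_gt0.
  under eq_bigr do rewrite mulNrn.
  by rewrite sumrN trS oppr0.
have f_line : rs (- a) = <[f]>%VS.
  apply/eqP; rewrite eqEsubv -memvE af andbT; apply/subvP => y ay.
  (* Both [e, y] and K(e, y) [e, f] equal K(e, y) [tau a], so the difference lies in the cut space,
     which is zero. *)
  have y0 : y - killing e y *: f = 0.
    apply/eqP; rewrite -memv0 -(V0 (- a)).
      rewrite /V eqxx memv_cap memvB ?memvZ //= memv_ker adE linearB linearZ /= eft.
      by rewrite (lie_tau ssL cartanL ae ay) subrr.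
    by rewrite -[a]mulr1n; apply: (SP 0%N) nzf; rewrite mulr1n.
  by apply/vlineP; exists (killing e y); apply/eqP; rewrite -subr_eq0 y0.
split; first by rewrite f_line dim_vline nzf.
apply/eqP; rewrite -subv0; apply/subvP => v rv; rewrite memv0.
apply/negPn/negP => nzv; have Sv := SP 1%N v rv nzv.
case/negP: nzv; rewrite -memv0 -(V0 _ Sv).
by rewrite /V eqr_opp -{2}[a]mulr1n neq_mul.
Qed.

Lemma dim_root_space a : root a -> \dim (rs a) = 1%N.
Proof. by rewrite -(is_rootNE ssL cartanL) => /dim_opp_root_space; rewrite opprK; case. Qed.

Lemma rs_double a : root a -> rs (a *+ 2) = 0%VS.
Proof.
rewrite -(is_rootNE ssL cartanL) => /dim_opp_root_space[_].
by rewrite mulNrn opprK.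
Qed.

Lemma rs_line a v : root a -> v \in rs a -> v != 0 -> rs a = <[v]>%VS.
Proof.
move=> ra av nzv; apply/eqP; rewrite eq_sym eqEdim -memvE av.
by rewrite dim_root_space // dim_vline nzv.
Qed.

Lemma dot_square p : dot p p = \sum_(b <- root_seq) dot b p ^+ 2.
Proof.
have := killing_tau_square ssL cartanL (tau_h ssL cartanL p).
rewrite killing_tau ?tau_h // -/(dot p p) => ->.
rewrite big_seq [RHS]big_seq; apply: eq_bigr => b; rewrite mem_roots => rb.
by rewrite dim_root_space.
Qed.

(** As [e] kills the top weight b, the sum over b, b - a, b - 2a, ... is stable and [tau a] has
    trace zero on it. Were (b, a) negative, all its eigenvalues there would be. The weight 0 is
    listed too because the string may pass through h. The trace identity is kept for
    [string_step]. *)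
Lemma lower_string_ge0 a b e f : root a -> root b ->
    e \in rs a -> f \in rs (- a) -> lie e f = tau a ->
    {in rs b, forall v, lie e v = 0} ->
  0 <= dot b a /\ (\sum_(c <- [seq c <- 0 :: root_seq | `[< exists n, c = b - a *+ n >]])
    ev c (tau a) *+ \dim (rs c) = 0).
Proof.
move=> ra rb ae af eft eb; set S := filter _ _.
have nza := root_neq0 ra.
have uniqS : uniq S.
  by rewrite filter_uniq //= roots_uniq andbT mem_roots is_root0.
have SP n v : v \in rs (b - a *+ n) -> v != 0 -> b - a *+ n \in S.
  move=> rv nzv; rewrite mem_filter inE mem_roots.
  have -> : `[< exists n0, b - a *+ n = b - a *+ n0 >] by apply/asboolP; exists n.
  by have [//|nz] := eqVneq (b - a *+ n) 0; rewrite (rs_root rv nzv).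
have trS : \sum_(c <- S) ev c (tau a) *+ \dim (rs c) = 0.
  rewrite -eft; apply: graded_trace; [exact: uniqS | by move=> c; apply: subvv | | |].
    by rewrite eft; apply: tau_h.
    move=> c v; rewrite mem_filter => /andP[/asboolP[n ->] _].
    case: n => [|n] rv; first by left; apply: eb; rewrite mulr0n subr0 in rv.
    have [->|nz] := eqVneq (lie e v) 0; [by left | right].
    have rev : lie e v \in rs (b - a *+ n).
      have := lie_mem_rs ae rv.
      by rewrite mulrS opprD addrCA [a + (- a - _)]addrA subrr add0r.
    by exists (b - a *+ n); first exact: SP nz.
  move=> c v; rewrite mem_filter => /andP[/asboolP[n ->] _] rv.
  have [->|nz] := eqVneq (lie f v) 0; [by left | right].
  have rfv : lie f v \in rs (b - a *+ n.+1).
    have := lie_mem_rs af rv.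
    by rewrite addrCA -opprD -mulrS.
  by exists (b - a *+ n.+1); first exact: SP nz.
split=> //; rewrite real_leNgt ?real0 ?dot_real //; apply/negP => ba_lt0.
have Sb : b \in S.
  rewrite mem_filter inE mem_roots rb orbT andbT.
  by apply/asboolP; exists 0%N; rewrite subr0.
have := psum_mulrn_eq0 (w := fun c => - ev c (tau a)) (n := fun c => \dim (rs c)) _ _ Sb.
rewrite dim_root_space // => dim0; suff : 1%N = 0%N by [].
apply: dim0; last by under eq_bigr do rewrite mulNrn; rewrite sumrN trS oppr0.
move=> c; rewrite mem_filter => /andP[/asboolP[n ->] _].
rewrite -evNl opprB evDl evNl subr_gt0 -!/(dot _ _) dotMnl.
by rewrite (lt_le_trans ba_lt0) // mulrn_wge0 // ltW // dot_root_gt0.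
Qed.

(** The trace of [tau a] vanishes on the whole string b + Z a and on its lower part, hence on the
    part above b. There its eigenvalues (b, a) + n (a, a) are positive, so that part is empty and a
    + b is not a root. *)
Lemma string_step a b u v : root a -> root b -> u \in rs a -> v \in rs b ->
  u != 0 -> v != 0 -> lie u v = 0 -> 0 <= dot b a /\ ~~ root (a + b).
Proof.
move=> ra rb au bv nzu nzv uv0.
have [e [f [ae af nze nzf eft]]] := root_triple ssL cartanL ra.
have eb : {in rs b, forall w, lie e w = 0}.
  move=> w; rewrite (rs_line rb bv nzv) => /vlineP[k ->].
  move: ae; rewrite (rs_line ra au nzu) => /vlineP[l ->].
  by rewrite linearZ /= lieZl uv0 !scaler0.
have [ba_ge0 lowS] := lower_string_ge0 ra rb ae af eft eb.
split=> //; apply/negP => rab; have nza := root_neq0 ra.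
pose inS c := `[< exists n : int, c = b + a *~ n >].
pose S := [seq c <- 0 :: root_seq | inS c].
have uniqS : uniq S.
  by rewrite filter_uniq //= roots_uniq andbT mem_roots is_root0.
have SP (n : int) w : w \in rs (b + a *~ n) -> w != 0 -> b + a *~ n \in S.
  move=> rw nzw; rewrite mem_filter inE mem_roots.
  have -> : inS (b + a *~ n) by apply/asboolP; exists n.
  by have [//|nz] := eqVneq (b + a *~ n) 0; rewrite (rs_root rw nzw).
have trS : \sum_(c <- S) ev c (tau a) *+ \dim (rs c) = 0.
  rewrite -eft; apply: graded_trace; [exact: uniqS | by move=> c; apply: subvv | | |].
    by rewrite eft; apply: tau_h.
    move=> c w; rewrite mem_filter => /andP[/asboolP[n ->] _] rw.
    have [->|nz] := eqVneq (lie e w) 0; [by left | right].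
    have rew : lie e w \in rs (b + a *~ (n + 1)).
      by have := lie_mem_rs ae rw; rewrite mulrzDr addrC -addrA.
    by exists (b + a *~ (n + 1)); first exact: SP nz.
  move=> c w; rewrite mem_filter => /andP[/asboolP[n ->] _] rw.
  have [->|nz] := eqVneq (lie f w) 0; [by left | right].
  have rfw : lie f w \in rs (b + a *~ (n - 1)).
    by have := lie_mem_rs af rw; rewrite mulrzDr addrC -addrA.
  by exists (b + a *~ (n - 1)); first exact: SP nz.
pose low c := `[< exists n, c = b - a *+ n >].
rewrite (bigID low) /= -big_filter in trS.
have lowE : [seq c <- S | low c] = [seq c <- 0 :: root_seq | low c].
  rewrite -filter_predI; apply: eq_filter => c /=.
  rewrite andb_idr // => /asboolP[n ->]; apply/asboolP; exists (- n%:Z).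
  by rewrite mulrNz pmulrn.
rewrite lowE lowS add0r -big_filter in trS.
have upab : a + b \in [seq c <- S | ~~ low c].
  rewrite mem_filter; apply/andP; split.
    apply/asboolP => -[n]; rewrite addrC => /addrI/eqP.
    rewrite -addr_eq0 -mulrS -scaler_nat scaler_eq0 (negPf nza) orbF.
    by rewrite pnatr_eq0.
  rewrite mem_filter inE mem_roots rab orbT andbT.
  by apply/asboolP; exists 1; rewrite addrC.
have := psum_mulrn_eq0 (w := fun c => ev c (tau a)) (n := fun c => \dim (rs c)) _ trS upab.
rewrite dim_root_space // => dim0; suff : 1%N = 0%N by [].
apply: dim0 => c; rewrite !mem_filter => /andP[nlow /andP[/asboolP[n defc] _]].
rewrite defc in nlow *; case: n nlow {defc} => n nlow; last first.
  by case/asboolP: nlow; exists n.+1; rewrite NegzE mulrNz pmulrn.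
case: n nlow => [|n] nlow.
  by case/asboolP: nlow; exists 0%N; rewrite subr0 mulr0z addr0.
rewrite evDl -!/(dot _ _) -pmulrn dotMnl ltr_wpDl // pmulrn_lgt0 //.
exact: dot_root_gt0.
Qed.

(** Contrapositive of [string_step]: a negative product forces a nonzero bracket of root vectors. *)
Lemma dot_lt0_root a b : root a -> root b -> dot a b < 0 ->
  a + b = 0 \/ root (a + b).
Proof.
move=> ra rb ab_lt0; have [->|nzab] := eqVneq (a + b) 0; [by left | right].
have [[_ nza] [_ nzb]] := (andP ra, andP rb).
rewrite -vpick0 in nza; rewrite -vpick0 in nzb.
have step := string_step ra rb (memv_pick _) (memv_pick _) nza nzb.
have uv : lie (vpick (rs a)) (vpick (rs b)) \in rs (a + b).
  by apply: lie_mem_rs; apply: memv_pick.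
apply: (rs_root uv) => //; apply/eqP => /step[].
by rewrite dotC => /(lt_le_trans ab_lt0); rewrite ltxx.
Qed.

Lemma lie_root_neq0 a b u v : root a -> root b -> root (a + b) ->
  u \in rs a -> v \in rs b -> u != 0 -> v != 0 -> lie u v != 0.
Proof.
move=> ra rb rab au bv nzu nzv; apply/eqP => uv0.
by have [_] := string_step ra rb au bv nzu nzv uv0; rewrite rab.
Qed.

End RootStrings.

(** * Positive systems *)

Section PositiveSystems.
Variables (F : numClosedFieldType) (L : lieAlgType F) (h : {vspace L}).
Implicit Types (x y z u v e f : L) (U V Q : {vspace L}) (a b c d : dual_space h).
Local Notation rs := (@root_space F L fullv h).
Local Notation root := (@is_root F L fullv h).

Hypothesis ssL : semisimple_algebra (fullv : {vspace L}).
Hypothesis cartanL : cartan_subalgebra fullv h.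
Local Notation root_seq := (root_seq ssL cartanL).
Local Notation tau := (tau ssL cartanL).
Local Notation dot := (dot ssL cartanL).

Variable P : seq (dual_space h).
Hypothesis posP : positive_system fullv P.

Lemma pos_root a : a \in P -> root a.
Proof. by case: posP => PR _ _; apply: PR. Qed.

Lemma pos_add a b : a \in P -> b \in P -> root (a + b) -> a + b \in P.
Proof. by case: posP => _ _; apply. Qed.

Lemma pos_oppN a : a \in P -> - a \in P = false.
Proof.
by case: posP => _ Pxor _ Pa; have := Pxor a (pos_root Pa); rewrite Pa; case: (- a \in P).
Qed.

Lemma pos_cases a : root a -> a \in P \/ - a \in P.
Proof.
case: posP => _ Pxor _ /Pxor; case: (a \in P); first by left.
by case: (- a \in P) => //; right.
Qed.

(** If the sum is zero, the first root a has a negative product with some c of the list; then a + c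
    is a root, positive by closure, and replacing the pair by it gives a shorter list with the same
    sum. *)
Lemma pos_sum_neq0 (s : seq (dual_space h)) :
  {subset s <= P} -> s != [::] -> \sum_(a <- s) a != 0.
Proof.
move: {2}(size s) (erefl (size s)) => n; elim: n s => [|n IHn] [|a s] //= [sz] sP _.
have Pa : a \in P by apply: sP; rewrite mem_head.
have ra := pos_root Pa.
have sP' : {subset s <= P} by move=> c sc; apply: sP; rewrite inE sc orbT.
rewrite big_cons; apply/eqP => sum0.
have : has (fun c => dot a c < 0) s.
  apply/negPn/negP; rewrite -all_predC => /allP ge0.
  have : 0 <= dot a (\sum_(c <- s) c).
    rewrite dot_sumr big_seq sumr_ge0 // => c sc.
    have rc := pos_root (sP' c sc).
    by rewrite real_leNgt ?dot_real //; apply: (ge0 c sc).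
  have -> : \sum_(c <- s) c = - a by apply/eqP; rewrite -addr_eq0 addrC sum0.
  by rewrite dotNr oppr_ge0 => /(lt_le_trans (dot_root_gt0 ssL cartanL ra)); rewrite ltxx.
case/hasP => c sc ac_lt0; have Pc := sP' c sc.
have nzac : a + c != 0.
  apply: contraFneq (pos_oppN Pa) => /eqP; rewrite addrC addr_eq0 => /eqP <-.
  exact: Pc.
have [/eqP|rac] := dot_lt0_root ra (pos_root Pc) ac_lt0; first by rewrite (negPf nzac).
have Pac := pos_add Pa Pc rac.
have /eqP : \sum_(d <- a + c :: rem c s) d = 0.
  by move: sum0; rewrite (big_rem c) //= addrA big_cons => ->.
apply/negP; apply: IHn => //=; last first.
  by move=> d; rewrite inE => /predU1P[->|/mem_rem/sP'].
by rewrite size_rem // -sz prednK //; case: (s) sc.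
Qed.

Local Notation simple := (simple_root P).

(** Induction along the order in which c lies below b when b - c is a nonempty sum of positive
    roots. It is irreflexive by [pos_sum_neq0], and the measure counts the positive roots below
    b. *)
Lemma pos_ind (Q : dual_space h -> Prop) :
    (forall a, simple a -> Q a) ->
    (forall c d, c \in P -> d \in P -> c + d \in P -> Q c -> Q d -> Q (c + d)) ->
  forall b, b \in P -> Q b.
Proof.
move=> Qsimple Qadd b.
pose lt c b := `[< exists s : seq (dual_space h),
    [/\ {subset s <= P}, s != [::] & b = c + \sum_(a <- s) a] >].
have lt_irr c : ~~ lt c c.
  apply/negP => /asboolP[s [sP nzs /eqP]].
  by rewrite -subr_eq0 opprD addrA subrr add0r oppr_eq0 (negPf (pos_sum_neq0 sP nzs)).
have lt_trans c d a : lt c d -> lt d a -> lt c a.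
  move=> /asboolP[s [sP nzs ->]] /asboolP[t [tP nzt ->]]; apply/asboolP.
  exists (s ++ t); rewrite big_cat addrA; split=> //.
    by move=> x; rewrite mem_cat => /orP[/sP|/tP].
  by case: s nzs {sP}.
pose m b := size [seq c <- undup P | lt c b].
move: {2}(m b).+1 (ltnSn (m b)) => n; elim: n b => // n IHn b mb Pb.
have [|nsb] := pselect (simple b); first exact: Qsimple.
have [c [d [Pc Pd defb]]] : exists c d, [/\ c \in P, d \in P & b = c + d].
  apply: contrapT => none; apply: nsb; split=> // c d Pc Pd defb.
  by apply: none; exists c, d.
have ltP c' d' : d' \in P -> b = c' + d' -> lt c' b.
  move=> Pd' ->; apply/asboolP; exists [:: d']; rewrite big_seq1; split=> //.
  by move=> x; rewrite inE => /eqP->.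
have lt_m c' : c' \in P -> lt c' b -> (m c' < n)%N.
  move=> Pc' ltc; rewrite ltnS in mb; apply: leq_trans mb; rewrite /m.
  have sub : {subset c' :: [seq x <- undup P | lt x c'] <= [seq x <- undup P | lt x b]}.
    move=> x; rewrite inE !mem_filter mem_undup => /predU1P[->|/andP[ltx ->]].
      by rewrite ltc.
    by rewrite (lt_trans _ _ _ ltx ltc).
  apply: (uniq_leq_size _ sub); rewrite /= mem_filter (negPf (lt_irr _)).
  by rewrite filter_uniq ?undup_uniq.
rewrite defb; apply: Qadd => //; first by rewrite -defb.
  exact: IHn (lt_m c Pc (ltP _ _ Pd defb)) Pc.
exact: IHn (lt_m d Pd (ltP _ _ Pc (etrans defb (addrC _ _)))) Pd.
Qed.

Lemma simple_decomposition b : b \in P ->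
  exists2 s : seq (dual_space h), (forall a, a \in s -> simple a) & b = \sum_(a <- s) a.
Proof.
move: b; apply: pos_ind => [a sa | c d _ _ _ [s sS ->] [t tS ->]].
  by exists [:: a]; rewrite ?big_seq1 // => b; rewrite inE => /eqP->.
exists (s ++ t); last by rewrite big_cat.
by move=> a; rewrite mem_cat => /orP[/sS|/tS].
Qed.

Lemma simple_pos a : simple a -> a \in P. Proof. by case. Qed.

(** Otherwise a - b is a root, and its sign exhibits a or b as a sum of two positive roots. *)
Lemma dot_simple_le0 a b : simple a -> simple b -> a != b -> dot a b <= 0.
Proof.
move=> [Pa sa] [Pb sb] neq_ab; have [ra rb] := (pos_root Pa, pos_root Pb).
rewrite real_leNgt ?dot_real //; apply/negP => ab_gt0.
have nab : dot a (- b) < 0 by rewrite dotNr oppr_lt0.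
have rNb : root (- b) by rewrite is_rootNE.
have [/eqP|rab] := dot_lt0_root ra rNb nab; first by rewrite subr_eq0 (negPf neq_ab).
have [Pab | Pba] := pos_cases rab.
  by case: (sa b (a - b)) => //; rewrite addrC subrK.
by rewrite opprB in Pba; case: (sb a (b - a)) => //; rewrite addrC subrK.
Qed.

(** Plays the part of a linear functional positive on the simple roots. [undup] is there because a
    positive system is any sequence, possibly with repetitions. *)
Definition two_rho : dual_space h := \sum_(b <- undup P) b.

(* The sum of the g_b over the positive b <> a is stable under g_a and g_(-a),
   so the trace of [tau a] on it vanishes. *)
Lemma dot_two_rho a : simple a -> dot two_rho a = dot a a.
Proof.
move=> [Pa sa]; have ra := pos_root Pa.
have [e [f [ae af nze nzf eft]]] := root_triple ssL cartanL ra.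
set S := [seq b <- undup P | b != a].
have memS b : b \in S = (b != a) && (b \in P) by rewrite mem_filter mem_undup.
have trS : \sum_(b <- S) ev b (lie e f) *+ \dim (rs b) = 0.
  apply: (graded_trace ssL cartanL).
  - by apply: filter_uniq; apply: undup_uniq.
  - by move=> b; apply: subvv.
  - by rewrite eft; apply: tau_h.
  - move=> b v; rewrite memS => /andP[neqba Pb] bv.
    have [->|nz] := eqVneq (lie e v) 0; [by left | right].
    have rev := lie_mem_rs ae bv.
    have nzab : a + b != 0.
      by apply: contraFneq (pos_oppN Pa) => /eqP; rewrite addrC addr_eq0 => /eqP <-.
    exists (a + b); rewrite // memS -subr_eq0 addrAC subrr add0r root_neq0 ?pos_root //=.
    exact: (pos_add Pa Pb (rs_root rev nz nzab)).
  move=> b v; rewrite memS => /andP[neqba Pb] bv.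
  have [->|nz] := eqVneq (lie f v) 0; [by left | right].
  have := lie_mem_rs af bv; rewrite addrC => rfv.
  have nzba : b - a != 0 by rewrite subr_eq0.
  have rba := rs_root rfv nz nzba.
  exists (b - a) => //; rewrite memS; apply/andP; split.
    (* b - a = a would make b = 2a, which is never a root. *)
    rewrite subr_eq -mulr2n; apply: contraTneq (pos_root Pb) => ->.
    by rewrite /is_root rs_double // eqxx andbF.
  case: (pos_cases rba) => //; rewrite opprB => Pab.
  by case: (sa b (a - b)); rewrite // addrC subrK.
rewrite dotC /two_rho dot_sumr (bigD1_seq a) ?undup_uniq ?mem_undup //=.
rewrite -[RHS]addr0; congr (_ + _); rewrite -big_filter -[RHS]trS.
rewrite big_seq [RHS]big_seq; apply: eq_bigr => b; rewrite memS => /andP[_ Pb].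
by rewrite dim_root_space ?pos_root // eft dotC.
Qed.

(** Let p be the positive part of the relation, equal to the negative part with its sign changed.
    Obtuse angles give (p, p) <= 0, while (p, p) is a sum of real squares; so p = 0. But a positive
    coefficient would make the product of p with [two_rho] positive. *)
Lemma simple_real_indep (s : seq (dual_space h)) (k : dual_space h -> F) :
    uniq s -> (forall a, a \in s -> simple a) -> (forall a, k a \is Num.real) ->
  \sum_(a <- s) k a *: a = 0 -> forall a, a \in s -> k a = 0.
Proof.
move=> uniqs sS k_real sum0.
have half (k' : dual_space h -> F) : (forall a, k' a \is Num.real) ->
    \sum_(a <- s) k' a *: a = 0 -> forall a, a \in s -> ~~ (0 < k' a).
  move=> k'_real k'0 a0 sa0; apply/negP => ka0.
  pose p := \sum_(a <- s | 0 < k' a) k' a *: a.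
  have pE : p = \sum_(a <- s | ~~ (0 < k' a)) (- k' a) *: a.
    move: k'0; rewrite (bigID (fun a => 0 < k' a)) /= -/p => /eqP.
    rewrite addr_eq0 => /eqP->; rewrite -sumrN; apply: eq_bigr => a _.
    by rewrite scaleNr.
  have pp_le0 : dot p p <= 0.
    rewrite {1}/p pE dot_suml big_seq_cond sumr_le0 // => a /andP[sa ka].
    rewrite dotZl dot_sumr big_seq_cond mulr_ge0_le0 ?(ltW ka) //.
    rewrite sumr_le0 // => b /andP[sb kb]; rewrite dotZr mulr_ge0_le0 //.
      by rewrite oppr_ge0 real_leNgt ?real0.
    apply: dot_simple_le0; try exact: sS.
    by apply: contraNneq kb => <-.
  have pb_real b : root b -> dot b p \is Num.real.
    move=> rb; rewrite dot_sumr big_seq_cond rpred_sum // => a /andP[sa _].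
    rewrite dotZr; apply: rpredM; first exact: k'_real.
    exact: (dot_real ssL cartanL rb (pos_root (simple_pos (sS a sa)))).
  have sq_ge0 b : b \in root_seq -> 0 <= dot b p ^+ 2.
    by rewrite mem_roots -realEsqr; apply: pb_real.
  have pp0 : dot p p = 0.
    by apply/eqP; rewrite eq_le pp_le0 dot_square big_seq sumr_ge0.
  have p0 : p = 0.
    apply: (tau_eq0 (ssL := ssL) (cartanL := cartanL)) => b.
    move/eqP: pp0; rewrite dot_square big_seq psumr_eq0 // => /allP sq0.
    rewrite -(mem_roots ssL cartanL) => rb.
    by have := sq0 b rb; rewrite rb sqrf_eq0 => /eqP.
  have : 0 < dot p two_rho.
    rewrite dot_suml big_seq_cond (big_rem a0) //= sa0 ka0 /=.
    have term a : a \in s -> 0 < k' a -> 0 < dot (k' a *: a) two_rho.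
      move=> sa ka; rewrite dotZl dotC (dot_two_rho (sS a sa)).
      apply: mulr_gt0 ka _.
      exact: (dot_root_gt0 ssL cartanL (pos_root (simple_pos (sS a sa)))).
    rewrite ltr_wpDr ?term //; apply: sumr_ge0 => a /andP[sa ka].
    exact/ltW/term.
  by rewrite p0 dot0l ltxx.
move=> a sa; apply/eqP; apply/negPn/negP => nzka.
have := half k k_real sum0 a sa; rewrite -real_leNgt // => ka_le0.
suff : ~~ (0 < - k a) by rewrite oppr_gt0 lt_neqAle nzka ka_le0.
apply: (half (fun a => - k a)) sa => [b|]; first by rewrite rpredN.
by under eq_bigr do rewrite scaleNr; rewrite sumrN sum0 oppr0.
Qed.

(** Products of roots are real, so the real parts of the coefficients satisfy the same relation. *)
Lemma simple_indep (s : seq (dual_space h)) (k : dual_space h -> F) :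
    uniq s -> (forall a, a \in s -> simple a) ->
  \sum_(a <- s) k a *: a = 0 -> forall a, a \in s -> k a = 0.
Proof.
move=> uniqs sS sum0.
have Re0 (k' : dual_space h -> F) : \sum_(a <- s) k' a *: a = 0 ->
    forall a, a \in s -> 'Re (k' a) = 0.
  move=> k'0; apply: (simple_real_indep (k := fun a => 'Re (k' a))) => //.
  apply: (tau_eq0 (ssL := ssL) (cartanL := cartanL)) => b rb.
  have := congr1 (fun a => 'Re (dot b a)) k'0.
  rewrite /= [dot b 0]dotC dot0l raddf0 => <-.
  rewrite !dot_sumr raddf_sum big_seq [RHS]big_seq; apply: eq_bigr => a sa /=.
  rewrite !dotZr ReMr //.
  exact: (dot_real ssL cartanL rb (pos_root (simple_pos (sS a sa)))).
move=> a sa; rewrite [k a]Crect Re0 // add0r.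
(* Multiplying by -i turns the imaginary parts into real parts. *)
have kNi : \sum_(b <- s) (- 'i * k b) *: b = 0.
  by under eq_bigr do rewrite -scalerA; rewrite -scaler_sumr sum0 scaler0.
have := Re0 _ kNi a sa.
by rewrite mulNr raddfN /= ReMil opprK => ->; rewrite mulr0.
Qed.

Lemma simple_free (X : seq (dual_space h)) :
  uniq X -> (forall a, a \in X -> simple a) -> free X.
Proof.
move=> uniqX XS; apply/(freeP (X := in_tuple X)) => k k0 i.
pose k' a := if insub (index a X) is Some j then k j else 0.
have k'E (j : 'I_(size X)) : k' X`_j = k j by rewrite /k' index_uniq // valK.
rewrite -k'E; apply: (simple_indep (k := k') uniqX XS); last exact: mem_nth.
rewrite (big_nth 0) big_mkord -[RHS]k0; apply: eq_bigr => j _.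
by rewrite k'E.
Qed.

Lemma dim_dual : \dim {: dual_space h} = \dim h.
Proof. by rewrite !dimvf /dim /= muln1. Qed.

Lemma simple_separate x : x \in h -> (forall a, simple a -> ev a x = 0) -> x = 0.
Proof.
move=> hx x0; apply: (roots_separate ssL cartanL) => // a ra.
have posx b : b \in P -> ev b x = 0.
  case/simple_decomposition => s sS ->; rewrite ev_suml big_seq big1 // => c sc.
  exact/x0/sS.
have [/posx//|/posx/eqP] := pos_cases ra.
by rewrite evNl oppr_eq0 => /eqP.
Qed.

(** Independence bounds the number of simple roots by dim h. They also separate the points of h, so
    evaluating them is an injective, hence bijective, map from h to coordinates; the basis dual to
    [X] follows. *)
Lemma simple_coordinates (X : seq (dual_space h)) :
    uniq X -> (forall a, a \in X <-> simple a) ->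
  size X = \dim h /\
  forall a, a \in X -> exists2 x, x \in h & forall b, b \in X -> ev b x = (b == a)%:R.
Proof.
move=> uniqX XS; have freeX : free X by apply: simple_free => // a /XS.
pose phi (t : subvs_of h) : 'rV[F]_(size X) := \row_i (X`_i t : F).
have phi_lin : linear phi.
  by move=> k t u; apply/rowP => i; rewrite !mxE linearP.
pose lin := GRing.isLinear.Build F (subvs_of h) 'rV[F]_(size X) _ _ phi_lin.
pose phi' : {linear subvs_of h -> 'rV[F]_(size X)} := HB.pack phi lin.
have ker0 : lker (linfun phi') == 0%VS.
  rewrite -subv0; apply/subvP => t; rewrite memv_ker memv0 lfunE /= => /eqP/rowP t0.
  apply/eqP/subvs_inj; apply: simple_separate (subvsP t) _ => a /XS Xa.
  have lt_a : (index a X < size X)%N by rewrite index_mem.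
  have := t0 (Ordinal lt_a); rewrite !mxE /= nth_index // => at0.
  by rewrite /ev vsvalK at0.
have dim_img : \dim (limg (linfun phi')) = \dim h.
  by rewrite limg_dim_eq ?(eqP ker0) ?capv0 // dimvf.
have dim_row : \dim {: 'rV[F]_(size X)} = size X.
  by rewrite dimvf dim_matrix -[RHS]mul1n.
have sizeX : size X = \dim h.
  apply/eqP; rewrite eqn_leq -{1}dim_dual -(eqP freeX) dimvS ?subvf //=.
  by rewrite (eqP freeX) -dim_img -[X in (_ <= X)%N]dim_row dimvS ?subvf.
split=> // a Xa; have lt_a : (index a X < size X)%N by rewrite index_mem.
have : delta_mx 0 (Ordinal lt_a) \in limg (linfun phi').
  suff -> : limg (linfun phi') = fullv by rewrite memvf.
  by apply/eqP; rewrite eqEdim subvf dim_img dim_row sizeX /=.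
case/memv_imgP => t _; rewrite lfunE /= => phit.
exists (vsval t) => [|b Xb]; first exact: subvsP.
have lt_b : (index b X < size X)%N by rewrite index_mem.
have /rowP/(_ (Ordinal lt_b)) := phit; rewrite !mxE /= nth_index // /ev vsvalK => <-.
congr (_%:R : F); congr nat_of_bool.
apply/eqP/eqP => [[eq_ab] | eq_ba].
  by rewrite -(nth_index 0 Xb) eq_ab nth_index.
by apply/val_inj; rewrite /= eq_ba.
Qed.

End PositiveSystems.

(** * Hermitian pairs *)

Section SeqSums.
Variables (F : fieldType) (vT : vectType F) (T : eqType).
Implicit Types (s : seq T) (V : T -> {vspace vT}).

Lemma sub_seq_sumv s V (W : {vspace vT}) :
  (forall a, a \in s -> (V a <= W)%VS) -> (\sum_(a <- s) V a <= W)%VS.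
Proof.
elim: s => [|a s IHs] sW; first by rewrite big_nil sub0v.
rewrite big_cons subv_add sW ?mem_head // IHs // => b sb.
by rewrite sW // inE sb orbT.
Qed.

Lemma seq_sumv_sup s V a : a \in s -> (V a <= \sum_(b <- s) V b)%VS.
Proof. by move=> sa; rewrite (big_rem a) //= addvSl. Qed.

End SeqSums.

Lemma direct_sum_disjoint (F : fieldType) (vT : vectType F) n
    (W : 'I_n -> {vspace vT}) i j :
  directv (\sum_(i < n) W i) -> i != j -> (W i :&: W j = 0)%VS.
Proof.
move=> /directv_sumP/(_ i isT) dxi neq_ij.
apply/eqP; rewrite -subv0 -dxi capvS //.
by apply: (sumv_sup j) => //; rewrite eq_sym.
Qed.

Lemma direct_sum_intro (F : fieldType) (L : lieAlgType F) V n (W : 'I_n -> {vspace L}) :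
    V = (\sum_(i < n) W i)%VS ->
    (forall i, W i :&: (\sum_(j < n | j != i) W j) = 0)%VS ->
  direct_sum V W.
Proof. by move=> defV dxW; split=> //; apply/directv_sumP => i _; apply: dxW. Qed.

Lemma direct_sum_indep (F : fieldType) (L : lieAlgType F) V n (W : 'I_n -> {vspace L}) us :
    direct_sum V W -> (forall i, us i \in W i) -> \sum_i us i = 0 ->
  forall i, us i = 0.
Proof.
move=> [_ /directv_sum_independent dxW] Wus us0 i.
by apply: dxW => // j _; apply: Wus.
Qed.

Lemma direct_sum2_intro (F : fieldType) (L : lieAlgType F) (U W : {vspace L}) :
  (U :&: W = 0)%VS -> direct_sum2 (U + W)%VS U W.
Proof. by move=> UW0; split=> //; apply/directv_addP. Qed.

Section HermitianPair.
Variables (F : numClosedFieldType) (L : lieAlgType F) (theta : 'End(L)).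
Variables (k h : {vspace L}).
Implicit Types (x y z u v e f : L) (U V Q : {vspace L}) (a b c d : dual_space h).
Local Notation rs := (@root_space F L fullv h).
Local Notation root := (@is_root F L fullv h).

Hypothesis ssL : semisimple_algebra (fullv : {vspace L}).
Hypothesis cartanL : cartan_subalgebra fullv h.
Local Notation rproj := (rproj ssL cartanL).
Local Notation tau := (tau ssL cartanL).
Local Notation dot := (dot ssL cartanL).

Variable P : seq (dual_space h).
Hypothesis posP : positive_system fullv P.
Hypothesis theta_inv : involution theta.
Hypothesis k_fixed : k = fixedSpace theta.
Hypothesis sub_hk : (h <= k)%VS.

Let p := passmx.leigenspace theta (-1).
Let Pk := roots_in fullv P k.
Let Pn := roots_in fullv P p.

Lemma mem_k x : (x \in k) = (theta x == x).
Proof. by rewrite k_fixed; apply/fixedSpaceP/eqP. Qed.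

Lemma mem_p x : (x \in p) = (theta x == - x).
Proof.
rewrite /p /passmx.leigenspace memv_ker add_lfunE opp_lfunE scale_lfunE id_lfunE.
by rewrite scaleN1r subr_eq0.
Qed.

Lemma theta_lie x y : theta (lie x y) = lie (theta x) (theta y).
Proof. by case: theta_inv. Qed.

Lemma lie_kk x y : x \in k -> y \in k -> lie x y \in k.
Proof. by rewrite !mem_k theta_lie => /eqP-> /eqP->. Qed.

Lemma lie_kp x y : x \in k -> y \in p -> lie x y \in p.
Proof. by rewrite mem_k !mem_p theta_lie => /eqP-> /eqP->; rewrite linearN. Qed.

Lemma lie_pp x y : x \in p -> y \in p -> lie x y \in k.
Proof.
by rewrite mem_k !mem_p theta_lie => /eqP-> /eqP->; rewrite linearN /= lieNl opprK.
Qed.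

Lemma kp_disjoint x : x \in k -> x \in p -> x = 0.
Proof.
rewrite mem_k mem_p => /eqP-> ; rewrite -addr_eq0 -mulr2n -scaler_nat scaler_eq0.
by rewrite pnatr_eq0 => /eqP.
Qed.

Lemma kp_split x : exists y z, [/\ y \in k, z \in p & x = y + z].
Proof.
have theta2 y : theta (theta y) = y by case: theta_inv.
exists (2%:R^-1 *: (x + theta x)), (2%:R^-1 *: (x - theta x)).
split.
- by rewrite mem_k linearZ linearD /= theta2 addrC.
- by rewrite mem_p linearZ linearB /= theta2 -scalerN opprB.
rewrite -scalerDr addrACA subrr addr0 -mulr2n -scaler_nat scalerA mulVf ?scale1r //.
by rewrite pnatr_eq0.
Qed.

Lemma k_h_stable x v : x \in h -> v \in k -> lie x v \in k.
Proof. by move=> /(subvP sub_hk) kx; apply: lie_kk. Qed.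

Lemma p_h_stable x v : x \in h -> v \in p -> lie x v \in p.
Proof. by move=> /(subvP sub_hk) kx; apply: lie_kp. Qed.

Lemma root_line a : root a -> exists2 v, v != 0 & rs a = <[v]>%VS.
Proof.
move=> ra; have [_ nza] := andP ra; rewrite -vpick0 in nza.
by exists (vpick (rs a)) => //; apply: (rs_line ssL cartanL); rewrite ?memv_pick.
Qed.

Lemma sub_root_space a v U : root a -> v \in rs a -> v != 0 -> v \in U ->
  (rs a <= U)%VS.
Proof. by move=> ra av nzv Uv; rewrite (rs_line ssL cartanL ra av nzv) -memvE. Qed.

(** [theta] fixes h pointwise, so it preserves each root space; on this line it acts by a scalar of
    square 1. *)
Lemma root_parity a : root a -> (rs a <= k)%VS || (rs a <= p)%VS.
Proof.
move=> ra; have [v nzv defv] := root_line ra.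
have av : v \in rs a by rewrite defv memv_line.
have : theta v \in rs a.
  apply: mem_rs => x hx.
  have /eqP thx : theta x == x by rewrite -mem_k; apply: (subvP sub_hk).
  by rewrite -{1}thx -theta_lie (lie_rs av hx) linearZ.
rewrite defv => /vlineP[q thv].
have : theta (theta v) = v by case: theta_inv.
rewrite thv linearZ /= thv scalerA -[RHS]scale1r => /eqP.
rewrite -subr_eq0 -scalerBl scaler_eq0 (negPf nzv) orbF -expr2 subr_sqr_1 mulf_eq0.
rewrite subr_eq0 addr_eq0 -!memvE mem_k mem_p thv.
by case/orP => /eqP->; rewrite ?scale1r ?scaleN1r eqxx ?orbT.
Qed.

Lemma compact_not_p a : root a -> (rs a <= k)%VS -> (rs a <= p)%VS = false.
Proof.
move=> ra ak; apply/negP => ap; have [v nzv defv] := root_line ra.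
have av : v \in rs a by rewrite defv memv_line.
by case/eqP: nzv; apply: kp_disjoint; [apply: (subvP ak) | apply: (subvP ap)].
Qed.

Lemma compactE a : root a -> (rs a <= p)%VS = ~~ (rs a <= k)%VS.
Proof.
move=> ra; case: (boolP (rs a <= k)%VS) => [/(compact_not_p ra) // | nak].
by have := root_parity ra; rewrite (negPf nak).
Qed.

Lemma root_space_bracket a b u v U : root a -> root b -> root (a + b) ->
    u \in rs a -> v \in rs b -> u != 0 -> v != 0 -> lie u v \in U ->
  (rs (a + b)%R <= U)%VS.
Proof.
move=> ra rb rab au bv nzu nzv; apply: (sub_root_space rab (lie_mem_rs au bv)).
exact: (lie_root_neq0 ssL cartanL ra rb rab au bv nzu nzv).
Qed.

Lemma root_space_vec a : root a -> exists2 v, v \in rs a & v != 0.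
Proof. by move=> /root_line[v nzv ->]; exists v; rewrite ?memv_line. Qed.

(** One nonzero bracket of root vectors spans the root space of a + b, so bracket relations between
    subspaces pass to roots. *)
Lemma root_bracket_sub a b U V (W : {vspace L}) : root a -> root b -> root (a + b) ->
    (rs a <= U)%VS -> (rs b <= V)%VS ->
    (forall x y, x \in U -> y \in V -> lie x y \in W) ->
  (rs (a + b)%R <= W)%VS.
Proof.
move=> ra rb rab /subvP aU /subvP bV UVW.
have [[u au nzu] [v bv nzv]] := (root_space_vec ra, root_space_vec rb).
apply: (root_space_bracket ra rb rab au bv nzu nzv).
by apply: UVW; [apply: aU | apply: bV].
Qed.

(** If -a were noncompact, [tau a] = [e, f] would be in p as well as in h, hence zero. *)
Lemma compactN a : root a -> (rs a <= k)%VS -> (rs (- a) <= k)%VS.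
Proof.
move=> ra ak; have rNa : root (- a) by rewrite (is_rootNE ssL cartanL).
apply/negPn/negP; rewrite -compactE // => Nap.
have [e [f [ae af nze nzf eft]]] := root_triple ssL cartanL ra.
have : tau a = 0.
  apply: kp_disjoint; first by apply: (subvP sub_hk); apply: tau_h.
  by rewrite -eft (lie_kp (subvP ak _ ae) (subvP Nap _ af)).
move=> tau0; have := dot_root_gt0 ssL cartanL ra.
by rewrite /dot tau0 /ev !linear0 ltxx.
Qed.

Lemma mem_Pk a : (a \in Pk) = (a \in P) && (rs a <= k)%VS.
Proof. by rewrite mem_filter andbC. Qed.

Lemma mem_Pn a : (a \in Pn) = (a \in P) && (rs a <= p)%VS.
Proof. by rewrite mem_filter andbC. Qed.

Lemma Pn_pos a : a \in Pn -> a \in P. Proof. by rewrite mem_Pn => /andP[]. Qed.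
Lemma Pk_pos a : a \in Pk -> a \in P. Proof. by rewrite mem_Pk => /andP[]. Qed.
Lemma Pn_root a : a \in Pn -> root a. Proof. by move/Pn_pos/(pos_root posP). Qed.
Lemma Pk_root a : a \in Pk -> root a. Proof. by move/Pk_pos/(pos_root posP). Qed.

Lemma pos_parity a : a \in P -> a \in Pk \/ a \in Pn.
Proof.
move=> Pa; rewrite mem_Pk mem_Pn Pa /=; apply/orP.
exact: root_parity (pos_root posP Pa).
Qed.

Lemma compact_pos a : root a -> (rs a <= k)%VS -> a \in Pk \/ - a \in Pk.
Proof.
move=> ra ak; have [Pa | Pa] := pos_cases posP ra; [left | right].
  by rewrite mem_Pk Pa.
by rewrite mem_Pk Pa compactN.
Qed.

Lemma mem_sum_root_spaces (S : seq (dual_space h)) v :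
    {in S, forall a, root a} ->
  v \in sum_root_spaces fullv S <-> (forall b, b \notin S -> rproj b v = 0).
Proof.
move=> rS; split=> [Sv b nSb | v0].
  have [K KP] : exists K : {vspace L}, forall u, u \in K <-> rproj b u = 0.
    apply: vspace_of_pred => [|q u w u0 w0]; first exact: linear0.
    by rewrite linearP /= u0 w0 scaler0 addr0.
  apply/KP; apply: (subvP (_ : sum_root_spaces fullv S <= K)%VS) Sv.
  apply: sub_seq_sumv => a Sa; apply/subvP => u au; apply/KP.
  rewrite (rproj_id ssL cartanL b au); case: eqP => // eq_ba.
  by rewrite eq_ba Sa in nSb.
rewrite -[v](rproj_sum ssL cartanL) v0 ?add0r; last first.
  by apply/negP => /rS; rewrite /is_root eqxx.
rewrite big_seq; apply: memv_suml => a _.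
have [Sa | /v0->] := boolP (a \in S); last exact: mem0v.
by apply: (subvP (seq_sumv_sup _ Sa)); apply: rprojP.
Qed.

Lemma rproj_stableL U b v :
  {in h & U, forall x u, lie x u \in U} -> v \in U -> rproj b v \in U.
Proof. exact: rproj_stable. Qed.

Let pplus := sum_root_spaces fullv Pn.

Lemma mem_pplus v : v \in pplus <-> (forall b, b \notin Pn -> rproj b v = 0).
Proof. by apply: mem_sum_root_spaces => a; apply: Pn_root. Qed.

Lemma pplus_root a : root a -> (rs a <= pplus)%VS -> a \in Pn.
Proof.
move=> ra sa; apply/negPn/negP => nPa; have [v av nzv] := root_space_vec ra.
have /mem_pplus/(_ a nPa) := subvP sa v av.
by rewrite (rproj_id ssL cartanL a av) eqxx => v0; rewrite v0 eqxx in nzv.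
Qed.

Lemma root_sub_pplus a : a \in Pn -> (rs a <= pplus)%VS.
Proof. exact: seq_sumv_sup. Qed.

(** * Consequences of total positivity *)

Hypothesis tot : forall b, b \in Pn <-> totally_positive fullv k Pn b.

Lemma pplus_k_stable x v : x \in k -> v \in pplus -> lie x v \in pplus.
Proof.
move=> kx; rewrite -adE memv_preim; apply: subvP; apply: sub_seq_sumv => b.
case/tot => _ [U [sbU sUp /lie_prodP kU]]; apply/subvP => u bu.
rewrite -memv_preim adE; apply: (subvP sUp); apply: kU => //.
exact: (subvP sbU).
Qed.

Lemma Pn_add_compact b c : b \in Pn -> root c -> (rs c <= k)%VS -> root (b + c) ->
  b + c \in Pn.
Proof.
move=> Pb rc ck; rewrite addrC => rbc; apply: (pplus_root rbc).
apply: (root_bracket_sub rc (Pn_root Pb) rbc ck (root_sub_pplus Pb)).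
exact: pplus_k_stable.
Qed.

Lemma Pn_add_not_root b c : b \in Pn -> c \in Pn -> ~~ root (b + c).
Proof.
move=> Pb Pc; apply/negP => rbc.
have [bp cp] : (rs b <= p)%VS /\ (rs c <= p)%VS.
  by move: Pb Pc; rewrite !mem_Pn => /andP[_ ->] /andP[_ ->].
have bck : (rs (b + c)%R <= k)%VS.
  exact: (root_bracket_sub (Pn_root Pb) (Pn_root Pc) rbc bp cp lie_pp).
have rN : root (- (b + c)) by rewrite (is_rootNE ssL cartanL).
have bNE : b + - (b + c) = - c by rewrite opprD addrA subrr add0r.
have rc := Pn_root Pc.
have : b + - (b + c) \in Pn.
  have rNc : root (b + - (b + c)) by rewrite bNE (is_rootNE ssL cartanL).
  exact: (Pn_add_compact Pb rN (compactN rbc bck) rNc).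
by rewrite bNE => /Pn_pos; rewrite (pos_oppN posP (Pn_pos Pc)).
Qed.

Lemma root_space_pplus_commute b c u v : b \in Pn -> c \in Pn ->
  u \in rs b -> v \in rs c -> lie u v = 0.
Proof.
move=> Pb Pc bu cv; apply/eqP; rewrite -memv0.
have nz : b + c != 0.
  rewrite addr_eq0; apply: contraTneq (Pn_pos Pb) => ->.
  by rewrite (pos_oppN posP (Pn_pos Pc)).
by rewrite -(rs_out nz (Pn_add_not_root Pb Pc)) lie_mem_rs.
Qed.

Lemma pplus_abelian : lie_prod pplus pplus = 0%VS.
Proof.
apply/eqP; rewrite -subv0; apply/lie_prodP => u v pu pv.
suff H b w : b \in Pn -> w \in rs b -> lie u w = 0.
  rewrite -adE memv_preim lpreim0; apply: (subvP _ _ pv); apply: sub_seq_sumv => b Pb.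
  by apply/subvP => w bw; rewrite memv_ker adE (H b w).
move=> Pb bw; apply/eqP; rewrite lieC oppr_eq0 -adE -memv_ker.
apply: (subvP _ _ pu); apply: sub_seq_sumv => c Pc.
by apply/subvP => z cz; rewrite memv_ker adE (root_space_pplus_commute Pb Pc bw cz).
Qed.

(** * Simple roots and the irreducible components of p^+ *)

Variables (r s : nat).
Variables (alpha : r.-tuple (dual_space h)) (beta : s.-tuple (dual_space h)).
Variable pp : 'I_s -> {vspace L}.
Hypothesis alpha_uniq : uniq alpha.
Hypothesis alphaP : forall a, a \in alpha <-> simple_root Pk a.
Hypothesis ppP : irreducible_decomposition k pplus pp.
Hypothesis betaP : forall i, lowest_weight fullv Pk (pp i) (tnth beta i).

Lemma pp_direct : directv (\sum_(i < s) pp i).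
Proof. by case: ppP => [[]]. Qed.

Lemma pp_sum : pplus = (\sum_(i < s) pp i)%VS.
Proof. by case: ppP => [[]]. Qed.

Lemma pp_sub i : (pp i <= pplus)%VS.
Proof. by rewrite pp_sum (sumv_sup i). Qed.

Lemma pp_stable i x v : x \in k -> v \in pp i -> lie x v \in pp i.
Proof. by case: ppP => _ /(_ i)[/lie_prodP H _ _]; apply: H. Qed.

Lemma pp_neq0 i : pp i != 0%VS.
Proof. by case: ppP => _ /(_ i)[_ /eqP]. Qed.

Lemma pp_irreducible i U : (U <= pp i)%VS ->
  (forall x v, x \in k -> v \in U -> lie x v \in U) -> U != 0%VS -> U = pp i.
Proof.
case: ppP => _ /(_ i)[_ _ irr] sU kU /eqP nzU; have [|//|//] := irr U sU.
by apply/lie_prodP => x v; apply: kU.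
Qed.

Lemma pp_h_stable i : {in h & pp i, forall x v, lie x v \in pp i}.
Proof. by move=> x v /(subvP sub_hk) kx; apply: pp_stable. Qed.

Lemma stable_root U v : {in h & U, forall x u, lie x u \in U} ->
    (U <= pplus)%VS -> v \in U -> v != 0 ->
  exists b, [/\ b \in Pn, (rs b <= U)%VS & rproj b v != 0].
Proof.
move=> hU sU Uv nzv; have /mem_pplus v0 := subvP sU v Uv.
have [b nzb] : exists b, rproj b v != 0.
  apply/not_existsP => all0; case/eqP: nzv.
  rewrite -[v](rproj_sum ssL cartanL) big1 => [|b _]; last exact/eqP/negPn/negP/all0.
  by rewrite addr0; apply/eqP/negPn/negP/all0.
have Pb : b \in Pn by apply: contraR nzb => /v0->.
exists b; split=> //.
exact: (sub_root_space (Pn_root Pb) (rprojP ssL cartanL b v) nzb (rproj_stableL b hU Uv)).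
Qed.

Lemma pp_has_root i : exists2 b, b \in Pn & (rs b <= pp i)%VS.
Proof.
have := pp_neq0 i; rewrite -vpick0 => nzv.
have [b [Pb sb _]] := stable_root (@pp_h_stable i) (pp_sub i) (memv_pick _) nzv.
by exists b.
Qed.

(** Some component of a root vector has a nonzero part of weight b; that part stays in the h-stable
    [pp i], and it spans the whole one-dimensional root space. *)
Lemma pp_root_exists b : b \in Pn -> exists i, (rs b <= pp i)%VS.
Proof.
move=> Pb; have [v bv nzv] := root_space_vec (Pn_root Pb).
have : v \in (\sum_(i < s) pp i)%VS by rewrite -pp_sum (subvP (root_sub_pplus Pb)).
case/memv_sumP => us Us defv.
have [i nzi] : exists i, rproj b (us i) != 0.
  apply/not_existsP => all0; case/eqP: nzv.
  have <- : rproj b v = v by apply: rproj_self.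
  by rewrite defv linear_sum big1 // => i _; apply/eqP/negPn/negP/all0.
exists i; apply: (sub_root_space (Pn_root Pb) (rprojP ssL cartanL b (us i)) nzi).
exact: (rproj_stableL b (@pp_h_stable i) (Us i isT)).
Qed.

Lemma pp_root_uniq b i j : root b -> (rs b <= pp i)%VS -> (rs b <= pp j)%VS -> i = j.
Proof.
move=> rb bi bj; apply/eqP/negPn/negP => neq_ij; have [_ /negP] := andP rb; apply.
by rewrite -subv0 -(direct_sum_disjoint pp_direct neq_ij) subv_cap bi.
Qed.

Lemma pp_Pn b i : root b -> (rs b <= pp i)%VS -> b \in Pn.
Proof. by move=> rb bi; apply: pplus_root rb (subv_trans bi (pp_sub i)). Qed.

Lemma Pk_add_Pn b c : b \in Pk -> c \in Pn -> root (b + c) -> b + c \in Pn.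
Proof.
rewrite addrC => Pb Pc; apply: Pn_add_compact => //; first exact: Pk_root.
by move: Pb; rewrite mem_Pk => /andP[].
Qed.

Lemma Pk_Pn_disjoint a : a \in Pk -> a \in Pn -> False.
Proof.
move=> Pka; have ra := Pk_root Pka; move: Pka.
by rewrite mem_Pk mem_Pn => /andP[_ /(compact_not_p ra)->] /andP[].
Qed.

Lemma Pk_add a b c : b \in Pk -> c \in Pk -> root (b + c) -> b + c \in Pk.
Proof.
move=> Pb Pc rbc; have [rb rc] := (Pk_root Pb, Pk_root Pc).
move: Pb Pc; rewrite !mem_Pk => /andP[Pb bk] /andP[Pc ck].
by rewrite (pos_add posP Pb Pc rbc) (root_bracket_sub rb rc rbc bk ck lie_kk).
Qed.

(** A compact root that is a sum of two positive roots has both summands compact: two noncompact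
    ones have no root as sum, and mixed ones have a noncompact sum. *)
Lemma simple_Pk a : simple_root Pk a -> simple_root P a.
Proof.
move=> [Pka sa]; split=> [|b c Pb Pc abc]; first exact: Pk_pos.
have rbc : root (b + c) by rewrite -abc Pk_root.
have nPn : b + c \in Pn -> False by apply: Pk_Pn_disjoint; rewrite -abc.
case: (pos_parity Pb) (pos_parity Pc) => [kb | nb] [kc | nc].
- exact: sa kb kc abc.
- exact: nPn (Pk_add_Pn kb nc rbc).
- by apply: nPn; rewrite addrC in rbc *; apply: (Pk_add_Pn kc nb rbc).
- by have := Pn_add_not_root nb nc; rewrite rbc.
Qed.

Lemma simple_Pk_of a : simple_root P a -> a \in Pk -> simple_root Pk a.
Proof. by move=> [_ sa] Pka; split=> // b c /Pk_pos Pb /Pk_pos Pc; apply: sa. Qed.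

Lemma beta_vec i : exists v, [/\ v != 0, v \in pp i, v \in rs (tnth beta i) &
  forall a x, a \in Pk -> x \in rs (- a) -> lie x v = 0].
Proof.
by have [v [nzv]] := betaP i; rewrite memv_cap => /andP[vi bv] low; exists v.
Qed.

Lemma beta_Pn i : tnth beta i \in Pn.
Proof.
have [v [nzv vi bv _]] := beta_vec i.
have /mem_pplus v0 := subvP (pp_sub i) v vi.
apply: contraR nzv => /v0; rewrite (rproj_id ssL cartanL _ bv) eqxx => ->.
by [].
Qed.

Lemma beta_sub i : (rs (tnth beta i) <= pp i)%VS.
Proof.
have [v [nzv vi bv _]] := beta_vec i.
exact: (sub_root_space (Pn_root (beta_Pn i)) bv nzv vi).
Qed.

(** In a splitting into a compact a and a noncompact a', the root vectors of -a would carry the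
    lowest weight vector to a nonzero vector of weight a', against lowestness. *)
Lemma beta_simple i : simple_root P (tnth beta i).
Proof.
have Pb := beta_Pn i; split=> [|b c bP cP defb]; first exact: Pn_pos.
have [v [nzv vi bv low]] := beta_vec i.
have rbc : root (b + c) by rewrite -defb Pn_root.
have lowP a a' : a \in Pk -> a' \in Pn -> tnth beta i = a + a' -> False.
  move=> ka na' defb'; have rNa : root (- a) by rewrite (is_rootNE ssL cartanL) Pk_root.
  have [x ax nzx] := root_space_vec rNa.
  have ra' : root (- a + tnth beta i) by rewrite defb' addrA addNr add0r Pn_root.
  have := lie_root_neq0 ssL cartanL rNa (Pn_root Pb) ra' ax bv nzx nzv.
  by rewrite (low a x ka ax) eqxx.
case: (pos_parity bP) (pos_parity cP) => [kb | nb] [kc | nc].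
- by apply: (@Pk_Pn_disjoint (b + c)); [apply: Pk_add | rewrite -defb].
- exact: lowP kb nc defb.
- by apply: lowP kc nb _; rewrite addrC.
- by have := Pn_add_not_root nb nc; rewrite rbc.
Qed.

Lemma beta_inj : injective (tnth beta).
Proof.
move=> i j eq_ij; apply: (pp_root_uniq (Pn_root (beta_Pn i))); first exact: beta_sub.
by rewrite eq_ij beta_sub.
Qed.

Definition acomb (m : 'I_r -> nat) : dual_space h := \sum_(j < r) tnth alpha j *+ m j.

Lemma acombD m n : acomb m + acomb n = acomb (fun j => (m j + n j)%N).
Proof. by rewrite -big_split; apply: eq_bigr => j _; rewrite mulrnDr. Qed.

(** Compact and noncompact roots are treated together, since a noncompact root splits into one of
    each kind. That g is one of the [beta] comes only with [pp_comb]. *)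
Lemma pos_comb b : b \in P ->
  (b \in Pk -> exists m, b = acomb m) /\
  (b \in Pn -> exists g m, [/\ simple_root P g, g \in Pn & b = g + acomb m]).
Proof.
have acomb0 : acomb (fun=> 0%N) = 0 by rewrite /acomb big1.
move: b; apply: (pos_ind ssL cartanL posP) => [a sa | b c Pb Pc Pbc [bk bn] [ck cn]].
  split=> [ka | na]; last by exists a, (fun=> 0%N); rewrite acomb0 addr0.
  have /tnthP[j defa] : a \in alpha by apply/alphaP/simple_Pk_of.
  exists (fun i => (i == j)%N); rewrite /acomb (bigD1 j) //= eqxx -defa big1 ?addr0 //.
  by move=> i /negPf->.
have rbc := pos_root posP Pbc.
case: (pos_parity Pb) (pos_parity Pc) => [kb | nb] [kc | nc].
- have [[m defb] [n defc]] := (bk kb, ck kc).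
  split=> [_ | n']; first by exists (fun j => (m j + n j)%N); rewrite defb defc acombD.
  by case: (@Pk_Pn_disjoint (b + c)) => //; apply: Pk_add.
- have [[m defb] [g [n [sg Pg defc]]]] := (bk kb, cn nc).
  split=> [k' | _]; first by case: (Pk_Pn_disjoint k' (Pk_add_Pn kb nc rbc)).
  exists g, (fun j => (m j + n j)%N); split=> //.
  by rewrite -acombD defb defc addrCA.
- have [[m defc] [g [n [sg Pg defb]]]] := (ck kc, bn nb).
  split=> [k' | _].
    by rewrite addrC in k' rbc; case: (Pk_Pn_disjoint k' (Pk_add_Pn kc nb rbc)).
  exists g, (fun j => (n j + m j)%N); split=> //.
  by rewrite -acombD defb defc addrA.
- by have := Pn_add_not_root nb nc; rewrite rbc.
Qed.

Lemma alpha_simple j : simple_root P (tnth alpha j).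
Proof. by apply: simple_Pk; apply/alphaP; apply: mem_tnth. Qed.

Lemma acomb_span m : acomb m \in <<alpha>>%VS.
Proof. by apply: memv_suml => j _; rewrite rpredMn // memv_span // mem_tnth. Qed.

Lemma simple_nc_unique g g' m m' : simple_root P g -> simple_root P g' ->
  g \in Pn -> g' \in Pn -> g + acomb m = g' + acomb m' -> g = g'.
Proof.
move=> sg sg' ng ng' eqg; apply/eqP/negPn/negP => neqg.
have nalpha a : a \in Pn -> a \notin alpha.
  by move=> na; apply/negP => /alphaP[ka _]; apply: (Pk_Pn_disjoint ka).
have : free [:: g, g' & alpha].
  apply: (simple_free ssL cartanL posP).
    by rewrite /= inE negb_or neqg !nalpha.
  move=> a; rewrite !inE => /or3P[/eqP->|/eqP->|] //.
  by case/tnthP => j ->; apply: alpha_simple.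
rewrite free_cons span_cons => /andP[/negP[]].
have -> : g = g' + (acomb m' - acomb m) by rewrite addrA -eqg addrK.
by rewrite memv_add ?memv_line // memvB ?acomb_span.
Qed.

(** An element of k has components only in h and in compact root spaces. Compact c and noncompact b
    never cancel, so no bracket falls into h. *)
Lemma sum_root_spaces_k_stable (S : seq (dual_space h)) :
    {in S, forall b, root b /\ (rs b <= p)%VS} ->
    (forall b c, b \in S -> root c -> (rs c <= k)%VS -> root (b + c) -> b + c \in S) ->
  forall x v, x \in k -> v \in sum_root_spaces fullv S ->
    lie x v \in sum_root_spaces fullv S.
Proof.
move=> SP addS x v kx; rewrite -adE memv_preim; apply: subvP; apply: sub_seq_sumv => b Sb.
have [rb bp] := SP b Sb; apply/subvP => u bu; rewrite -memv_preim adE.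
have sbS := seq_sumv_sup (fun b => rs b) Sb.
rewrite -[x](rproj_sum ssL cartanL) lieDl lie_suml memvD //.
  rewrite (lie_rs bu); first by rewrite memvZ ?(subvP sbS).
  by rewrite -(mem_rs0 ssL cartanL) rprojP.
rewrite big_seq; apply: memv_suml => c; rewrite mem_roots => rc.
have [-> | nzc] := eqVneq (rproj c x) 0; first by rewrite lie0l mem0v.
have cx : rproj c x \in rs c by apply: rprojP.
have ck : (rs c <= k)%VS.
  exact: (sub_root_space rc cx nzc (rproj_stableL c k_h_stable kx)).
have := lie_mem_rs cx bu; rewrite addrC => bcxu.
have [bc0 | nzbc] := eqVneq (b + c) 0.
  have rNc : root (- c) by rewrite (is_rootNE ssL cartanL).
  have bNc : b = - c by apply/eqP; rewrite -addr_eq0 bc0.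
  by have := compact_not_p rNc (compactN rc ck); rewrite -bNc bp.
have [rbc | nrbc] := boolP (root (b + c)); last first.
  by move: bcxu; rewrite (rs_out nzbc nrbc) memv0 => /eqP->; apply: mem0v.
exact: (subvP (seq_sumv_sup (fun b => rs b) (addS b c Sb rc ck rbc))).
Qed.

(* The noncompact positive roots whose expansion in simple roots involves a
   given noncompact simple root g span a k-submodule, so each irreducible
   submodule of p^+ involves only one g, namely its lowest root. *)
Lemma pp_comb i b g m : root b -> (rs b <= pp i)%VS -> simple_root P g -> g \in Pn ->
  b = g + acomb m -> g = tnth beta i.
Proof.
move=> rb bi sg ng defb.
pose S := [seq c <- Pn | `[< exists n, c = g + acomb n >]].
have memS c : c \in S = `[< exists n, c = g + acomb n >] && (c \in Pn).
  by rewrite mem_filter.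
pose M := sum_root_spaces fullv S.
have SP : {in S, forall b, root b /\ (rs b <= p)%VS}.
  move=> c; rewrite memS => /andP[_ nc]; split; first exact: Pn_root.
  by move: nc; rewrite mem_Pn => /andP[].
have kM : forall x v, x \in k -> v \in M -> lie x v \in M.
  apply: sum_root_spaces_k_stable SP _ => c d; rewrite !memS => /andP[/asboolP[n defc] nc].
  move=> rd dk rcd; have ncd := Pn_add_compact nc rd dk rcd; rewrite ncd andbT.
  apply/asboolP; have [kd | kd] := compact_pos rd dk.
    have [n' defd] := (pos_comb (Pk_pos kd)).1 kd.
    by exists (fun j => (n j + n' j)%N); rewrite -acombD defc defd addrA.
  (* Here -d is positive. The root c + d has its own noncompact simple root g'; adding -d gives back
     c, and independence forces g' = g. *)
  have [n' defd] := (pos_comb (Pk_pos kd)).1 kd.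
  have [g' [n'' [sg' ng' defcd]]] := (pos_comb (Pn_pos ncd)).2 ncd.
  suff -> : g = g' by exists n''.
  apply: (@simple_nc_unique g g' n (fun j => (n'' j + n' j)%N)) => //.
  by rewrite -acombD addrA -defcd -defd -defc addrK.
have Sb : b \in S by rewrite memS (pp_Pn rb bi) andbT; apply/asboolP; exists m.
(* Irreducibility puts all of [pp i] in [M], so its lowest root also involves g; being simple, it is
   g. *)
have ppM : (pp i :&: M)%VS = pp i.
  apply: pp_irreducible; first exact: capvSl.
    by move=> x v kx; rewrite !memv_cap => /andP[vi vM]; rewrite pp_stable ?kM.
  have [v bv nzv] := root_space_vec rb; apply: contraNneq nzv => ppM0.
  rewrite -memv0 -ppM0 memv_cap (subvP bi) //.
  exact: (subvP (seq_sumv_sup (fun b => rs b) Sb)).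
have Sbeta : tnth beta i \in S.
  have [v bv nzv] := root_space_vec (Pn_root (beta_Pn i)).
  have : v \in M.
    by have := subvP (beta_sub i) v bv; rewrite -{1}ppM memv_cap => /andP[].
  have rS : {in S, forall a, root a} by move=> a /SP[].
  move/(mem_sum_root_spaces v rS)/(_ (tnth beta i)).
  rewrite (rproj_id ssL cartanL _ bv) eqxx => v0.
  by apply: contraR nzv => /v0->.
move: Sbeta; rewrite memS => /andP[/asboolP[n defbeta] _].
have acomb0 : acomb (fun=> 0%N) = 0 by rewrite /acomb big1.
apply/esym/(@simple_nc_unique _ g (fun=> 0%N) n) => //.
- exact: beta_simple.
- exact: beta_Pn.
by rewrite acomb0 addr0.
Qed.

Lemma simple_rootsE a : (a \in alpha) || (a \in beta) <-> simple_root P a.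
Proof.
split=> [/orP[/alphaP|/tnthP[i ->]] | sa]; [exact: simple_Pk | exact: beta_simple |].
have [ka | na] := pos_parity (simple_pos sa).
  by apply/orP; left; apply/alphaP/simple_Pk_of.
have ra := Pn_root na; have [i ai] := pp_root_exists na.
have acomb0 : acomb (fun=> 0%N) = 0 by rewrite /acomb big1.
have -> : a = tnth beta i.
  by apply: (@pp_comb i a a (fun=> 0%N)); rewrite // acomb0 addr0.
by rewrite mem_tnth orbT.
Qed.

Definition simples : seq (dual_space h) := alpha ++ beta.

Lemma simplesP a : a \in simples <-> simple_root P a.
Proof. by rewrite mem_cat; apply: simple_rootsE. Qed.

Lemma beta_notin_alpha i : tnth beta i \notin alpha.
Proof.
apply/negP => /alphaP[ka _]; exact: (Pk_Pn_disjoint ka (beta_Pn i)).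
Qed.

Lemma simples_uniq : uniq simples.
Proof.
rewrite cat_uniq alpha_uniq /=; apply/andP; split.
  by apply/hasPn => _ /tnthP[i ->]; apply: beta_notin_alpha.
by rewrite (tuple_map_ord beta) map_inj_uniq ?enum_uniq //; apply: beta_inj.
Qed.

Lemma simples_size : (r + s)%N = \dim h.
Proof.
have [<- _] := simple_coordinates ssL cartanL posP simples_uniq simplesP.
by rewrite size_cat !size_tuple.
Qed.

Lemma simples_free : free simples.
Proof.
by apply: (simple_free ssL cartanL posP simples_uniq) => a /simplesP.
Qed.

Lemma acomb_inj m n : acomb m = acomb n -> m =1 n.
Proof.
move=> eq_mn j; have := simples_free => /catl_free/freeP free_alpha.
have := free_alpha (fun j => (m j)%:R - (n j)%:R).
have -> : \sum_(i < r) ((m i)%:R - (n i)%:R) *: alpha`_i = 0.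
  transitivity (acomb m - acomb n); last by rewrite eq_mn subrr.
  rewrite -sumrB; apply: eq_bigr => i _.
  by rewrite scalerBl !scaler_nat (tnth_nth 0).
move=> /(_ erefl j)/eqP; rewrite subr_eq0 eqr_nat => /eqP.
by [].
Qed.

Lemma noncompact_expansion b : b \in Pn ->
  exists! im : 'I_s * {ffun 'I_r -> nat},
    b = tnth beta im.1 + \sum_(j < r) tnth alpha j *+ im.2 j.
Proof.
move=> nb; have [i bi] := pp_root_exists nb.
have [g [m [sg ng defb]]] := (pos_comb (Pn_pos nb)).2 nb.
have gi := pp_comb (Pn_root nb) bi sg ng defb.
have mE : acomb [ffun j => m j] = acomb m by apply: eq_bigr => j _; rewrite ffunE.
exists (i, [ffun j => m j]); split=> /= [|[i' m'] /= defb'].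
  by rewrite -/(acomb _) mE -gi.
have eq_b : g + acomb m = tnth beta i' + acomb m' by rewrite -defb.
have gi' : g = tnth beta i'.
  exact: simple_nc_unique sg (beta_simple i') ng (beta_Pn i') eq_b.
have eqi : i = i' by apply: beta_inj; rewrite -gi.
rewrite -eqi; congr (_, _); apply/ffunP => j; rewrite ffunE.
by move: eq_b; rewrite -gi' => /addrI/acomb_inj.
Qed.

(** * The center of k *)

Lemma h_normalizerL x : (forall y, y \in h -> lie x y \in h) -> x \in h.
Proof. by have [_ _ _ nh] := cartanL; apply: nh; apply: memvf. Qed.

Local Notation c := (lie_center k).

Lemma center_sub_h : (c <= h)%VS.
Proof.
apply/subvP => x /lie_centerP[kx x0]; apply: h_normalizerL => y hy.
by rewrite x0 ?mem0v // (subvP sub_hk).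
Qed.

(** k is spanned by h and the compact root spaces, and compact positive roots are combinations of
    the [alpha]. *)
Lemma mem_center x : x \in c <-> x \in h /\ forall j, ev (tnth alpha j) x = 0.
Proof.
split=> [cx | [hx x0]].
  have hx := subvP center_sub_h x cx; split=> // j.
  have /alphaP[ka _] := mem_tnth j alpha.
  have [v av nzv] := root_space_vec (Pk_root ka).
  have kv : v \in k by move: ka; rewrite mem_Pk => /andP[_ /subvP]; apply.
  case/lie_centerP: cx => _ /(_ v kv); rewrite (lie_rs av hx) => /eqP.
  by rewrite scaler_eq0 (negPf nzv) orbF => /eqP.
apply/lie_centerP; split=> [|y ky]; first exact: (subvP sub_hk).
have Pk0 a : a \in Pk -> ev a x = 0.
  move=> ka; have [m ->] := (pos_comb (Pk_pos ka)).1 ka.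
  rewrite ev_suml big1 // => j _; elim: (m j) => [|n IHn]; first by rewrite ev0l.
  by rewrite mulrS evDl x0 IHn addr0.
rewrite -[y](rproj_sum ssL cartanL) linearD linear_sum /= big_seq.
rewrite (h_abelianL ssL cartanL hx) ?add0r; last first.
  by rewrite -(mem_rs0 ssL cartanL) rprojP.
apply: big1 => a; rewrite mem_roots => ra.
have [-> | nza] := eqVneq (rproj a y) 0; first by rewrite linear0.
have ay : rproj a y \in rs a by apply: rprojP.
have ak := sub_root_space ra ay nza (rproj_stableL a k_h_stable ky).
rewrite (lie_rs ay hx); suff -> : ev a x = 0 by rewrite scale0r.
have [/Pk0 // | /Pk0/eqP] := compact_pos ra ak.
by rewrite evNl oppr_eq0 => /eqP.
Qed.

Lemma ev_sumr (I : finType) a (q : I -> F) (x : I -> L) :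
  ev a (\sum_i q i *: x i) = \sum_i q i * ev a (x i).
Proof. by rewrite /ev !linear_sum; apply: eq_bigr => i _; rewrite !linearZ. Qed.

(** Fundamental coweights of the noncompact simple roots. As the [alpha] vanish on them they are
    central in k, and they form the basis of the center dual to the [beta]. *)
Lemma beta_coweight_exists i : exists x, [/\ x \in h,
  forall j, ev (tnth alpha j) x = 0 & forall i', ev (tnth beta i') x = (i' == i)%:R].
Proof.
have [_ coords] := simple_coordinates ssL cartanL posP simples_uniq simplesP.
have beta_in i' : tnth beta i' \in simples by rewrite mem_cat mem_tnth orbT.
have [x hx evx] := coords _ (beta_in i); exists x; split=> // [j | i'].
  rewrite evx; last by rewrite mem_cat mem_tnth.
  by case: eqP => // eq_j; have := beta_notin_alpha i; rewrite -eq_j mem_tnth.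
by rewrite evx // (inj_eq beta_inj).
Qed.

Definition coweight i : L := projT1 (cid (beta_coweight_exists i)).

Lemma coweight_h i : coweight i \in h.
Proof. by rewrite /coweight; case: cid => x []. Qed.

Lemma coweight_beta i i' : ev (tnth beta i') (coweight i) = (i' == i)%:R.
Proof. by rewrite /coweight; case: cid => x []. Qed.

Lemma coweight_center i : coweight i \in c.
Proof.
by apply/mem_center; split; [apply: coweight_h | rewrite /coweight; case: cid => x []].
Qed.

Lemma center_expand x : x \in c -> x = \sum_i ev (tnth beta i) x *: coweight i.
Proof.
move=> cx; apply/eqP; rewrite -subr_eq0; apply/eqP.
have cy : x - \sum_i ev (tnth beta i) x *: coweight i \in c.
  by apply: memvB => //; apply: memv_suml => i _; apply/memvZ/coweight_center.
have /mem_center[hy y0] := cy.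
apply: (simple_separate ssL cartanL posP hy) => a /simple_rootsE/orP[/tnthP[j ->] //|].
case/tnthP => i ->; rewrite /ev !linearB /= -!/(ev _ _) ev_sumr.
rewrite (bigD1 i) //= coweight_beta eqxx mulr1 big1 ?addr0 ?subrr // => j neq_ji.
by rewrite coweight_beta eq_sym (negPf neq_ji) mulr0.
Qed.

Lemma coweight_coord q i : ev (tnth beta i) (\sum_j q j *: coweight j) = q i.
Proof.
rewrite ev_sumr (bigD1 i) //= coweight_beta eqxx mulr1 big1 ?addr0 // => j neq_ji.
by rewrite coweight_beta eq_sym (negPf neq_ji) mulr0.
Qed.

Lemma dim_center : s = \dim c.
Proof.
pose X := [tuple coweight i | i < s].
suff basX : basis_of c X by rewrite (size_basis basX).
rewrite basisEfree; apply/and3P; split.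
- apply/freeP => q q0 i; rewrite -[LHS]coweight_coord.
  have <- : \sum_(j < s) q j *: X`_j = \sum_j q j *: coweight j.
    by apply: eq_bigr => j _; rewrite -tnth_nth tnth_mktuple.
  by rewrite q0 /ev !linear0.
- by apply/span_subvP => _ /mapP[i _ ->]; apply: coweight_center.
rewrite size_tuple -[X in (_ <= X)%N](size_tuple X).
apply: leq_trans (dim_span X); apply: dimvS; apply/subvP => x /center_expand ->.
apply: memv_suml => i _; apply/memvZ/memv_span.
by apply/mapP; exists i; rewrite ?mem_enum.
Qed.

Lemma restrict_dualE U a x : x \in U -> restrict_dual U a (vsproj U x) = ev a x :> F.
Proof.
move=> Ux; rewrite /restrict_dual comp_lfunE.
have -> : linfun (fun x : subvs_of U => vsproj h (vsval x))
    = linfun (vsproj h \o vsval) by [].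
by rewrite lfunE /= vsprojK.
Qed.

Lemma beta_restrict_free : free [seq restrict_dual c b | b <- beta].
Proof.
apply/(freeP (X := [tuple of [seq restrict_dual c b | b <- beta]])) => q q0 i.
have sz : (i < size beta)%N by rewrite size_tuple.
have := congr1 (fun a : dual_space c => a (vsproj c (coweight i)) : F) q0.
rewrite /= zero_lfunE sum_lfunE => <-; rewrite (bigD1 i) //= big1 ?addr0.
  rewrite scale_lfunE (nth_map 0) // restrict_dualE ?coweight_center //.
  by rewrite -tnth_nth coweight_beta eqxx [_ *: _]mulr1.
move=> j neq_ji; have szj : (j < size beta)%N by rewrite size_tuple.
rewrite scale_lfunE (nth_map 0) // restrict_dualE ?coweight_center //.
by rewrite -tnth_nth coweight_beta (negPf neq_ji) [_ *: _]mulr0.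
Qed.

(** * The ideals g_i *)

Hypothesis k_generated : k = lie_prod p p.

Let Pi i := roots_in fullv P (pp i).
Let pm i := sum_opp_root_spaces fullv (Pi i).
Let p_ i := (pp i + pm i)%VS.
Let k_ i := lie_prod (p_ i) (p_ i).
Let g_ i := (k_ i + p_ i)%VS.

Let oppPi i := [seq - b | b <- Pi i].
Let Qi i := Pi i ++ oppPi i.

Lemma mem_Pi i b : (b \in Pi i) = (b \in P) && (rs b <= pp i)%VS.
Proof. by rewrite mem_filter andbC. Qed.

Lemma Pi_Pn i b : b \in Pi i -> b \in Pn.
Proof. by rewrite mem_Pi => /andP[Pb bi]; apply: (pp_Pn (pos_root posP Pb) bi). Qed.

Lemma mem_Qi i b : b \in Qi i -> b \in Pi i \/ - b \in Pi i.
Proof.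
rewrite mem_cat => /orP[|/mapP[c ci ->]]; first by left.
by right; rewrite opprK.
Qed.

Lemma Qi_root i b : b \in Qi i -> root b.
Proof.
case/mem_Qi => bi; first exact: Pn_root (Pi_Pn bi).
rewrite -(is_rootNE ssL cartanL); exact: Pn_root (Pi_Pn bi).
Qed.

Lemma Qi_p i b : b \in Qi i -> (rs b <= p)%VS.
Proof.
move=> Qb; have rb := Qi_root Qb; rewrite (compactE rb); apply/negP => bk.
have := compactN rb bk; have rNb : root (- b) by rewrite (is_rootNE ssL cartanL).
case/mem_Qi: Qb => /Pi_Pn; rewrite mem_Pn => /andP[_].
  by rewrite (compactE rb) bk.
by rewrite (compactE rNb) => /negPf->.
Qed.

Lemma ppE i : pp i = sum_root_spaces fullv (Pi i).
Proof.
apply/eqP; rewrite eqEsubv; apply/andP; split; last first.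
  by apply: sub_seq_sumv => b; rewrite mem_Pi => /andP[].
apply/subvP => v vi; apply/mem_sum_root_spaces => [a /Pi_Pn/Pn_root // | b nb].
apply/eqP; apply: contraR nb => nz.
have vb := rproj_stableL b (@pp_h_stable i) vi.
have nPb : b \in Pn.
  have /mem_pplus v0 := subvP (pp_sub i) v vi.
  by apply: contraR nz => /v0->.
rewrite mem_Pi (Pn_pos nPb).
exact: (sub_root_space (Pn_root nPb) (rprojP ssL cartanL b v) nz vb).
Qed.

Lemma pmE i : pm i = sum_root_spaces fullv (oppPi i).
Proof. by rewrite /pm /sum_opp_root_spaces /sum_root_spaces big_map. Qed.

Lemma p_E i : p_ i = sum_root_spaces fullv (Qi i).
Proof. by rewrite /p_ ppE pmE /sum_root_spaces big_cat. Qed.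

Lemma Pi_add_compact i b d : b \in Pi i -> root d -> (rs d <= k)%VS -> root (b + d) ->
  b + d \in Pi i.
Proof.
move=> bi rd dk rbd; have nb := Pi_Pn bi; have rb := Pn_root nb.
have nbd := Pn_add_compact nb rd dk rbd.
move: bi; rewrite !mem_Pi (Pn_pos nbd) => /andP[_ bi] /=.
have rdb : root (d + b) by rewrite addrC; exact: rbd.
by rewrite addrC (root_bracket_sub rd rb rdb dk bi (@pp_stable i)).
Qed.

Lemma p_k_stable i x v : x \in k -> v \in p_ i -> lie x v \in p_ i.
Proof.
rewrite p_E; move: x v; apply: sum_root_spaces_k_stable => [b Qb | b d Qb rd dk rbd].
  by split; [apply: Qi_root Qb | apply: Qi_p Qb].
rewrite mem_cat; case: (mem_Qi Qb) => [bi | Nbi].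
  by rewrite (Pi_add_compact bi rd dk rbd).
apply/orP; right; apply/mapP; exists (- (b + d)); rewrite ?opprK // opprD.
apply: (Pi_add_compact Nbi); first by rewrite (is_rootNE ssL cartanL).
  exact: compactN.
by rewrite -opprD (is_rootNE ssL cartanL).
Qed.

Lemma pp_sub_p_ i : (pp i <= p_ i)%VS. Proof. exact: addvSl. Qed.

Lemma p_sub i : (p_ i <= p)%VS.
Proof. by rewrite p_E; apply: sub_seq_sumv => b; apply: Qi_p. Qed.

Lemma Pn_Pi b : b \in Pn -> exists i, b \in Pi i.
Proof. by move=> nb; have [i bi] := pp_root_exists nb; exists i; rewrite mem_Pi (Pn_pos nb). Qed.

Lemma p_sum : p = (\sum_(i < s) p_ i)%VS.
Proof.
apply/eqP; rewrite eqEsubv; apply/andP; split; last first.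
  by apply/subv_sumP => i _; apply: p_sub.
apply/subvP => v pv; rewrite -[v](rproj_sum ssL cartanL).
have p0 : rproj 0 v = 0.
  apply: kp_disjoint; last exact: (rproj_stableL 0 p_h_stable pv).
  by apply: (subvP sub_hk); rewrite -(mem_rs0 ssL cartanL) rprojP.
rewrite p0 add0r big_seq; apply: memv_suml => b; rewrite mem_roots => rb.
have [-> | nz] := eqVneq (rproj b v) 0; first exact: mem0v.
have bv : rproj b v \in rs b by apply: rprojP.
have bp := sub_root_space rb bv nz (rproj_stableL b p_h_stable pv).
have [i Qb] : exists i, b \in Qi i.
  have [Pb | PNb] := pos_cases posP rb.
    have [i bi] : exists i, b \in Pi i by apply: Pn_Pi; rewrite mem_Pn Pb.
    by exists i; rewrite mem_cat bi.
  have rNb : root (- b) by rewrite (is_rootNE ssL cartanL).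
  have nNb : - b \in Pn.
    rewrite mem_Pn PNb (compactE rNb); apply/negP => /(compactN rNb).
    by rewrite opprK => bk; rewrite (compact_not_p rb bk) in bp.
  have [i Nbi] := Pn_Pi nNb; exists i; rewrite mem_cat; apply/orP; right.
  by apply/mapP; exists (- b); rewrite ?opprK.
apply: (subvP (sumv_sup i _ (subvv _))) => //; rewrite p_E.
exact: (subvP (seq_sumv_sup (fun b => rs b) Qb)).
Qed.

(** If b - d were a root it would be compact, as its root space lies in [p, p]; then b = d + (b - d)
    would belong to the component of d by k-stability. *)
Lemma Pi_sub_not_root i j b d : i != j -> b \in Pi i -> d \in Pi j ->
  b - d != 0 /\ ~~ root (b - d).
Proof.
move=> neq_ij bi dj; have [rb rd] := (Pn_root (Pi_Pn bi), Pn_root (Pi_Pn dj)).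
have [bp dp] : (rs b <= p)%VS /\ (rs d <= p)%VS.
  split; first by apply: (@Qi_p i); rewrite mem_cat bi.
  by apply: (@Qi_p j); rewrite mem_cat dj.
have not_j : (rs b <= pp j)%VS -> False.
  move=> bj; case/eqP: neq_ij; apply: (pp_root_uniq rb) bj.
  by move: bi; rewrite mem_Pi => /andP[].
have bd0 : b - d != 0.
  apply/eqP => /eqP; rewrite subr_eq0 => /eqP bd; apply: not_j.
  by rewrite bd; move: dj; rewrite mem_Pi => /andP[].
split=> //; apply/negP => rbd; apply: not_j.
have rNd : root (- d) by rewrite (is_rootNE ssL cartanL).
have Ndp : (rs (- d) <= p)%VS.
  by apply: (@Qi_p j); rewrite mem_cat; apply/orP; right; apply/mapP; exists d.
have bdk : (rs (b - d)%R <= k)%VS := root_bracket_sub rb rNd rbd bp Ndp lie_pp.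
have bE : d + (b - d) = b by rewrite addrC subrK.
have rbE : root (d + (b - d)) by rewrite bE.
by have := Pi_add_compact dj rbd bdk rbE; rewrite bE mem_Pi => /andP[].
Qed.

(** Up to an overall sign, a sum of signed roots is either a sum inside P_n or a difference across
    components. *)
Lemma Qi_add_not_root i j a b : i != j -> a \in Qi i -> b \in Qi j ->
  a + b != 0 /\ ~~ root (a + b).
Proof.
move=> neq_ij ai bj.
have nn c d : c \in Pn -> d \in Pn -> c + d != 0 /\ ~~ root (c + d).
  move=> nc nd; split; last exact: Pn_add_not_root.
  rewrite addr_eq0; apply: contraTneq (Pn_pos nc) => ->.
  by rewrite (pos_oppN posP (Pn_pos nd)).
have opp c d a' : a' = - (c + d) -> c + d != 0 /\ ~~ root (c + d) ->
    a' != 0 /\ ~~ root a'.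
  by move=> ->; rewrite oppr_eq0 (is_rootNE ssL cartanL).
case: (mem_Qi ai) (mem_Qi bj) => [a1 | a1] [b1 | b1].
- exact: nn (Pi_Pn a1) (Pi_Pn b1).
- by have := Pi_sub_not_root neq_ij a1 b1; rewrite opprK.
- apply: (opp (- a) (- b)); first by rewrite opprD !opprK.
  exact: Pi_sub_not_root neq_ij a1 b1.
- apply: (opp (- a) (- b)); first by rewrite opprD !opprK.
  exact: nn (Pi_Pn a1) (Pi_Pn b1).
Qed.

Lemma p_commute i j u v : i != j -> u \in p_ i -> v \in p_ j -> lie u v = 0.
Proof.
move=> neq_ij; rewrite !p_E => ui vj.
have H b w : b \in Qi j -> w \in rs b -> lie u w = 0.
  move=> bj bw; apply/eqP; rewrite lieC oppr_eq0 -adE -memv_ker.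
  apply: (subvP _ _ ui); apply: sub_seq_sumv => a ai; apply/subvP => z az.
  rewrite memv_ker adE lieC oppr_eq0 -memv0.
  have [nzab nrab] := Qi_add_not_root neq_ij ai bj.
  rewrite -(rs_out nzab nrab); exact: lie_mem_rs az bw.
apply/eqP; rewrite -adE -memv_ker; apply: (subvP _ _ vj); apply: sub_seq_sumv => b bj.
by apply/subvP => w bw; rewrite memv_ker adE (H b w).
Qed.

Lemma k_sub i : (k_ i <= k)%VS.
Proof.
by apply/lie_prodP => u v ui vi; apply: lie_pp; apply: (subvP (p_sub i)).
Qed.

Lemma k_k_stable i x y : x \in k -> y \in k_ i -> lie x y \in k_ i.
Proof.
move=> kx; rewrite -adE memv_preim; apply: subvP; apply/lie_prodP => u v ui vi.
rewrite -memv_preim adE lie_derivation.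
by apply: memvD; apply: mem_lie_prod => //; apply: p_k_stable.
Qed.

Lemma lie_k_0 i v : {in p_ i, forall u, lie v u = 0} -> {in k_ i, forall y, lie v y = 0}.
Proof.
move=> v0 y yi; apply/eqP; rewrite -adE -memv_ker; apply: (subvP _ _ yi).
apply/lie_prodP => u w ui wi; rewrite memv_ker adE lie_derivation !v0 //.
by rewrite lie0l linear0 addr0.
Qed.

Lemma pk_commute i j v y : i != j -> v \in p_ j -> y \in k_ i -> lie v y = 0.
Proof.
move=> neq_ij vj; apply: lie_k_0 => u ui; rewrite eq_sym in neq_ij.
exact: p_commute neq_ij vj ui.
Qed.

Lemma k_commute i j x y : i != j -> x \in k_ j -> y \in k_ i -> lie x y = 0.
Proof.
move=> neq_ij xj; apply: lie_k_0 => u ui; rewrite lieC.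
by rewrite eq_sym in neq_ij; rewrite (pk_commute neq_ij ui xj) oppr0.
Qed.

Lemma g_commute i j x y : i != j -> x \in g_ i -> y \in g_ j -> lie x y = 0.
Proof.
move=> neq_ij; have neq_ji : j != i by rewrite eq_sym.
case/memv_addP => a ak [b bp ->]; case/memv_addP => a' ak' [b' bp' ->].
rewrite lieDl !linearD /= (k_commute neq_ji ak ak') (pk_commute neq_ji bp ak').
rewrite (p_commute neq_ij bp bp') [lie a b']lieC (pk_commute neq_ij bp' ak).
by rewrite oppr0 !addr0.
Qed.

(** The mixed brackets [p_i, p_j] vanish, so k = [p, p] is the sum of the [p_i, p_i]. *)
Lemma k_sum : k = (\sum_(i < s) k_ i)%VS.
Proof.
apply/eqP; rewrite eqEsubv; apply/andP; split; last first.
  by apply/subv_sumP => i _; apply: k_sub.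
rewrite {1}k_generated p_sum; apply/lie_prodP => u v.
case/memv_sumP => us usP ->; case/memv_sumP => vs vsP ->.
rewrite lie_suml; apply: memv_suml => i _; rewrite linear_sum; apply: memv_suml => j _ /=.
have [<- | neq_ij] := eqVneq i j; last first.
  by rewrite (p_commute neq_ij (usP i isT) (vsP j isT)) mem0v.
apply: (subvP (sumv_sup i _ (subvv _))) => //.
by apply: mem_lie_prod; [apply: usP | apply: vsP].
Qed.

Lemma k_sub_g i : (k_ i <= g_ i)%VS. Proof. exact: addvSl. Qed.
Lemma p_sub_g i : (p_ i <= g_ i)%VS. Proof. exact: addvSr. Qed.

Lemma g_sum : fullv = (\sum_(i < s) g_ i)%VS.
Proof.
apply/eqP; rewrite eqEsubv subvf andbT; apply/subvP => x _.
have [y [z [ky pz ->]]] := kp_split x; apply: memvD.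
  move: ky; rewrite k_sum; apply: subvP; apply/subv_sumP => i _.
  by apply: (sumv_sup i) => //; apply: k_sub_g.
move: pz; rewrite p_sum; apply: subvP; apply/subv_sumP => i _.
by apply: (sumv_sup i) => //; apply: p_sub_g.
Qed.

Lemma g_lie i x y : x \in g_ i -> y \in g_ i -> lie x y \in g_ i.
Proof.
case/memv_addP => a ak [b bp ->]; case/memv_addP => a' ak' [b' bp' ->].
have [ka ka'] := (subvP (k_sub i) a ak, subvP (k_sub i) a' ak').
rewrite lieDl !linearD /=.
have gk : {subset k_ i <= g_ i} by apply/subvP/k_sub_g.
have gp : {subset p_ i <= g_ i} by apply/subvP/p_sub_g.
apply: memvD; apply: memvD.
- exact/gk/k_k_stable.
- exact/gp/p_k_stable.
- by rewrite lieC memvN; apply/gp/p_k_stable.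
exact/gk/mem_lie_prod.
Qed.

Lemma g_ideal i x y : y \in g_ i -> lie x y \in g_ i.
Proof.
move=> yi; have : x \in fullv by apply: memvf.
rewrite g_sum => /memv_sumP[xs xsP ->]; rewrite lie_suml; apply: memv_suml => j _.
have [eq_ji | neq_ji] := eqVneq j i; last first.
  by rewrite (g_commute neq_ji (xsP j isT) yi) mem0v.
by apply: g_lie => //; rewrite -eq_ji; apply: xsP.
Qed.

(** An element of one summand that also lies in the sum of the others commutes with everything, and
    the center of g is zero. *)
Lemma g_direct : direct_sum fullv g_.
Proof.
apply: direct_sum_intro g_sum _ => i; apply/eqP; rewrite -subv0; apply/subvP => x.
rewrite memv_cap memv0 => /andP[xi xj]; apply/eqP/(center0 ssL cartanL) => y.
have : y \in fullv by apply: memvf.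
rewrite g_sum => /memv_sumP[ys ysP ->]; rewrite linear_sum big1 // => l _ /=.
have [-> | neq_li] := eqVneq l i; last first.
  by rewrite eq_sym in neq_li; apply: g_commute neq_li xi (ysP l isT).
case/memv_sumP: xj => xs xsP ->; rewrite lie_suml big1 // => j neq_ji.
exact: g_commute neq_ji (xsP j neq_ji) (ysP i isT).
Qed.

Lemma g_lie_ideal i : lie_ideal fullv (g_ i).
Proof. by rewrite /lie_ideal subvf; apply/lie_prodP => x y _; apply: g_ideal. Qed.

Lemma g_theta_stable i : (theta @: g_ i <= g_ i)%VS.
Proof.
apply/subvP => _ /memv_imgP[_ /memv_addP[a ak [b bp ->]] ->]; rewrite linearD /=.
have /eqP-> : theta a == a by rewrite -mem_k (subvP (k_sub i)).
have /eqP-> : theta b == - b by rewrite -mem_p (subvP (p_sub i)).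
by apply: memv_add; rewrite ?memvN.
Qed.

Lemma g_kp_direct i : direct_sum2 (g_ i) (k_ i) (p_ i).
Proof.
apply: direct_sum2_intro; apply/eqP; rewrite -subv0; apply/subvP => x.
rewrite memv_cap memv0 => /andP[xk xp]; apply/eqP.
by apply: kp_disjoint; [apply: (subvP (k_sub i)) | apply: (subvP (p_sub i))].
Qed.

Lemma p_pm_direct i : direct_sum2 (p_ i) (pp i) (pm i).
Proof.
apply: direct_sum2_intro; apply/eqP; rewrite -subv0; apply/subvP => x.
rewrite memv_cap memv0 ppE pmE => /andP[xp xm].
have PiR : {in Pi i, forall a, root a} by move=> a /Pi_Pn/Pn_root.
have NPiR : {in oppPi i, forall a, root a}.
  by move=> a ai; apply: (@Qi_root i); rewrite mem_cat ai orbT.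
have x0 b : rproj b x = 0.
  have [bi | nbi] := boolP (b \in Pi i); last first.
    by move/(mem_sum_root_spaces x PiR): xp; apply.
  move/(mem_sum_root_spaces x NPiR): xm; apply.
  apply/negP => /mapP[d /Pi_Pn/Pn_pos Pd defb].
  by have := pos_oppN posP Pd; rewrite -defb (Pn_pos (Pi_Pn bi)).
by rewrite -[x](rproj_sum ssL cartanL) x0 add0r big1.
Qed.

(** * The Cartan subalgebra and the roots of each ideal *)

Let h_ i := (h :&: g_ i)%VS.

(** For y in h the brackets [t_i, y] lie in different ideals and add up to [t, y] = 0, so each is
    zero; every t_i therefore normalizes h. *)
Lemma h_split t : t \in h -> exists2 ts, (forall i, ts i \in h_ i) & t = \sum_i ts i.
Proof.
move=> ht; have : t \in fullv by apply: memvf.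
rewrite g_sum => /memv_sumP[ts tsP deft]; exists ts => // i.
rewrite memv_cap tsP // andbT; apply: h_normalizerL => y hy.
suff -> : lie (ts i) y = 0 by apply: mem0v.
apply: (direct_sum_indep (us := fun i => lie (ts i) y) g_direct) => [j|].
  by rewrite lieC memvN; apply: g_ideal; apply: tsP.
by rewrite -lie_suml -deft (h_abelianL ssL cartanL).
Qed.

Lemma h__h i t : t \in h_ i -> t \in h. Proof. by rewrite memv_cap => /andP[]. Qed.
Lemma h__g i t : t \in h_ i -> t \in g_ i. Proof. by rewrite memv_cap => /andP[]. Qed.

Lemma g_cartan i : cartan_subalgebra (g_ i) (h_ i).
Proof.
have h0 : {in h_ i &, forall x y, lie x y = 0}.
  by move=> x y hx hy; rewrite (h_abelianL ssL cartanL) ?(h__h hx) ?(h__h hy).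
split; first exact: capvSr.
- by apply/lie_prodP => x y hx hy; rewrite h0 ?mem0v.
- exists 1%N; apply/eqP; rewrite -subv0; apply/lie_prodP => x y hx hy.
  by rewrite h0 ?mem0v.
move=> x gx nx; rewrite memv_cap gx andbT; apply: h_normalizerL => y hy.
have [ys ysP ->] := h_split hy; rewrite linear_sum; apply: memv_suml => j _ /=.
have [-> | neq_ji] := eqVneq j i; first exact: (h__h (nx _ (ysP i))).
by rewrite eq_sym in neq_ji; rewrite (g_commute neq_ji gx (h__g (ysP j))) mem0v.
Qed.

(** Satisfied by the roots whose root space lies in [g_ i]; such functionals are determined by their
    restriction to [h_ i], and restriction then preserves root spaces. *)
Definition supported i a := forall j t, j != i -> t \in h_ j -> ev a t = 0.

Lemma root_supported i a : root a -> (rs a <= g_ i)%VS -> supported i a.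
Proof.
move=> ra ag j t neq_ji tj; have [v av nzv] := root_space_vec ra.
have gv := subvP ag v av; have := lie_rs av (h__h tj).
rewrite (g_commute neq_ji (h__g tj) gv) => /eqP; rewrite eq_sym scaler_eq0.
by rewrite (negPf nzv) orbF => /eqP.
Qed.

(** The ideal contains [e, f] = [tau a], and [[tau a], f] is f times -(a, a), which is nonzero. *)
Lemma ideal_root (I : {vspace L}) a : (forall x y, y \in I -> lie x y \in I) ->
  root a -> (rs a <= I)%VS -> tau a \in I /\ (rs (- a) <= I)%VS.
Proof.
move=> idI ra ag; have [e [f [ae af nze nzf eft]]] := root_triple ssL cartanL ra.
have tg : tau a \in I by rewrite -eft lieC memvN; apply: idI; exact: (subvP ag e ae).
split; first exact: tg.
have rNa : root (- a) by rewrite (is_rootNE ssL cartanL).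
apply: (sub_root_space rNa af nzf).
have : lie (tau a) f \in I by rewrite lieC memvN; apply: idI.
rewrite (lie_rs af (tau_h ssL cartanL a)) => gf.
have nzd : ev (- a) (tau a) != 0.
  by rewrite evNl oppr_eq0 gt_eqF //; apply: dot_root_gt0.
by rewrite -[f](scalerK nzd) memvZ.
Qed.

Lemma tau_g i a : root a -> (rs a <= g_ i)%VS ->
  tau a \in h_ i /\ (rs (- a) <= g_ i)%VS.
Proof.
move=> ra ag; have [tg Ng] := ideal_root (@g_ideal i) ra ag.
by rewrite memv_cap tau_h tg.
Qed.

Let restr i a : dual_space (h_ i) := restrict_dual (h_ i) a.

Lemma restrE i a t : t \in h_ i -> (restr i a (vsproj (h_ i) t) : F) = ev a t.
Proof. exact: restrict_dualE. Qed.

Lemma restr_inj i a b : supported i a -> supported i b -> restr i a = restr i b -> a = b.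
Proof.
move=> sa sb eq_ab; apply: ev_eq => t ht; have [ts tsP ->] := h_split ht.
have evs d : ev d (\sum_i ts i) = \sum_i ev d (ts i).
  by rewrite /ev !linear_sum.
rewrite !evs; apply: eq_bigr => j _; have [-> | neq_ji] := eqVneq j i.
  by rewrite -(restrE a (tsP i)) -(restrE b (tsP i)) eq_ab.
by rewrite (sa j) ?(sb j).
Qed.

Lemma mem_restr_root_space i a v : supported i a ->
  v \in root_space (g_ i) (restr i a) <-> v \in rs a /\ v \in g_ i.
Proof.
move=> sa; split=> [/root_spaceP[gv av] | [av gv]].
  split=> //; apply: mem_rs => t ht; have [ts tsP ->] := h_split ht.
  rewrite lie_suml /ev !linear_sum scaler_suml; apply: eq_bigr => j _ /=.
  rewrite -/(ev _ _); have [-> | neq_ji] := eqVneq j i.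
    by have := av (vsproj (h_ i) (ts i)); rewrite restrE ?vsprojK.
  by rewrite (sa j _ neq_ji (tsP j)) scale0r (g_commute neq_ji (h__g (tsP j)) gv).
apply/root_spaceP; split=> // t; rewrite (lie_rs av (h__h (subvsP t))).
by rewrite -(restrE _ (subvsP t)) vsvalK.
Qed.

Lemma restr_root_space i a : root a -> (rs a <= g_ i)%VS ->
  root_space (g_ i) (restr i a) = rs a.
Proof.
move=> ra ag; have sa := root_supported ra ag; apply/vspaceP => v.
by apply/idP/idP => [/(mem_restr_root_space v sa)[] // | av];
  apply/mem_restr_root_space => //; split=> //; apply: (subvP ag).
Qed.

Lemma restr_is_root i a : root a -> (rs a <= g_ i)%VS -> is_root (g_ i) (restr i a).
Proof.
move=> ra ag; have [_ nza] := andP ra; rewrite /is_root restr_root_space // nza andbT.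
have [ta _] := tau_g ra ag; apply/eqP => a0.
have := dot_root_gt0 ssL cartanL ra; rewrite /dot -(restrE a ta) a0.
by rewrite zero_lfunE ltxx.
Qed.

(** The other [h_ j] kill a root vector of [g_ i], so its line is stable under all of h and it is a
    root vector for h. *)
Lemma is_root_restr i (b : dual_space (h_ i)) : is_root (g_ i) b ->
  exists a, [/\ root a, (rs a <= g_ i)%VS & b = restr i a].
Proof.
case/andP => nzb; rewrite -vpick0; set v := vpick _ => nzv.
have /root_spaceP[gv bv] : v \in root_space (g_ i) b by apply: memv_pick.
have hv : {in h & <[v]>%VS, forall t u, lie t u \in <[v]>%VS}.
  move=> t _ ht /vlineP[q ->]; rewrite linearZ memvZ //=.
  have [ts tsP ->] := h_split ht; rewrite lie_suml; apply: memv_suml => j _.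
  have [-> | neq_ji] := eqVneq j i; last first.
    by rewrite (g_commute neq_ji (h__g (tsP j)) gv) mem0v.
  have := bv (vsproj (h_ i) (ts i)); rewrite vsprojK // => ->.
  by rewrite memvZ ?memv_line.
have [a nza] : exists a, rproj a v != 0.
  apply/not_existsP => all0; case/eqP: nzv.
  rewrite -[v](rproj_sum ssL cartanL) big1 => [|d _]; last exact/eqP/negPn/negP/all0.
  by rewrite addr0; apply/eqP/negPn/negP/all0.
have av : v \in rs a.
  have /vlineP[q defq] := rproj_stableL a hv (memv_line v).
  have nzq : q != 0 by apply: contraNneq nza => q0; rewrite defq q0 scale0r.
  rewrite -[v](scalerK nzq) -defq memvZ //; exact: rprojP.
have bE : b = restr i a.
  apply/lfunP => t; have ht := subvsP t; apply/eqP.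
  have := bv t; rewrite (lie_rs av (h__h ht)) => /eqP.
  rewrite -subr_eq0 -scalerBl scaler_eq0 (negPf nzv) orbF subr_eq0 eq_sym => /eqP->.
  by rewrite -(restrE _ ht) vsvalK.
have nza0 : a != 0.
  by apply: contraNneq nzb => a0; rewrite bE a0 /restr /restrict_dual comp_lfun0l.
have ra := rs_root av nzv nza0; exists a; split=> //.
exact: (sub_root_space ra av nzv gv).
Qed.

Let P_ i := [seq restrict_dual (h_ i) a | a <- roots_in fullv P (g_ i)].

Lemma mem_P_ i a : root a -> (rs a <= g_ i)%VS -> (restr i a \in P_ i) = (a \in P).
Proof.
move=> ra ag; apply/mapP/idP => [[b] | Pa]; last first.
  by exists a; rewrite // mem_filter ag.
rewrite mem_filter => /andP[bg Pb] eq_ab; have rb := pos_root posP Pb.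
suff -> : a = b by [].
by apply: (restr_inj (root_supported ra ag) (root_supported rb bg)).
Qed.

Lemma restrN i a : - restr i a = restr i (- a).
Proof. by rewrite /restr /restrict_dual comp_lfunNl. Qed.

Lemma restrD i a b : restr i a + restr i b = restr i (a + b).
Proof. by rewrite /restr /restrict_dual comp_lfunDl. Qed.

Lemma P_P i (b : dual_space (h_ i)) : b \in P_ i ->
  exists a, [/\ a \in P, (rs a <= g_ i)%VS & b = restr i a].
Proof. by case/mapP => a; rewrite mem_filter => /andP[ag Pa] ->; exists a. Qed.

Lemma g_positive i : positive_system (g_ i) (P_ i).
Proof.
split=> [b /P_P[a [Pa ag ->]] | b /is_root_restr[a [ra ag ->]] | b d].
- exact: restr_is_root (pos_root posP Pa) ag.
- have rNa : root (- a) by rewrite (is_rootNE ssL cartanL).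
  have [_ Nag] := tau_g ra ag.
  rewrite restrN (mem_P_ ra ag) (mem_P_ rNa Nag).
  by case: posP => _ Pxor _; apply: Pxor.
case/P_P => a [Pa ag ->] /P_P[a' [Pa' ag' ->]].
have [ra ra'] := (pos_root posP Pa, pos_root posP Pa').
rewrite restrD => /is_root_restr[e [re eg eq_e]].
have aE : a + a' = e.
  apply: restr_inj eq_e; last exact: root_supported.
  move=> j t neq_ji tj; rewrite evDl (root_supported ra ag neq_ji tj).
  by rewrite (root_supported ra' ag' neq_ji tj) addr0.
rewrite aE (mem_P_ re eg) -aE; apply: (pos_add posP Pa Pa').
by rewrite aE.
Qed.

Lemma pp_sub_g i : (pp i <= g_ i)%VS.
Proof. exact: subv_trans (addvSl _ _) (addvSr _ _). Qed.

(** The stable subspace that witnesses total positivity is [pp i] itself. *)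
Lemma g_totally_positive i (Pn_i := roots_in (g_ i) (P_ i) (p_ i))
    (b : dual_space (h_ i)) :
  b \in Pn_i -> totally_positive (g_ i) (k_ i) Pn_i b.
Proof.
rewrite mem_filter => /andP[bp /P_P[a [Pa ag defb]]]; have ra := pos_root posP Pa.
rewrite defb (restr_root_space ra ag) in bp.
have in_Pn d : d \in Pi i -> restr i d \in Pn_i.
  move=> di; have rd := Pn_root (Pi_Pn di).
  have [Pd di'] : d \in P /\ (rs d <= pp i)%VS by apply/andP; rewrite -mem_Pi.
  have dg := subv_trans di' (pp_sub_g i).
  rewrite mem_filter (restr_root_space rd dg) (mem_P_ rd dg) Pd andbT.
  exact: subv_trans di' (pp_sub_p_ i).
have na : a \in Pn by rewrite mem_Pn Pa (subv_trans bp (p_sub i)).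
have ai : a \in Pi i.
  (* A root vector lying in two different ideals would commute with all of them, hence be central
     and zero. *)
  have [j aj] := Pn_Pi na; have [<- // | neq_ij] := eqVneq j i.
  have [v av nzv] := root_space_vec ra.
  have vj : v \in g_ j.
    by move: aj; rewrite mem_Pi => /andP[_ /subvP aj]; apply/(subvP (pp_sub_g j))/aj.
  case/eqP: nzv; apply: (center0 ssL cartanL) => y.
  have : y \in fullv by apply: memvf.
  rewrite g_sum => /memv_sumP[ys ysP ->]; rewrite linear_sum big1 // => l _ /=.
  have [-> | neq_lj] := eqVneq l j.
    by rewrite eq_sym in neq_ij; apply: g_commute neq_ij (subvP ag v av) (ysP j isT).
  by rewrite eq_sym in neq_lj; apply: g_commute neq_lj vj (ysP l isT).
split; first by rewrite defb; apply: restr_is_root.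
exists (pp i); split.
- by rewrite defb (restr_root_space ra ag); move: ai; rewrite mem_Pi => /andP[].
- rewrite ppE; apply: sub_seq_sumv => d di; have rd := Pn_root (Pi_Pn di).
  have dg : (rs d <= g_ i)%VS.
    by move: di; rewrite mem_Pi => /andP[_ di]; apply: subv_trans di (pp_sub_g i).
  rewrite -(restr_root_space rd dg).
  exact: (seq_sumv_sup (fun e : dual_space (h_ i) => root_space (g_ i) e) (in_Pn d di)).
by apply/lie_prodP => x y /(subvP (k_sub i)); apply: pp_stable.
Qed.

(** * The centers of the k_i and the simplicity of the g_i *)

Lemma center_k_expand i x : x \in lie_center (k_ i) ->
  x \in h_ i /\ x = ev (tnth beta i) x *: coweight i.
Proof.
case/lie_centerP => xk x0.
have cx : x \in c.
  apply/lie_centerP; split=> [|y]; first exact: (subvP (k_sub i)).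
  rewrite k_sum => /memv_sumP[ys ysP ->]; rewrite linear_sum big1 // => j _ /=.
  have [-> | neq_ji] := eqVneq j i; first exact: x0 (ysP i isT).
  exact: k_commute neq_ji xk (ysP j isT).
have hx : x \in h_ i.
  by rewrite memv_cap (subvP center_sub_h _ cx) (subvP (k_sub_g i)).
split=> //; rewrite {1}(center_expand cx) (bigD1 i) //= big1 ?addr0 // => j neq_ji.
have bj := subv_trans (beta_sub j) (pp_sub_g j); rewrite eq_sym in neq_ji.
by rewrite (root_supported (Pn_root (beta_Pn j)) bj neq_ji hx) scale0r.
Qed.

(** The components of the coweight in the [k_ j] are central there, hence multiples of the coweights
    j; the coefficients are its values at [beta], zero except at i. *)
Lemma coweight_center_k i : coweight i \in lie_center (k_ i).
Proof.
have ck := coweight_center i; have /lie_centerP[kH H0] := ck.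
move: (kH); rewrite k_sum => /memv_sumP[ys ysP defH].
have ycent j : ys j \in lie_center (k_ j).
  apply/lie_centerP; split=> [|z zj]; first exact: ysP.
  have := H0 z (subvP (k_sub j) z zj); rewrite defH lie_suml (bigD1 j) //= big1 ?addr0 //.
  by move=> l neq_lj; rewrite eq_sym in neq_lj; apply: k_commute neq_lj (ysP l isT) zj.
have ev_y j : ev (tnth beta j) (ys j) = (j == i)%:R.
  rewrite -(coweight_beta i j) defH /ev !linear_sum (bigD1 j) //= -!/(ev _ _).
  rewrite big1 ?addr0 // => l neq_lj; have [hl _] := center_k_expand (ycent l).
  have bj := subv_trans (beta_sub j) (pp_sub_g j).
  exact: (root_supported (Pn_root (beta_Pn j)) bj neq_lj hl).
suff -> : coweight i = ys i by [].
rewrite {1}defH (bigD1 i) //= big1 ?addr0 // => j neq_ji.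
by have [_ ->] := center_k_expand (ycent j); rewrite ev_y (negPf neq_ji) scale0r.
Qed.

Lemma coweight_neq0 i : coweight i != 0.
Proof.
apply/eqP => H0; have := coweight_beta i i.
by rewrite H0 /ev !linear0 eqxx => /esym/eqP; rewrite oner_eq0.
Qed.

Lemma dim_center_k i : \dim (lie_center (k_ i)) = 1%N.
Proof.
suff -> : lie_center (k_ i) = <[coweight i]>%VS by rewrite dim_vline coweight_neq0.
apply/eqP; rewrite eqEsubv -memvE coweight_center_k andbT; apply/subvP => x.
by case/center_k_expand => _ ->; rewrite memvZ ?memv_line.
Qed.

(** By irreducibility the ideal contains [pp i], then the opposite root spaces by [ideal_root], then
    their brackets. *)
Lemma ideal_contains_g i (I : {vspace L}) : (forall x y, y \in I -> lie x y \in I) ->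
  (pp i :&: I)%VS != 0%VS -> (g_ i <= I)%VS.
Proof.
move=> idI nz; have ppI : (pp i <= I)%VS.
  rewrite -(pp_irreducible (capvSl (pp i) I) _ nz) ?capvSr //.
  by move=> x v kx; rewrite !memv_cap => /andP[vi vI]; rewrite pp_stable ?idI.
have pI : (p_ i <= I)%VS.
  rewrite subv_add ppI pmE; apply: sub_seq_sumv => _ /mapP[b bi ->].
  have bI : (rs b <= I)%VS.
    by move: bi; rewrite mem_Pi => /andP[_ bi]; apply: subv_trans bi ppI.
  by have [] := ideal_root idI (Pn_root (Pi_Pn bi)) bI.
rewrite subv_add pI andbT; apply/lie_prodP => u v _ vi.
by apply: idI; apply: (subvP pI).
Qed.

(** An ideal of [g_ i] is an ideal of g. If it misses [pp i] it contains no root space of [p_ i], so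
    it lies in k, commutes with [p_ i], and is central. *)
Lemma g_simple i : simple_algebra (g_ i).
Proof.
(* [g_i, g_i] is nonzero because it contains [k_ i] and hence the coweight. *)
split=> [gg0 | I /andP[sIg /lie_prodP gI]].
  have kg : (k_ i <= lie_prod (g_ i) (g_ i))%VS by apply: lie_prodS; apply: p_sub_g.
  have /lie_centerP[ki _] := coweight_center_k i.
  by have := subvP kg _ ki; rewrite gg0 memv0 (negPf (coweight_neq0 i)).
have idI x y : y \in I -> lie x y \in I.
  move=> Iy; have : x \in fullv by apply: memvf.
  rewrite g_sum => /memv_sumP[xs xsP ->]; rewrite lie_suml; apply: memv_suml => j _.
  have [-> | neq_ji] := eqVneq j i; first exact: gI (xsP i isT) Iy.
  by rewrite (g_commute neq_ji (xsP j isT) (subvP sIg y Iy)) mem0v.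
have [ppI | nzppI] := eqVneq (pp i :&: I)%VS 0%VS; last first.
  by right; apply/eqP; rewrite eqEsubv sIg ideal_contains_g.
left; have hI : {in h & I, forall x v, lie x v \in I} by move=> x v _; apply: idI.
have Qi_not_in b : b \in Qi i -> (rs b <= I)%VS -> False.
  move=> Qb bI; have rb := Qi_root Qb.
  have [b' [bi' b'I]] : exists b', b' \in Pi i /\ (rs b' <= I)%VS.
    case/mem_Qi: Qb => bi; first by exists b.
    by exists (- b); have [_ NbI] := ideal_root idI rb bI.
  have rb' := Pn_root (Pi_Pn bi'); have [_ /negP] := andP rb'; apply.
  rewrite -subv0 -ppI subv_cap b'I andbT.
  by move: bi'; rewrite mem_Pi => /andP[].
have sIk : (I <= k)%VS.
  (* A component of x at a root of [p_ i] must vanish; at any other weight it comes from the [k_ i]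
     part alone. *)
  apply/subvP => x Ix; have kb b : rproj b x \in k.
    have xI := rproj_stableL b hI Ix.
    have /memv_addP[a ak [u ui defx]] := subvP sIg x Ix.
    have [Qb | nQb] := boolP (b \in Qi i).
      have [-> | nz] := eqVneq (rproj b x) 0; first exact: mem0v.
      have rb := Qi_root Qb; case: (Qi_not_in b Qb).
      exact: (sub_root_space rb (rprojP ssL cartanL b x) nz xI).
    have QR : {in Qi i, forall d, root d} by move=> d /Qi_root.
    rewrite p_E in ui; have /(mem_sum_root_spaces u QR)/(_ b nQb) ub := ui.
    rewrite defx linearD /= ub addr0; apply: (rproj_stableL b k_h_stable).
    exact: (subvP (k_sub i)).
  by rewrite -[x](rproj_sum ssL cartanL) memvD //; apply: memv_suml => b _.
apply/eqP; rewrite -subv0; apply/subvP => x Ix; rewrite memv0.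
(* The bracket is in k because it stays in the ideal, and in p because x is in k. *)
have xp u : u \in p_ i -> lie x u = 0.
  move=> ui; apply: kp_disjoint.
    by apply: (subvP sIk); rewrite lieC memvN; apply: idI.
  by apply: lie_kp; [apply: (subvP sIk) | apply: (subvP (p_sub i))].
apply/eqP/(center0 ssL cartanL) => y; have : y \in fullv by apply: memvf.
rewrite g_sum => /memv_sumP[ys ysP ->]; rewrite linear_sum big1 // => j _ /=.
have [-> | neq_ji] := eqVneq j i; last first.
  by rewrite eq_sym in neq_ji; apply: g_commute neq_ji (subvP sIg x Ix) (ysP j isT).
case/memv_addP: (ysP i isT) => a ak [u ui ->]; rewrite linearD /= (xp u ui) addr0.
exact: lie_k_0 xp a ak.
Qed.

End HermitianPair.

(* p^+ is multiplicity free: an irreducible submodule is the one that contains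
   any of its root spaces. *)
Lemma irreducible_decomposition_leq (F : numClosedFieldType) (L : lieAlgType F)
    (theta : 'End(L)) (k h : {vspace L}) (P : seq (dual_space h))
    (pplus := sum_root_spaces fullv (roots_in fullv P (passmx.leigenspace theta (-1))))
    m n (q : 'I_m -> {vspace L}) (q' : 'I_n -> {vspace L}) :
    semisimple_algebra (fullv : {vspace L}) -> cartan_subalgebra fullv h ->
    positive_system fullv P -> (h <= k)%VS ->
    irreducible_decomposition k pplus q -> irreducible_decomposition k pplus q' ->
  (m <= n)%N.
Proof.
move=> ssL cartanL posP hk qP q'P.
have same i : exists j, q i = q' j.
  have [b nb bi] := pp_has_root ssL cartanL posP hk qP i.
  have [j bj] := pp_root_exists ssL cartanL posP hk q'P nb.
  exists j; have nz : (q i :&: q' j)%VS != 0%VS.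
    have [v av nzv] := root_space_vec ssL cartanL (Pn_root posP nb).
    apply: contraNneq nzv => qq0; rewrite -memv0 -qq0 memv_cap.
    by rewrite (subvP bi v av) (subvP bj v av).
  have kqq x v : x \in k -> v \in (q i :&: q' j)%VS -> lie x v \in (q i :&: q' j)%VS.
    by move=> kx; rewrite !memv_cap => /andP[vi vj]; rewrite (pp_stable qP) ?(pp_stable q'P).
  rewrite -(pp_irreducible qP (capvSl _ _) kqq nz).
  exact: (pp_irreducible q'P (capvSr _ _) kqq nz).
pose f i := projT1 (cid (same i)).
have fE i : q i = q' (f i) by rewrite /f; case: cid.
have f_inj : injective f.
  move=> i j eq_f; have [b nb bi] := pp_has_root ssL cartanL posP hk qP i.
  apply: (pp_root_uniq qP (Pn_root posP nb) bi).
  by rewrite fE -eq_f -fE.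
by have := leq_card f f_inj; rewrite !card_ord.
Qed.

Lemma irreducible_decomposition1 (F : fieldType) (L : lieAlgType F) (k V : {vspace L}) :
  irreducible_module k V -> irreducible_decomposition k V (fun _ : 'I_1 => V).
Proof.
move=> irrV; split=> //; apply: direct_sum_intro => [|i]; first by rewrite big_ord1.
by rewrite big1 ?capv0 // => j; rewrite !ord1 eqxx.
Qed.

Theorem theorem2p8 (R : realType) (L : lieAlgType R[i])
    (theta : 'End(L)) (k h : {vspace L}) (P : seq (dual_space h))
    (r s : nat) (alpha : r.-tuple (dual_space h)) (beta : s.-tuple (dual_space h))
    (pp : 'I_s -> {vspace L}) :
  let g : {vspace L} := fullv in
  let p := passmx.leigenspace theta (-1) in
  let Pk := roots_in g P k in
  let Pn := roots_in g P p in
  let pplus := sum_root_spaces g Pn in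
  let pm i := sum_opp_root_spaces g (roots_in g P (pp i)) in
  let c := lie_center k in
  let p_ i := (pp i + pm i)%VS in
  let k_ i := lie_prod (p_ i) (p_ i) in
  let g_ i := (k_ i + p_ i)%VS in
  let h_ i := (h :&: g_ i)%VS in
  let P_ i := [seq restrict_dual (h_ i) a | a <- roots_in g P (g_ i)] in
  harish_chandra_pair theta k ->
  (exists n : nat, has_rank g n /\ has_rank k n) ->
  (h <= k)%VS -> cartan_subalgebra g h -> cartan_subalgebra k h ->
  positive_system g P ->
  (forall b, b \in Pn <-> totally_positive g k Pn b) ->
  k = lie_prod p p ->
  uniq alpha -> (forall a, a \in alpha <-> simple_root Pk a) ->
  irreducible_decomposition k pplus pp ->
  (forall i, lowest_weight g Pk (pp i) (tnth beta i)) ->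
  (forall a, (a \in alpha) || (a \in beta) <-> simple_root P a)
  /\ [/\
    (* (a) *)
    (r + s)%N = \dim h,
    (* (b) *)
    [/\ s = \dim c, (c <= h)%VS & free [seq restrict_dual c b | b <- beta]],
    (* (c) *)
    (forall b, b \in Pn ->
       exists! im : 'I_s * {ffun 'I_r -> nat},
         b = tnth beta im.1 + \sum_(j < r) tnth alpha j *+ im.2 j)
    /\ lie_prod pplus pplus = 0%VS,
    (* (d) *)
    [/\ direct_sum g g_,
        forall i, [/\ lie_ideal g (g_ i), (theta @: g_ i <= g_ i)%VS,
                      direct_sum2 (g_ i) (k_ i) (p_ i) &
                      direct_sum2 (p_ i) (pp i) (pm i)],
        forall i,
          [/\ cartan_subalgebra (g_ i) (h_ i), positive_system (g_ i) (P_ i) &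
              let Pn_i := roots_in (g_ i) (P_ i) (p_ i) in
              forall b, b \in Pn_i -> totally_positive (g_ i) (k_ i) Pn_i b],
        forall i, \dim (lie_center (k_ i)) = 1%N &
        forall i, simple_algebra (g_ i)] &
    (* (e) *)
    (forall t (q : 'I_t -> {vspace L}),
       irreducible_decomposition k pplus q -> t = s)
    /\ (simple_algebra g <-> irreducible_module k pplus)].
Proof.
move=> g p Pk Pn pplus pm c p_ k_ g_ h_ P_ [ssL thetaP k_fixed _] _ hk cartanL _ posP tot.
move=> k_gen alpha_uniq alphaP ppP betaP.
have leq_dec := irreducible_decomposition_leq ssL cartanL posP hk.
have gP : direct_sum g g_ := g_direct ssL cartanL posP thetaP k_fixed hk tot ppP k_gen.
have simpleP i : simple_algebra (g_ i).
  exact: (g_simple ssL cartanL posP thetaP k_fixed hk tot alpha_uniq alphaP ppP betaP k_gen).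
split.
  exact: (simple_rootsE ssL cartanL posP thetaP k_fixed hk tot alpha_uniq alphaP ppP betaP).
split.
- exact: (simples_size ssL cartanL posP thetaP k_fixed hk tot alpha_uniq alphaP ppP betaP).
- split.
    exact: (dim_center ssL cartanL posP thetaP k_fixed hk tot alpha_uniq alphaP ppP betaP).
    exact: (center_sub_h cartanL hk).
  exact: (beta_restrict_free ssL cartanL posP thetaP k_fixed hk tot alpha_uniq alphaP ppP betaP).
- split; last exact: (pplus_abelian ssL cartanL posP thetaP k_fixed hk tot).
  exact: (noncompact_expansion ssL cartanL posP thetaP k_fixed hk tot alpha_uniq alphaP ppP betaP).
- split=> // i.
  + split.
    * exact: (g_lie_ideal ssL cartanL posP thetaP k_fixed hk tot ppP k_gen).
    * exact: (g_theta_stable ssL cartanL posP thetaP k_fixed hk ppP).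
    * exact: (g_kp_direct ssL cartanL posP thetaP k_fixed hk ppP).
    * exact: (p_pm_direct ssL cartanL posP hk ppP).
  + split.
    * exact: (g_cartan ssL cartanL posP thetaP k_fixed hk tot ppP k_gen).
    * exact: (g_positive ssL cartanL posP thetaP k_fixed hk tot ppP k_gen).
    * exact: (g_totally_positive ssL cartanL posP thetaP k_fixed hk tot ppP k_gen).
  + exact: (dim_center_k ssL cartanL posP thetaP k_fixed hk tot alpha_uniq alphaP ppP betaP k_gen).
split=> [t q qP | ].
  by apply/eqP; rewrite eqn_leq (leq_dec _ _ _ _ _ qP ppP) (leq_dec _ _ _ _ _ ppP qP).
split=> [[gg0 simpleL] | irr].
  (* When g is simple every nonzero ideal [g_ i] is all of g; two of them cannot form a direct
     sum. *)
  have gE i : g_ i = fullv.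
    have [gi0|//] := simpleL (g_ i)
      (g_lie_ideal ssL cartanL posP thetaP k_fixed hk tot ppP k_gen i).
    case: (simpleP i) => nz _; case: nz; apply/eqP; rewrite -subv0 gi0.
    by apply/lie_prodP => x y; rewrite memv0 => /eqP-> _; rewrite lie0l mem0v.
  (* The case s = 0 has to be excluded: g would be an empty sum, against [g, g] nonzero. *)
  have [i0 | none] := pselect (exists i : 'I_s, True); last first.
    case: gg0; apply/eqP; rewrite -subv0; case: gP => -> _.
    rewrite big1 => [|i _]; last by case: none; exists i.
    by apply/lie_prodP => x y; rewrite memv0 => /eqP-> _; rewrite lie0l mem0v.
  have {i0}[i _] := i0.
  have all_i j : j = i.
    apply/eqP/negPn/negP => neq_ji.
    have L0 : (g_ j :&: g_ i = 0)%VS := direct_sum_disjoint (proj2 gP) neq_ji.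
    rewrite !gE capvv in L0; case: gg0; apply/eqP; rewrite -subv0 /g L0.
    by apply/lie_prodP => x y; rewrite memv0 => /eqP-> _; rewrite lie0l mem0v.
  have -> : pplus = pp i.
    apply: etrans (pp_sum ppP) _; rewrite (bigD1 i) //= big1 ?addv0 // => j.
    by rewrite (all_i j) eqxx.
  by case: ppP => _; apply.
(* An irreducible p^+ is a decomposition with one term, so s = 1 by uniqueness and g is its single
   ideal. *)
have dec1 := irreducible_decomposition1 irr.
have s1 : s = 1%N.
  by apply/eqP; rewrite eqn_leq (leq_dec _ _ _ _ _ ppP dec1) (leq_dec _ _ _ _ _ dec1 ppP).
have i0 : 'I_s by rewrite s1; apply: ord0.
have all_i0 (j : 'I_s) : j = i0.
  by apply/val_inj; case: j i0 => [j ltj] [l ltl] /=; move: ltj ltl; rewrite s1; case: j l => [[]|].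
suff -> : g = g_ i0 by apply: simpleP.
case: gP => -> _; rewrite (bigD1 i0) //= big1 ?addv0 // => j.
by rewrite (all_i0 j) eqxx.
Qed.
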